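(* Let $F$ be a double-well potential satisfying the standing assumptions listed in the context, with $F(x_0)<F(x_1)$, and let $0<\rho<|x_0|\wedge x_1$. For each $\varepsilon>0$ let $(\xi_0,\xi_1)=(\xi_{0,\varepsilon},\xi_{1,\varepsilon})$ be an admissible pair and let $(X,Y)=(X_\varepsilon,Y_\varepsilon)$ be the corresponding coupled process. Then the four conditions (1) $P(X_\varepsilon(t)<0\mid Y_\varepsilon(t)=0)\to1$ as $\varepsilon\to0$, for each $t\ge0$, (2) $P(X_\varepsilon(t)>0\mid Y_\varepsilon(t)=1)\to1$ as $\varepsilon\to0$, for each $t\ge0$, (3) $E^1[\tau^{Y_\varepsilon}_0]\sim E^{x_1}[\tau^{X_\varepsilon}_{B_\rho(x_0)}]$ as $\varepsilon\to0$, (4) $E^0[\tau^{Y_\varepsilon}_1]\sim E^{x_0}[\tau^{X_\varepsilon}_{B_\rho(x_1)}]$ as $\varepsilon\to0$, all hold if and only if $\xi_0\sim-\eta(\infty)^{-1}$ and $\xi_1\sim|\eta(-\infty)|^{-1}$ as $\varepsilon\to0$.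
   Context: Notation: $a_\varepsilon\sim b_\varepsilon$ means $a_\varepsilon/b_\varepsilon\to1$ as $\varepsilon\to0$. $B_\rho(x)$ is the ball (interval) of radius $\rho$ centered at $x$. For a cadlag process $Z$ and a set $H$, $\tau^Z_H=\inf\{t>0:Z(t)\in H\text{ or }Z(t-)\in H\}$, and $\tau^Z_z=\tau^Z_{\{z\}}$. $E^{x}[\tau^X_H]$ is the expectation when the diffusion $X$ starts at $x$; $E^{j}[\tau^Y_i]$ is the expectation when the Markov chain $Y$ starts at $j$. Standing assumptions on $F$: $F\in C^3(\mathbb{R})$, $F(x)\to\infty$ as $|x|\to\infty$; there are constants $a_1,a_2,c_1,c_2,c_3,c_4>0$ with $a_2<2a_1-2$ such that for all $x$, $c_1|x|^{a_1}-c_2\le |F'(x)|^2\le c_3|x|^{a_2}+c_4$ and $c_1|x|^{a_1}-c_2\le(|F'(x)|-2F''(x))^2\le c_3|x|^{a_2}+c_4$. There are points $x_0<0<x_1$ such that $F$ is strictly decreasing on $(-\infty,x_0)$ and $(0,x_1)$, strictly increasing on $(x_0,0)$ and $(x_1,\infty)$, $F''(x_0)>0$, $F''(0)<0$, $F''(x_1)>0$, and $F(x_0)<F(x_1)$. Eigenfunction: for each $\varepsilon>0$ put $\mu(dx)=e^{-F(x)/\varepsilon}dx$, $\varpi=\mu(\mathbb{R})^{-1}\mu$, and $Af=\varepsilon f''-F'f'$. Let $-\lambda=-\lambda_\varepsilon<0$ be the second eigenvalue of $A$ in $L^2(\varpi)$ (the first is $0$, with constant eigenfunctions) and $\eta=\eta_\varepsilon$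 a corresponding eigenfunction, so $\varepsilon\eta''-F'\eta'=-\lambda\eta$. It is known that $\eta$ is continuous and bounded and, with the sign of $\eta$ suitably fixed, there is $r_\varepsilon\in\mathbb{R}$ with $\eta<0$ on $(-\infty,r_\varepsilon)$, $\eta(r_\varepsilon)=0$, $\eta>0$ on $(r_\varepsilon,\infty)$, and $\eta$ is strictly increasing. Write $\eta(\pm\infty)=\lim_{x\to\pm\infty}\eta(x)$ (finite). Coupling: a pair $(\xi_0,\xi_1)\in\mathbb{R}^2$ (depending on $\varepsilon$) is admissible if $-1/\eta(\infty)\le\xi_j\le1/|\eta(-\infty)|$ for $j=0,1$ and $\xi_0\xi_1<0$. Given an admissible pair set $a_j=\lambda\xi_j/(\xi_j-\xi_{1-j})>0$, $Q=\begin{pmatrix} -a_0 & a_0 \\ a_1 & -a_1 \end{pmatrix}$ (rows and columns indexed by $0,1$), and $\alpha_j=1+\xi_j\eta>0$. Choose any probability vector $p=(p_0,p_1)$, and let $(X_\varepsilon,Y_\varepsilon)$ be the cadlag Markov process on $\mathbb{R}\times\{0,1\}$ with initial distribution $\nu(\Gamma\times\{i\})=p_i\int_\Gamma\alpha_i\,d\varpi$ and generator $Bf(x,i)=Af(\cdot,i)(x)+\sum_{j\ne i}Q_{ij}\frac{\alpha_j(x)}{\alpha_i(x)}(f(x,j)-f(x,i))$. It is known that $X_\varepsilon$ solves $X_\varepsilon(t)=X_\varepsilon(0)-\int_0^tF'(X_\varepsilon(s))ds+\sqrt{2\varepsilon}\,W(t)$ with $W$ a standard Brownian motion, that $Y_\varepsilon$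 is a continuous-time Markov chain with generator $Q$, and that $P(X_\varepsilon(t)\in\Gamma\mid Y_\varepsilon(t)=j)=\int_\Gamma\alpha_j\,d\varpi=\varpi(\Gamma)+\xi_j\int_\Gamma\eta\,d\varpi$ for all $t\ge0$, $j\in\{0,1\}$ and Borel $\Gamma\subset\mathbb{R}$ (this formula is taken as the meaning of the conditional law if $P(Y_\varepsilon(t)=j)=0$). Dependence on $\varepsilon$ is suppressed in the notation. *)

(* Defs.v *)
From HB Require Import structures.
From mathcomp Require Import all_boot all_order all_algebra.
From mathcomp Require Import all_classical all_reals all_analysis.

Set Implicit Arguments.
Unset Strict Implicit.
Unset Printing Implicit Defensive.

Import Order.TTheory GRing.Theory Num.Theory.
Import numFieldNormedType.Exports.

Local Open Scope classical_set_scope.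
Local Open Scope ring_scope.

(* The index set {0, 1} is [bool], with [false] for 0, [true] for 1 and
   [~~ j] for 1 - j; this type carries the discrete topology and
   sigma-algebra in the library. Time runs over the nonnegative elements of R;
   the values of a process at negative times are irrelevant. *)

Definition class_C (R : realType) (n : nat) (f : R -> R) : Prop :=
  (forall k x, (k < n)%N -> derivable (derive1n k f) x 1) /\
  continuous (derive1n n f).

Definition class_Cc (R : realType) (n : nat) (f : R -> R) : Prop :=
  class_C n f /\ exists M : R, forall x, M < `|x| -> f x = 0.

Section Potential.
Context {R : realType}.
Implicit Types (F f eta : R -> R) (eps : R).

Definition growth_conditions F : Prop :=
  exists a1 a2 c1 c2 c3 c4 : R,
    [/\ [/\ 0 < a1, 0 < a2 & a2 < 2 * a1 - 2],
        [/\ 0 < c1, 0 < c2, 0 < c3 & 0 < c4],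
        forall x, c1 * `|x| `^ a1 - c2 <= `|derive1 F x| ^+ 2
                    <= c3 * `|x| `^ a2 + c4
      & forall x, c1 * `|x| `^ a1 - c2 <= (`|derive1 F x| - 2 * derive1n 2 F x) ^+ 2
                    <= c3 * `|x| `^ a2 + c4].

Definition double_well F (x0 x1 : R) : Prop :=
  [/\ class_C 3 F,
      F x @[x --> +oo] --> +oo /\ F x @[x --> -oo] --> +oo,
      growth_conditions F,
      x0 < 0 < x1
    & [/\ (forall x y, x < y -> y < x0 -> F y < F x) /\
          (forall x y, 0 < x -> x < y -> y < x1 -> F y < F x),
          (forall x y, x0 < x -> x < y -> y < 0 -> F x < F y) /\
          (forall x y, x1 < x -> x < y -> F x < F y),
          [/\ 0 < derive1n 2 F x0, derive1n 2 F 0 < 0 & 0 < derive1n 2 F x1]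
        & F x0 < F x1]].

(* [gibbs_int F eps A g] is the integral of g over A with respect to varpi,
   the normalization of the measure exp(- F x / eps) dx. *)
Definition gibbs_int F eps (A : set R) (g : R -> R) : R :=
  (\int[lebesgue_measure]_(x in A) (g x * expR (- F x / eps))) /
  (\int[lebesgue_measure]_(x in [set: R]) expR (- F x / eps)).

Definition diffusion_generator F eps f (x : R) : R :=
  eps * derive1n 2 f x - derive1 F x * derive1 f x.

(* A classical solution of A f = kappa f lying in L^2(varpi). Since F is C^3,
   every L^2 eigenfunction of A has a C^2 version, so the regularity required
   here is not a restriction. *)
Definition eigenfunction F eps (kappa : R) f : Prop :=
  [/\ exists x, f x != 0,
      forall x, derivable f x 1 /\ derivable (derive1 f) x 1,
      lebesgue_measure.-integrable [set: R]
        (fun x => (f x ^+ 2 * expR (- F x / eps))%:E)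
    & forall x, diffusion_generator F eps f x = kappa * f x].

(* The first (largest) eigenvalue is 0. *)
Definition second_eigenvalue F eps (kappa : R) : Prop :=
  [/\ kappa < 0,
      exists f, eigenfunction F eps kappa f
    & forall kappa' f, eigenfunction F eps kappa' f -> kappa' < 0 ->
        kappa' <= kappa].

Definition at_pinfty eta : R := lim (eta x @[x --> +oo]).
Definition at_ninfty eta : R := lim (eta x @[x --> -oo]).

(* Fixes the sign of the eigenfunction, together with the properties that
   every second eigenfunction so signed is known to have. *)
Definition oriented eta : Prop :=
  [/\ continuous eta,
      exists M, forall x, `|eta x| <= M,
      exists r, [/\ forall x, x < r -> eta x < 0, eta r = 0
                  & forall x, r < x -> 0 < eta x]
    & {homo eta : x y / x < y}].

End Potential.

Section Coupling.
Context {R : realType}.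
Implicit Types (F eta : R -> R) (eps lambda : R) (xi a : bool -> R).

Definition admissible eta xi : Prop :=
  (forall j, - (at_pinfty eta)^-1 <= xi j <= `|at_ninfty eta|^-1) /\
  xi false * xi true < 0.

Definition rate lambda xi (j : bool) : R :=
  lambda * xi j / (xi j - xi (~~ j)).

Definition rate_matrix a (i j : bool) : R := if i == j then - a i else a i.

Definition tilt eta xi (j : bool) (x : R) : R := 1 + xi j * eta x.

Definition coupled_generator F eps (Q : bool -> bool -> R)
    (alpha : bool -> R -> R) (f : R * bool -> R) (z : R * bool) : R :=
  diffusion_generator F eps (fun x => f (x, z.2)) z.1 +
  \sum_(j | j != z.2)
     Q z.2 j * (alpha j z.1 / alpha z.2 z.1) * (f (z.1, j) - f z).

End Coupling.

Section Processes.
Context {R : realType}.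

Definition cadlag (S : topologicalType) (z : R -> S) : Prop :=
  forall t : R, 0 <= t ->
    z s @[s --> t^'+] --> z t /\
    (0 < t -> exists l : S, z s @[s --> t^'-] --> l).

Definition hitting_time (S : topologicalType) (z : R -> S) (H : set S)
    : \bar R :=
  ereal_inf [set t%:E | t in
    [set t : R | 0 < t /\
       (H (z t) \/ exists2 l : S, H l & z s @[s --> t^'-] --> l)]].

Definition mean_hitting_time (d : measure_display) (T : measurableType d)
    (P : probability T R) (S : topologicalType) (Z : R -> T -> S) (H : set S)
    : \bar R :=
  (\int[P]_w hitting_time (Z ^~ w) H)%E.

Definition natural_filtration (d d' : measure_display) (T : measurableType d)
    (S : measurableType d') (Z : R -> T -> S) (t : R) : set (set T) :=
  <<s [set A | exists s B, [/\ 0 <= s <= t, measurable B & A = Z s @^-1` B]] >>.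

Definition filtration (d : measure_display) (T : measurableType d)
    (G : R -> set (set T)) : Prop :=
  (forall t, sigma_algebra [set: T] (G t) /\ G t `<=` measurable) /\
  (forall s t, s <= t -> G s `<=` G t).

Definition adapted (d d' : measure_display) (T : measurableType d)
    (S : measurableType d') (G : R -> set (set T)) (Z : R -> T -> S) : Prop :=
  forall t B, 0 <= t -> measurable B -> G t (Z t @^-1` B).

(* [normal_prob m s] has standard deviation s. *)
Definition brownian_motion (d : measure_display) (T : measurableType d)
    (P : probability T R) (G : R -> set (set T)) (W : R -> T -> R) : Prop :=
  [/\ adapted G W,
      forall w, W 0 w = 0,
      forall w, {within `[0, +oo[, continuous (W ^~ w)}
    & forall s t A (B : set R), 0 <= s < t -> G s A -> measurable B ->
        P (A `&` [set w | B (W t w - W s w)]) =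
        (P A * normal_prob 0 (Num.sqrt (t - s)) B)%E].

Definition diffusion_from (F : R -> R) (eps x : R) (d : measure_display)
    (T : measurableType d) (P : probability T R) (X : R -> T -> R) : Prop :=
  exists (G : R -> set (set T)) (W : R -> T -> R),
    [/\ filtration G /\ brownian_motion P G W,
        adapted G X,
        forall w, X 0 w = x,
        forall w, {within `[0, +oo[, continuous (X ^~ w)}
      & {ae P, forall w, forall t, 0 <= t ->
          X t w = X 0 w
                  - (\int[lebesgue_measure]_(s in `[0, t]) derive1 F (X s w))
                  + Num.sqrt (2 * eps) * W t w}].

(* The Kolmogorov equation p' = p Q, p 0 = 1 on R says p t = exp (t Q). *)
Definition markov_chain_from (Q : bool -> bool -> R) (i0 : bool)
    (d : measure_display) (T : measurableType d) (P : probability T R)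
    (Y : R -> T -> bool) : Prop :=
  [/\ forall t, 0 <= t -> measurable_fun [set: T] (Y t),
      forall w, Y 0 w = i0,
      forall w, cadlag (Y ^~ w)
    & exists p : R -> bool -> bool -> R,
      [/\ forall i j, p 0 i j = (i == j)%:R,
          forall (t : R) i j,
            is_derive t (1 : R) (fun u : R => p u i j) (\sum_k p t i k * Q k j)
        & forall s t A i j, 0 <= s -> 0 <= t -> natural_filtration Y s A ->
            P (A `&` [set w | Y s w = i] `&` [set w | Y (s + t) w = j]) =
            (P (A `&` [set w | Y s w = i]) * (p t i j)%:E)%E]].

(* Cadlag Markov process on R x {0, 1} with generator B in the sense of the
   martingale problem: for f(., i) in C_c^2,
   f(Z t) - \int_0^t B f(Z u) du is a martingale. *)
Definition coupled_process (F : R -> R) (eps : R) (Q : bool -> bool -> R)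
    (alpha : bool -> R -> R) (p : bool -> R) (d : measure_display)
    (T : measurableType d) (P : probability T R)
    (X : R -> T -> R) (Y : R -> T -> bool) : Prop :=
  let Z : R -> T -> R * bool := fun t w => (X t w, Y t w) in
  [/\ forall t, 0 <= t -> measurable_fun [set: T] (Z t),
      forall w, cadlag (Z ^~ w),
      forall (A : set R) i, measurable A ->
        P [set w | A (X 0 w) /\ Y 0 w = i] =
        (p i * gibbs_int F eps A (alpha i))%:E,
      exists k : R -> R.-pker (R * bool)%type ~> (R * bool)%type,
        forall s t A (B : set (R * bool)), 0 <= s -> 0 <= t ->
          natural_filtration Z s A -> measurable B ->
          P (A `&` (Z (s + t) @^-1` B)) = (\int[P]_(w in A) k t (Z s w) B)%E
    & forall f : R * bool -> R, (forall i, class_Cc 2 (fun x => f (x, i))) ->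
        forall s t A, 0 <= s <= t -> natural_filtration Z s A ->
          \int[P]_(w in A)
            (f (Z t w) - f (Z s w)
             - \int[lebesgue_measure]_(u in `[s, t])
                 coupled_generator F eps Q alpha f (Z u w)) = 0].

(* P(X t in A | Y t = j), read as the integral of alpha_j over A with respect
   to varpi when P(Y t = j) = 0. *)
Definition cond_law (F : R -> R) (eps : R) (alpha : bool -> R -> R)
    (d : measure_display) (T : measurableType d) (P : probability T R)
    (X : R -> T -> R) (Y : R -> T -> bool) (t : R) (j : bool) (A : set R) : R :=
  if P [set w | Y t w = j] == 0%E then gibbs_int F eps A (alpha j)
  else fine (P [set w | A (X t w) /\ Y t w = j]) / fine (P [set w | Y t w = j]).

End Processes.

Section Equivalence.
Context {R : realType}.

Definition equivalent0 (a b : R -> R) : Prop :=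
  a eps / b eps @[eps --> 0^'+] --> (1 : R).

Definition equivalent0_ereal (a b : R -> \bar R) : Prop :=
  (\forall eps \near 0^'+, a eps \is a fin_num /\ b eps \is a fin_num) /\
  equivalent0 (fine \o a) (fine \o b).

End Equivalence.

(* Main.v *)
Require Import Defs.
From HB Require Import structures.
From mathcomp Require Import all_boot all_order all_algebra.
From mathcomp Require Import all_classical all_reals all_analysis.
From mathcomp Require Import measurable_realfun ring lra.

Set Implicit Arguments.
Unset Strict Implicit.
Unset Printing Implicit Defensive.

Import Order.TTheory GRing.Theory Num.Theory.
Import numFieldNormedType.Exports.

Local Open Scope classical_set_scope.
Local Open Scope ring_scope.

(* Put G = exp(-F/eps), Z = int G, and let J = (eps/lambda) G eta', so that
   J' = - eta G and J vanishes at infinity; in particular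
   int_{x > 0} eta G = J(0) = - int_{x < 0} eta G. Hence conditions (1), (2) say
   that (int_{x<0} G - xi_0 J(0))/Z -> 1 and (int_{x>0} G + xi_1 J(0))/Z -> 1, while
   the chain leaves j after the mean time 1/a_j = (1 - xi_{1-j}/xi_j)/lambda.
   Everything then follows from five asymptotic facts: the mass of the right
   well is negligible, J(0) ~ |eta(-oo)| Z, eta(-oo)/eta(oo) -> 0, and, m_j
   being the mean time the diffusion needs to leave x_j for a ball around
   x_{1-j}, lambda m_1 -> 1 and lambda m_0 |eta(-oo)|/eta(oo) -> 1.
   The spectral facts use that lambda is exponentially small, so that eta is
   nearly constant in each well. The m_j are squeezed between explicit
   solutions v of eps v'' - F' v' = - 1: summing E[v(X_{t+h}) - v(X_t)] = - h + o(h)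
   over an Euler grid, restricted to paths still inside an interval [b, L],
   yields the mean exit time from [b, L] without Ito calculus. *)

(** * Calculus on the line *)

Section Calculus.
Context {R : realType}.
Implicit Types (f g h P Q : R -> R) (a b l x y z : R).

(** No integral of exp(F/eps) or exp(-F/eps) is ever evaluated. Integrating eta' = (lambda/eps)
    exp(F/eps) J across the barrier, and likewise the derivatives of the solutions v, produces the
    same factor D, the integral of exp(F/eps) from x_0 to x_1, times a flux or a mass taken at 0. So
    lambda and the m_j are compared with one another without prefactors, and crude exponential
    bounds suffice. The inequality F(x_0) < F(x_1) makes the mass N of the right half-line
    negligible; since J(0) can be computed from either side, |eta(-oo)| Z ~ J(0) ~ eta(oo) N, which
    is why eta(-oo)/eta(oo) vanishes. The xi_j are normalized by values of eta at infinity rather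
    than in the wells; bridging the two uses the superlinear growth of F'. Two obstacles shape the
    probabilistic half: the solutions v are unbounded on the line, so they are frozen outside a
    bounded interval, and hitting times are not known to be measurable, so their means are bounded
    through measurable functions above or below them. *)

Definition primitive f g : Prop := forall x, is_derive x (1 : R) f (g x).

Lemma primitive_derivable f g x : primitive f g -> derivable f x 1.
Proof. by move=> fg; apply: ex_derive; apply: fg. Qed.

Lemma primitive_derive1 f g : primitive f g -> derive1 f = g.
Proof. by move=> fg; apply/funext => x; rewrite derive1E; apply: derive_val; apply: fg. Qed.

Lemma primitive_continuous f g : primitive f g -> continuous f.
Proof.
by move=> fg x; apply/differentiable_continuous/derivable1_diffP;
  exact: primitive_derivable fg.
Qed.

Lemma primitive_MVT f g a b : primitive f g -> a <= b ->
  exists2 c, a <= c <= b & f b - f a = g c * (b - a).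
Proof.
move=> fg ab.
have [c cab ->] := @MVT_segment R f g a b ab (fun x _ => fg x)
  (continuous_subspaceT (primitive_continuous fg)).
by exists c => //; move: cab; rewrite in_itv.
Qed.

Lemma primitive_le f g a b : primitive f g -> a <= b ->
  (forall x, a <= x <= b -> 0 <= g x) -> f a <= f b.
Proof.
move=> fg ab g0; have [c /g0 gc e] := primitive_MVT fg ab.
by rewrite -subr_ge0 e mulr_ge0// subr_ge0.
Qed.

Lemma primitive_ge f g a b : primitive f g -> a <= b ->
  (forall x, a <= x <= b -> g x <= 0) -> f b <= f a.
Proof.
move=> fg ab g0; have [c /g0 gc e] := primitive_MVT fg ab.
by rewrite -subr_le0 e mulr_le0_ge0// subr_ge0.
Qed.

Lemma primitive_ub f g a b c : primitive f g -> a <= b ->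
  (forall x, a <= x <= b -> g x <= c) -> f b - f a <= c * (b - a).
Proof.
move=> fg ab g0; have [d /g0 gd ->] := primitive_MVT fg ab.
by rewrite ler_wpM2r// subr_ge0.
Qed.

Lemma primitive_lb f g a b c : primitive f g -> a <= b ->
  (forall x, a <= x <= b -> c <= g x) -> c * (b - a) <= f b - f a.
Proof.
move=> fg ab g0; have [d /g0 gd ->] := primitive_MVT fg ab.
by rewrite ler_wpM2r// subr_ge0.
Qed.

Lemma primitive_norm f g a b c : primitive f g -> a <= b ->
  (forall x, a <= x <= b -> `|g x| <= c) -> `|f b - f a| <= c * (b - a).
Proof.
move=> fg ab g0; have [d /g0 gd ->] := primitive_MVT fg ab.
by rewrite normrM (ger0_norm (_ : 0 <= b - a)) ?subr_ge0// ler_wpM2r// subr_ge0.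
Qed.

Lemma primitiveD f1 g1 f2 g2 : primitive f1 g1 -> primitive f2 g2 ->
  primitive (fun x => f1 x + f2 x) (fun x => g1 x + g2 x).
Proof. by move=> h1 h2 x; apply: is_deriveD; [exact: h1|exact: h2]. Qed.

Lemma primitiveB f1 g1 f2 g2 : primitive f1 g1 -> primitive f2 g2 ->
  primitive (fun x => f1 x - f2 x) (fun x => g1 x - g2 x).
Proof. by move=> h1 h2 x; apply: is_deriveB; [exact: h1|exact: h2]. Qed.

Lemma primitiveN f1 g1 : primitive f1 g1 ->
  primitive (fun x => - f1 x) (fun x => - g1 x).
Proof. by move=> h1 x; apply: is_deriveN; exact: h1. Qed.

Lemma primitive_cst c : primitive (fun=> c) (fun=> 0).
Proof. by move=> x; exact: is_derive_cst. Qed.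

Lemma primitive_id : primitive id (fun=> 1).
Proof. by move=> x; exact: is_derive_id. Qed.

Lemma primitiveM f1 g1 f2 g2 : primitive f1 g1 -> primitive f2 g2 ->
  primitive (fun x => f1 x * f2 x) (fun x => f1 x * g2 x + f2 x * g1 x).
Proof.
move=> h1 h2 x.
have := @is_deriveM R R f1 f2 x 1 (g1 x) (g2 x) (h1 x) (h2 x).
by [].
Qed.

Lemma primitiveZ c f g : primitive f g ->
  primitive (fun x => c * f x) (fun x => c * g x).
Proof.
move=> h x; have := primitiveM (primitive_cst c) h x.
by rewrite mulr0 addr0.
Qed.

Lemma primitive_expR f g : primitive f g ->
  primitive (fun x => expR (f x)) (fun x => g x * expR (f x)).
Proof.
move=> h x; have := @is_derive1_comp R expR f x (expR (f x)) (g x) _ (h x).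
by rewrite mulrC; apply; exact: is_derive_expR.
Qed.

Lemma primitive_reflect f g : primitive f g ->
  primitive (fun x => f (- x)) (fun x => - g (- x)).
Proof.
move=> h x; have := @is_derive1_comp R f -%R x (g (- x)) (- 1) (h (- x)) _.
by rewrite mulrN1; apply.
Qed.

End Calculus.

(** * Antiderivatives and improper integrals *)

Section Integrals.
Context {R : realType}.
Implicit Types (f g h P Q : R -> R) (a b l x y z : R).
Notation mu := (@lebesgue_measure R).

Lemma continuous_integrable_itv g a b : continuous g ->
  mu.-integrable `[a, b] (EFin \o g).
Proof.
move=> cg; apply: continuous_compact_integrable; first exact: segment_compact.
exact: continuous_subspaceT.
Qed.

Lemma Rintegral_itv_cat g a b c : continuous g -> a <= b -> b <= c ->
  \int[mu]_(t in `[a, c]) g t =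
  \int[mu]_(t in `[a, b]) g t + \int[mu]_(t in `[b, c]) g t.
Proof.
move=> cg ab bc.
have := @Rintegral_itvB R g (BLeft a) (BRight c) b (continuous_integrable_itv a c cg).
rewrite !bnd_simp => /(_ ab bc) h.
rewrite -(@Rintegral_itv_obnd_cbnd R b (BRight c)); last first.
  apply: integrableS (continuous_integrable_itv b c cg) => //.
  by apply: subset_itvr; rewrite bnd_simp.
by rewrite -h addrC subrK.
Qed.

Lemma primitive_exists g : continuous g -> exists P, primitive P g.
Proof.
move=> cg.
(* The base point moves with x so that it lies to the left of both x and 0; [PE] shows that the
   value does not depend on it. *)
pose P x := \int[mu]_(t in `[- (`|x| + 1), x]) g t
          - \int[mu]_(t in `[- (`|x| + 1), 0]) g t.
have PE a x : a < 0 -> a < x ->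
    P x = \int[mu]_(t in `[a, x]) g t - \int[mu]_(t in `[a, 0]) g t.
  move=> a0 ax; rewrite /P; set b := - (`|x| + 1).
  have b0 : b <= 0 by rewrite oppr_le0 addr_ge0.
  have bx : b <= x by rewrite /b lerNl; have := ler_norm (- x); rewrite normrN; lra.
  have [ab|ba] := leP a b.
    by rewrite (Rintegral_itv_cat cg ab bx) (Rintegral_itv_cat cg ab b0); ring.
  by rewrite (Rintegral_itv_cat cg (ltW ba) (ltW ax)) (Rintegral_itv_cat cg (ltW ba) (ltW a0)); ring.
exists P => x.
pose a := - (`|x| + 1).
have ax : a < x by rewrite /a ltrNl; have := ler_norm (- x); rewrite normrN; lra.
have a0 : a < 0 by rewrite oppr_lt0 ltr_wpDl.
have [dF F'] := @continuous_FTC1_closed R g a x (x + 1) ltac:(lra)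
  (continuous_integrable_itv a (x + 1) cg) ax (cg x).
apply: (@near_eq_is_derive _ _ _
  (fun x => \int[mu]_(t in `[a, x]) g t - \int[mu]_(t in `[a, 0]) g t)).
  near=> y; rewrite (PE a)//; near: y.
  exact: lt_nbhsr.
have -> : g x = g x - 0 by rewrite subr0.
apply: is_deriveB; apply: DeriveDef; first exact: dF.
by rewrite -derive1E.
Unshelve. all: by end_near.
Qed.

Lemma continuous_cvg_right g a : continuous g -> g x @[x --> a^'+] --> g a.
Proof. by move=> cg; apply: cvg_at_right_filter; exact: cg. Qed.

Lemma ge0_integral_halfline g Q a l : (forall x, 0 <= g x) -> continuous g ->
  primitive Q g -> Q x @[x --> +oo] --> l ->
  (\int[mu]_(x in `]a, +oo[) (g x)%:E)%E = (l - Q a)%:E.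
Proof.
move=> g0 cg Qg Ql.
rewrite integral_itv_obnd_cbnd; last first.
  apply/measurable_EFinP; apply: measurable_funTS.
  exact: continuous_measurable_fun.
rewrite (@ge0_continuous_FTC2y R g Q a l)//.
- by apply: continuous_subspaceT.
- by move=> x _; exact: primitive_derivable Qg.
- exact: continuous_cvg_right (primitive_continuous Qg).
- by move=> x _; rewrite (primitive_derive1 Qg).
Qed.

(** Both g + h and h are nonnegative, so the nonnegative case applies to each of them, and g is
    their difference. *)
Lemma integral_halfline g Q h H a l l' : continuous g -> continuous h ->
  (forall x, `|g x| <= h x) -> primitive Q g -> primitive H h ->
  Q x @[x --> +oo] --> l -> H x @[x --> +oo] --> l' ->
  mu.-integrable `]a, +oo[ (EFin \o g) /\
  \int[mu]_(x in `]a, +oo[) g x = l - Q a.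
Proof.
move=> cg ch gh Qg Hh Ql Hl.
have h0 x : 0 <= h x by rewrite (le_trans _ (gh x)).
have ih : mu.-integrable `]a, +oo[ (EFin \o h).
  apply/integrableP; split.
    by apply/measurable_EFinP; apply: measurable_funTS; exact: continuous_measurable_fun.
  under eq_integral do rewrite /= ger0_norm//.
  by rewrite (ge0_integral_halfline a h0 ch Hh Hl) ltry.
have ig : mu.-integrable `]a, +oo[ (EFin \o g).
  apply: le_integrable ih => //.
    by apply/measurable_EFinP; apply: measurable_funTS; exact: continuous_measurable_fun.
  by move=> x _ /=; rewrite lee_fin (ger0_norm (h0 x)).
split=> //.
have gh0 x : 0 <= g x + h x by have := gh x; rewrite ler_norml; lra.
have := @ge0_integral_halfline (fun x => g x + h x) (fun x => Q x + H x) a (l + l') gh0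
  (fun x => continuousD (cg x) (ch x)) (primitiveD Qg Hh) (cvgD Ql Hl).
have := ge0_integral_halfline a h0 ch Hh Hl.
move=> e1 e2.
have : \int[mu]_(x in `]a, +oo[) (g x + h x) = l + l' - (Q a + H a).
  by rewrite /Rintegral e2.
rewrite RintegralD// => e3.
have e4 : \int[mu]_(x in `]a, +oo[) h x = l' - H a by rewrite /Rintegral e1.
by apply: (addIr (l' - H a)); rewrite -[in LHS]e4 e3; ring.
Qed.

End Integrals.

(** * Gibbs weight and eigenfunction *)

Section Limits.
Context {R : realType}.
Implicit Types (f g : R -> R) (a b l x y z : R).

Lemma cvg_pinfty_le f l x z : (forall y, z <= y -> f y <= x) ->
  f y @[y --> +oo] --> l -> l <= x.
Proof.
move=> fx fl; apply: (cvgr_to_le fl); near=> y; apply: fx.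
by apply/ltW; near: y; apply: nbhs_pinfty_gt; rewrite num_real.
Unshelve. all: by end_near.
Qed.

Lemma cvg_pinfty_ge f l x z : (forall y, z <= y -> x <= f y) ->
  f y @[y --> +oo] --> l -> x <= l.
Proof.
move=> fx fl; apply: (cvgr_to_ge fl); near=> y; apply: fx.
by apply/ltW; near: y; apply: nbhs_pinfty_gt; rewrite num_real.
Unshelve. all: by end_near.
Qed.

Lemma eventually_bounded_cvg f c z : {homo f : x y / x <= y} ->
  (forall y, z <= y -> f y <= c) -> exists l : R, f y @[y --> +oo] --> l.
Proof.
move=> fh fc; exists (sup (range f)); apply: nondecreasing_cvgr => //.
exists c => _ [y _ <-]; have [/fc//|/ltW yz] := leP z y.
exact: le_trans (fh _ _ yz) (fc _ (lexx z)).
Qed.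

Lemma homo_le_lim f l x : {homo f : x y / x <= y} ->
  f y @[y --> +oo] --> l -> f x <= l.
Proof. by move=> fh fl; apply: (@cvg_pinfty_ge f _ _ x) fl => y /fh. Qed.

Lemma primitive_nd f g : primitive f g -> (forall x, 0 <= g x) ->
  {homo f : x y / x <= y}.
Proof. by move=> fg g0 x y xy; apply: primitive_le fg xy _ => z _. Qed.

Lemma primitive_ge0_deriv f g x : primitive f g -> {homo f : x y / x < y} ->
  0 <= g x.
Proof.
move=> fg fh; rewrite -(primitive_derive1 fg).
apply: (@incr_derive1_ge0_itvy R f true (x - 1) x).
- by move=> y _; exact: primitive_derivable fg.
- by move=> u v _ _; exact: fh.
- by rewrite in_itv/= andbT; lra.
Qed.

Lemma noninc_lim_ge f g z l : primitive f g -> (forall x, z <= x -> g x <= 0) ->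
  f x @[x --> +oo] --> l -> l <= f z.
Proof.
move=> fg g0 fl; apply: (@cvg_pinfty_le f l (f z) z _ fl) => y zy.
by apply: primitive_ge fg zy _ => x /andP[zx _]; exact: g0.
Qed.

End Limits.

(** With p > 1 the function 1/f is integrable at infinity, which bounds the time the drift needs to
    come down from there. Applied to F' at the right end and to x -> - F'(- x) at the left end. *)
Definition superlinear (R : realType) (f : R -> R) (p k L : R) : Prop :=
  [/\ 1 < p, 0 < k, 0 < L & forall z, L <= z -> k * z `^ p <= f z].

Definition weight (R : realType) (F : R -> R) (eps x : R) : R :=
  expR (- F x / eps).

(** * Tail mass of the Gibbs weight *)

Section RightTail.
Context {R : realType}.
Context (F F1 : R -> R) (eps p k L : R).
Context (dF : primitive F F1) (eps0 : 0 < eps)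
  (tailF : superlinear F1 p k L).

Local Notation G := (weight F eps).

Lemma weight_gt0 x : 0 < G x. Proof. exact: expR_gt0. Qed.

Lemma weight_inv x : expR (F x / eps) * G x = 1.
Proof. by rewrite /weight -expRD mulNr addrN expR0. Qed.

Lemma weight_ratio x y : expR (F x / eps) * G y = expR ((F x - F y) / eps).
Proof. by rewrite /weight -expRD -mulrDl. Qed.

Lemma weight_primitive : primitive G (fun x => - (F1 x / eps) * G x).
Proof.
have := primitive_expR (primitiveZ (- eps^-1) dF).
have -> : (fun x => expR (- eps^-1 * F x)) = G.
  by apply/funext => x; rewrite /weight mulNr mulrC -mulNr.
suff -> : (fun x => - eps^-1 * F1 x * expR (- eps^-1 * F x)) = (fun x => - (F1 x / eps) * G x) by [].
by apply/funext => x; rewrite /weight; congr (_ * expR _); lra.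
Qed.

Lemma weight_continuous : continuous G.
Proof. exact: primitive_continuous weight_primitive. Qed.

Lemma tail_ge z w : L <= z -> z <= w -> k * z `^ p <= F1 w.
Proof.
have [p1 k0 L0 h] := tailF => Lz zw; apply: le_trans (h _ (le_trans Lz zw)).
by rewrite ler_pM2l// ge0_ler_powR// ?nnegrE; lra.
Qed.

Lemma tail_rate_gt0 z : L <= z -> 0 < k * z `^ p.
Proof. by have [p1 k0 L0 h] := tailF => Lz; rewrite mulr_gt0// powR_gt0//; lra. Qed.

Context (P : R -> R).
Context (dP : primitive P G).

Lemma weight_prim_nd : {homo P : x y / x <= y}.
Proof. by apply: (primitive_nd dP) => x; apply/ltW/weight_gt0. Qed.

(** On [z, w] the derivative of F is at least c = k z^p, so P + (eps / c) G has derivative (1 - F' /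
    c) G <= 0. *)
Lemma weight_prim_tail z w : L <= z -> z <= w ->
  P w <= P z + eps / (k * z `^ p) * G z.
Proof.
move=> Lz zw; have c0 := tail_rate_gt0 Lz; set c := k * z `^ p in c0 *.
have := primitive_ge (primitiveD dP (primitiveZ (eps / c) weight_primitive)) zw.
move=> /(_ _)-/(_ _)/le_trans h.
apply: le_trans (h _ _ (lexx _)).
  by rewrite lerDl mulr_ge0 ?divr_ge0 ?ltW ?weight_gt0.
move=> x /andP[zx xw].
have -> : G x + eps / c * (- (F1 x / eps) * G x) = (c - F1 x) / c * G x.
  by field; rewrite !gt_eqF.
apply: mulr_le0_ge0; last exact/ltW/weight_gt0.
apply: mulr_le0_ge0; last by rewrite invr_ge0 ltW.
by rewrite subr_le0; exact: tail_ge.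
Qed.

Lemma weight_prim_cvg : exists l : R, P x @[x --> +oo] --> l.
Proof.
apply: (eventually_bounded_cvg (c := P L + eps / (k * L `^ p) * G L) (z := L)).
  exact: weight_prim_nd.
by move=> y Ly; exact: weight_prim_tail.
Qed.

Context (lP : R).
Context (limP : P x @[x --> +oo] --> lP).

Lemma weight_tail_ge0 x : 0 <= lP - P x.
Proof. by rewrite subr_ge0; apply: homo_le_lim limP; exact: weight_prim_nd. Qed.

Lemma weight_tail_le z : L <= z -> lP - P z <= eps / (k * z `^ p) * G z.
Proof.
move=> Lz; rewrite lerBlDl; apply: (@cvg_pinfty_le _ P _ _ z) limP => y zy.
exact: weight_prim_tail.
Qed.

(** The mass of [z, L] is at most its length times the largest value of G; beyond L the tail
    estimate applies. *)
Lemma weight_tail_bound z f0 : z <= L -> (forall w, z <= w -> f0 <= F w) ->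
  lP - P z <= (L - z + eps / (k * L `^ p)) * expR (- f0 / eps).
Proof.
move=> zL hf.
have GE w : z <= w -> G w <= expR (- f0 / eps).
  by move=> zw; rewrite ler_expR ler_pM2r ?invr_gt0// lerN2 hf.
have h1 := weight_tail_le (lexx L).
have h2 : P L - P z <= expR (- f0 / eps) * (L - z).
  by apply: primitive_ub dP zL _ => x /andP[zx _]; exact: GE.
have c0 := tail_rate_gt0 (lexx L).
have h3 : eps / (k * L `^ p) * G L <= eps / (k * L `^ p) * expR (- f0 / eps).
  by rewrite ler_wpM2l ?GE// divr_ge0 ?ltW.
rewrite mulrDl; lra.
Qed.

End RightTail.

(** * The eigenfunction near the right end *)

Section RightEigen.
Context {R : realType}.
Context (F F1 : R -> R) (eps p k L : R).
Context (dF : primitive F F1) (eps0 : 0 < eps)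
  (tailF : superlinear F1 p k L).
Local Notation G := (weight F eps).
Local Notation E x := (expR (F x / eps)).
Context (P : R -> R) (lP : R).
Context (dP : primitive P G) (limP : P x @[x --> +oo] --> lP).
Context (eta eta1 eta2 : R -> R) (lam H : R).
Context (deta : primitive eta eta1) (deta1 : primitive eta1 eta2)
  (ode : forall x, eps * eta2 x - F1 x * eta1 x = - lam * eta x)
  (lam0 : 0 < lam) (eta_inc : {homo eta : x y / x < y})
  (eta_lim : eta x @[x --> +oo] --> H) (H0 : 0 < H).

Let lam_ge0 : 0 <= lam := ltW lam0.
Let eps_ge0 : 0 <= eps := ltW eps0.
Let H_ge0 : 0 <= H := ltW H0.

Definition flux (x : R) : R := eps / lam * (G x * eta1 x).
Local Notation J := flux.

Lemma flux_primitive : primitive J (fun x => - eta x * G x).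
Proof.
have := primitiveZ (eps / lam) (primitiveM (weight_primitive eps dF) deta1).
rewrite -/flux.
suff -> : (fun x => - eta x * G x) =
   (fun x => eps / lam * (G x * eta2 x + eta1 x * (- (F1 x / eps) * G x))) by [].
apply/funext => x.
have -> : eta2 x = (F1 x * eta1 x - lam * eta x) / eps.
  apply: (canRL (mulfK _)); first by rewrite gt_eqF.
  by rewrite mulrC; have := ode x; lra.
by field; rewrite !gt_eqF.
Qed.

Lemma eta1_ge0 x : 0 <= eta1 x.
Proof. exact: primitive_ge0_deriv deta eta_inc. Qed.

Lemma eta_nd : {homo eta : x y / x <= y}.
Proof. by apply: primitive_nd deta _; exact: eta1_ge0. Qed.

Lemma eta_le_lim x : eta x <= H.
Proof. exact: homo_le_lim eta_nd eta_lim. Qed.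

Lemma flux_ge0 x : 0 <= J x.
Proof.
by rewrite /flux mulr_ge0 ?divr_ge0 ?mulr_ge0 ?eta1_ge0// ltW// weight_gt0.
Qed.

Lemma eta1_flux x : eta1 x = lam / eps * (E x * J x).
Proof.
rewrite /flux (_ : _ * (_ * _) = (lam / lam) * (eps / eps) * (E x * G x) * eta1 x); last by ring.
by rewrite weight_inv !divff ?gt_eqF// !mul1r.
Qed.

Lemma flux_noninc a x y : 0 <= eta a -> a <= x -> x <= y -> J y <= J x.
Proof.
move=> ea ax xy; apply: primitive_ge flux_primitive xy _ => z /andP[xz _].
rewrite mulNr oppr_le0 mulr_ge0 ?(ltW (weight_gt0 _ _ _))//.
exact: le_trans ea (eta_nd (le_trans ax xz)).
Qed.

Lemma eta_eventually_ge0 : exists a, 0 <= eta a.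
Proof.
have : \forall x \near +oo, 0 < eta x.
  by apply: (cvgr_gt _ eta_lim).
move=> h; have [a ha] := filter_ex h.
by exists a; exact: ltW.
Qed.

(** J is nonnegative, and nonincreasing once eta >= 0. If it stayed above some e > 0, then eta' =
    (lam / eps) exp(F / eps) J would be bounded below on a half-line, against the boundedness of
    eta. *)
Lemma flux_cvg0 : J x @[x --> +oo] --> 0.
Proof.
have [a a0] := eta_eventually_ge0.
apply/cvgrPdist_lt => e e0.
have [p1 k0 L0 _] := tailF.
pose M := Num.max L a.
have FM x : M <= x -> F M <= F x.
  move=> Mx; apply: primitive_le dF Mx _ => y /andP[My _].
  have Ly : L <= y by apply: le_trans My; rewrite /M le_max lexx.
  by apply: le_trans (tail_ge tailF Ly (lexx y)); apply/ltW/(tail_rate_gt0 tailF Ly).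
have [[b [Mb Jb]]|none] := pselect (exists b, M <= b /\ J b < e).
  have : \forall x \near +oo, b < x by apply: nbhs_pinfty_gt; rewrite num_real.
  apply: filterS => x bx; rewrite sub0r normrN ger0_norm ?flux_ge0//.
  apply: le_lt_trans Jb; apply: (flux_noninc a0); last exact: ltW.
  by apply: le_trans Mb; rewrite /M le_max lexx orbT.
exfalso.
have Je x : M <= x -> e <= J x.
  by move=> Mx; rewrite leNgt; apply/negP => Jx; apply: none; exists x.
pose c := lam / eps * (E M * e).
have c0 : 0 < c by rewrite !mulr_gt0 ?expR_gt0// invr_gt0.
(* With slope at least c, an interval of length (H - eta M + 1) / c lifts eta above its limit H. *)
have := @primitive_lb R eta eta1 M (M + (H - eta M + 1) / c) c deta.
have hM : 0 <= H - eta M by rewrite subr_ge0 eta_le_lim.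
have Mle : M <= M + (H - eta M + 1) / c by rewrite lerDl divr_ge0 ?ltW//; lra.
move=> /(_ Mle) h.
have {h} : c * (M + (H - eta M + 1) / c - M) <= eta (M + (H - eta M + 1) / c) - eta M.
  apply: h => x /andP[Mx _]; rewrite eta1_flux /c ler_wpM2l ?divr_ge0//.
  apply: le_trans (_ : E M * J x <= _).
    by rewrite ler_wpM2l ?expR_ge0// Je.
  by rewrite ler_wpM2r ?flux_ge0// ler_expR ler_pM2r ?invr_gt0// FM.
have -> : c * (M + (H - eta M + 1) / c - M) = H - eta M + 1 by field; rewrite gt_eqF.
have := eta_le_lim (M + (H - eta M + 1) / c); lra.
Qed.

(** Both sides vanish at infinity, so comparing the derivatives - eta G and - H G on [z, oo) is
    enough. The companion bound [flux_ge] uses eta >= eta z there instead. *)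
Lemma flux_le z : J z <= H * (lP - P z).
Proof.
have d : primitive (fun x => H * (lP - P x) - J x) (fun x => H * (0 - G x) - - eta x * G x).
  exact: primitiveB (primitiveZ H (primitiveB (primitive_cst lP) dP)) flux_primitive.
have c : H * (lP - P x) - J x @[x --> +oo] --> H * (lP - lP) - 0.
  apply: cvgB flux_cvg0; apply: cvgM; first exact: cvg_cst.
  by apply: cvgB limP; exact: cvg_cst.
have := noninc_lim_ge d _ c; rewrite subrr mulr0 subrr => /(_ z) h.
rewrite -subr_ge0; apply: h => x _.
have -> : H * (0 - G x) - - eta x * G x = - ((H - eta x) * G x) by ring.
by rewrite oppr_le0 mulr_ge0 ?(ltW (weight_gt0 _ _ _))// subr_ge0 eta_le_lim.
Qed.

Lemma flux_ge z : eta z * (lP - P z) <= J z.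
Proof.
have d : primitive (fun x => J x - eta z * (lP - P x)) (fun x => - eta x * G x - eta z * (0 - G x)).
  exact: primitiveB flux_primitive (primitiveZ (eta z) (primitiveB (primitive_cst lP) dP)).
have c : J x - eta z * (lP - P x) @[x --> +oo] --> 0 - eta z * (lP - lP).
  apply: cvgB flux_cvg0 _; apply: cvgM; first exact: cvg_cst.
  by apply: cvgB limP; exact: cvg_cst.
have := noninc_lim_ge d _ c; rewrite subrr mulr0 subrr => /(_ z) h.
rewrite -subr_ge0; apply: h => x zx.
have -> : - eta x * G x - eta z * (0 - G x) = - ((eta x - eta z) * G x) by ring.
by rewrite oppr_le0 mulr_ge0 ?(ltW (weight_gt0 _ _ _))// subr_ge0 eta_nd.
Qed.

(** A Hardy type bound: J is nonincreasing on [a, d], so eta d >= eta d - eta a >= (lam / eps) J(d)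
    (S d - S a), while J(d) is at least eta d times the mass beyond d; then eta d cancels. *)
Lemma eigenvalue_le (S : R -> R) a d : primitive S (fun x => E x) ->
  0 <= eta a -> a <= d -> 0 < eta d ->
  lam / eps * ((S d - S a) * (lP - P d)) <= 1.
Proof.
move=> dS ea ad ed.
have h : lam / eps * (J d) * (S d - S a) <= eta d - eta a.
  have := primitive_le (primitiveB deta (primitiveZ (lam / eps * J d) dS)) ad.
  suff hh : forall x, a <= x <= d -> 0 <= eta1 x - lam / eps * J d * E x.
    by move=> /(_ hh); lra.
  move=> x /andP[ax xd]; rewrite eta1_flux.
  rewrite (_ : _ - _ = lam / eps * (E x * (J x - J d))); last by ring.
  rewrite mulr_ge0 ?divr_ge0// mulr_ge0 ?expR_ge0// subr_ge0.
  exact: flux_noninc ea ax xd.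
rewrite -(ler_pM2r ed) mul1r.
apply: le_trans (_ : eta d - eta a <= _); last by lra.
apply: le_trans h.
rewrite (_ : _ * eta d = lam / eps * (eta d * (lP - P d)) * (S d - S a)); last by ring.
rewrite ler_wpM2r//.
  by rewrite subr_ge0; apply: (primitive_nd dS) ad => x; exact: expR_ge0.
by rewrite ler_wpM2l ?flux_ge// divr_ge0.
Qed.

(* The entrance bound at infinity: F' grows superlinearly, so the drift comes
   down from infinity in bounded time and eta is almost at its limit. *)
Lemma eta_far : H - eta L <= lam * H * (L `^ (1 - p) / (k * (p - 1))).
Proof.
have [p1 k0 L0 _] := tailF.
set c := lam * H / (k * (p - 1)).
rewrite (_ : _ * (_ / _) = c * L `^ (1 - p)); last by rewrite /c; ring.
rewrite lerBlDl; apply: (@cvg_pinfty_le _ eta _ _ L) eta_lim => y Ly.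
have c0 : 0 <= c by rewrite /c divr_ge0 ?mulr_ge0 ?subr_ge0 ?ltW.
(* The constant c is such that the derivative of c x^(1 - p) is - lam H / (k x^p), which offsets the
   bound on eta' coming from J <= H (lP - P) and the tail estimate. The sum is therefore
   nonincreasing. *)
apply: le_trans (_ : eta y + c * y `^ (1 - p) <= _).
  by rewrite lerDl mulr_ge0 ?powR_ge0.
have d x : x \in `]L, y[ -> is_derive x 1 (fun x => eta x + c * x `^ (1 - p))
    (eta1 x + c * ((1 - p) * x `^ (1 - p - 1))).
  rewrite in_itv/= => /andP[Lx _].
  apply: is_deriveD; first exact: deta.
  have := @is_deriveZ R R R (fun x => x `^ (1 - p)) c x 1 _ (is_derive1_powR (1 - p) (lt_trans L0 Lx)).
  by [].
have ct : {within `[L, y], continuous (fun x => eta x + c * x `^ (1 - p))}.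
  apply: derivable_within_continuous => x; rewrite in_itv/= => /andP[Lx _].
  have x0 : 0 < x by lra.
  apply: derivableD; first exact: primitive_derivable deta.
  apply: (@derivableZ R R R (fun x => x `^ (1 - p)) c x).
  by apply: ex_derive; exact: is_derive1_powR.
have [z + e] := MVT_segment Ly d ct; rewrite in_itv/= => /andP[Lz zy].
rewrite -subr_le0 e; apply: mulr_le0_ge0; last by rewrite subr_ge0.
have z0 : 0 < z by lra.
have zp0 : 0 < z `^ p by rewrite powR_gt0.
rewrite (_ : 1 - p - 1 = - p); last by ring.
rewrite powRN.
rewrite (_ : c * _ = - (lam * H / (k * z `^ p))); last by rewrite /c; field; rewrite !gt_eqF// subr_gt0.
rewrite subr_le0 eta1_flux.
apply: le_trans (_ : lam / eps * (E z * (H * (lP - P z))) <= _).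
  by rewrite ler_wpM2l ?divr_ge0// ler_wpM2l ?expR_ge0// flux_le.
have := weight_tail_le dF eps0 tailF dP limP Lz.
move=> /(ler_wpM2l (expR_ge0 (F z / eps))); rewrite mulrCA weight_inv mulr1 => h.
rewrite (_ : _ * (_ * (_ * _)) = lam / eps * H * (E z * (lP - P z))); last by ring.
apply: le_trans (ler_wpM2l _ h) _; first by rewrite mulr_ge0 ?divr_ge0.
by rewrite le_eqVlt; apply/orP; left; apply/eqP; field; rewrite !gt_eqF.
Qed.

(** Here kap bounds every descent of F to the right of d, so exp(F x / eps) times the mass beyond x
    is at most exp(kap / eps) times a length. This bounds eta' on [d, L]; the rest is [eta_far]. The
    estimate is useful when lam beats exp(kap / eps). *)
Lemma eta_near d (kap : R) : d <= L -> (forall z w, d <= z -> z <= w -> F z - F w <= kap) ->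
  H - eta d <= lam * H *
   ((L - d) * (L - d + eps / (k * L `^ p)) * (expR (kap / eps) / eps) +
    L `^ (1 - p) / (k * (p - 1))).
Proof.
move=> dL hk; have c0 := tail_rate_gt0 tailF (lexx L).
have h : eta L - eta d <= lam * H *
    ((L - d + eps / (k * L `^ p)) * (expR (kap / eps) / eps)) * (L - d).
  apply: primitive_ub deta dL _ => x /andP[dx xL].
  rewrite eta1_flux.
  apply: le_trans (_ : lam / eps * (E x * (H * (lP - P x))) <= _).
    by rewrite ler_wpM2l ?divr_ge0// ler_wpM2l ?expR_ge0// flux_le.
  have h1 := @weight_tail_bound R F F1 eps p k L dF eps0 tailF P dP lP limP x (F x - kap) xL.
  have {}h1 : lP - P x <= (L - x + eps / (k * L `^ p)) * expR (- (F x - kap) / eps).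
    by apply: h1 => w xw; have := hk x w dx xw; lra.
  have e1 : E x * expR (- (F x - kap) / eps) = expR (kap / eps).
    by rewrite -expRD -mulrDl opprB addrCA subrr addr0.
  rewrite (_ : _ * (_ * (_ * _)) = lam / eps * H * (E x * (lP - P x))); last by ring.
  rewrite (_ : lam * H * _ = lam / eps * H * ((L - d + eps / (k * L `^ p)) * expR (kap / eps))); last by ring.
  rewrite ler_wpM2l ?mulr_ge0 ?invr_ge0//.
  apply: le_trans (ler_wpM2l (expR_ge0 _) h1) _.
  rewrite mulrCA e1 ler_wpM2r ?expR_ge0//; lra.
have := eta_far; lra.
Qed.

End RightEigen.

(** * The left end, by reflection *)

Section LeftEigen.
Context {R : realType}.
Context (F F1 : R -> R) (eps p k L p' k' L' : R).
Context (dF : primitive F F1) (eps0 : 0 < eps)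
  (tailR : superlinear F1 p k L)
  (tailL : superlinear (fun x => - F1 (- x)) p' k' L').
Local Notation G := (weight F eps).
Local Notation E x := (expR (F x / eps)).
Context (P : R -> R) (lp lm : R).
Context (dP : primitive P G) (limp : P x @[x --> +oo] --> lp)
  (limm : P x @[x --> -oo] --> lm).
Context (eta eta1 eta2 : R -> R) (lam Hp Hm : R).
Context (deta : primitive eta eta1) (deta1 : primitive eta1 eta2)
  (ode : forall x, eps * eta2 x - F1 x * eta1 x = - lam * eta x)
  (lam0 : 0 < lam) (eta_inc : {homo eta : x y / x < y})
  (etap : eta x @[x --> +oo] --> Hp) (Hp0 : 0 < Hp)
  (etam : eta x @[x --> -oo] --> - Hm) (Hm0 : 0 < Hm).
Local Notation J := (flux F eps eta1 lam).

Let lam_ge0 : 0 <= lam := ltW lam0.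
Let eps_ge0 : 0 <= eps := ltW eps0.

Lemma primitive_reflectN (f g : R -> R) : primitive f g ->
  primitive (fun x => - f (- x)) (fun x => g (- x)).
Proof.
move=> fg x; have := primitiveN (primitive_reflect fg) x.
by rewrite opprK.
Qed.

Lemma cvg_reflect (f : R -> R) (l : R) : f x @[x --> -oo] --> l ->
  f (- x) @[x --> +oo] --> l.
Proof. by move=> fl; apply/cvgNy_compNP. Qed.

(** Primes mark reflected objects, not derivatives. Under x -> - x and eta -> - eta the equation and
    the monotonicity are preserved, and the limit - Hm at -oo becomes the limit Hm at +oo, so the
    estimates at the right end apply. *)
Let F' x := F (- x).
Let F1' x := - F1 (- x).
Let P' x := - P (- x).
Let eta' x := - eta (- x).
Let eta1' x := eta1 (- x).
Let eta2' x := - eta2 (- x).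

Let dF' : primitive F' F1'. Proof. exact: primitive_reflect. Qed.
Let dP' : primitive P' (weight F' eps).
Proof. exact: (primitive_reflectN dP). Qed.
Let deta' : primitive eta' eta1'. Proof. exact: primitive_reflectN. Qed.
Let deta1' : primitive eta1' eta2'. Proof. exact: primitive_reflect. Qed.
Let limP' : P' x @[x --> +oo] --> - lm.
Proof. by apply: cvgN; exact: cvg_reflect. Qed.
Let etap' : eta' x @[x --> +oo] --> Hm.
Proof. by rewrite -(opprK Hm); apply: cvgN; exact: cvg_reflect. Qed.
Let eta_inc' : {homo eta' : x y / x < y}.
Proof. by move=> x y xy; rewrite /eta' ltrN2 eta_inc// ltrN2. Qed.
Let ode' x : eps * eta2' x - F1' x * eta1' x = - lam * eta' x.
Proof. by have := ode (- x); rewrite /eta2' /F1' /eta1' /eta'; lra. Qed.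

Lemma flux_le_left z : J z <= Hm * (P z - lm).
Proof.
have := flux_le dF' eps0 tailL dP' limP' deta' deta1' ode' lam0 eta_inc' etap' Hm0 (- z).
by rewrite /flux /weight /F' /eta1' /P' !opprK addrC.
Qed.

Lemma flux_ge_left z : - eta z * (P z - lm) <= J z.
Proof.
have := flux_ge dF' eps0 tailL dP' limP' deta' deta1' ode' lam0 eta_inc' etap' Hm0 (- z).
by rewrite /flux /weight /F' /eta1' /P' /eta' !opprK [- lm + _]addrC.
Qed.

Lemma eta_ge_lim x : - Hm <= eta x.
Proof.
have := eta_le_lim deta' eta_inc' etap' (- x).
by rewrite /eta' opprK lerNl.
Qed.

Lemma eta_near_left b (kap : R) : - L' <= b ->
  (forall z w, w <= z -> z <= b -> F z - F w <= kap) ->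
  Hm + eta b <= lam * Hm *
   ((L' + b) * (L' + b + eps / (k' * L' `^ p')) * (expR (kap / eps) / eps) +
    L' `^ (1 - p') / (k' * (p' - 1))).
Proof.
move=> bL hk.
have := @eta_near R F' F1' eps p' k' L' dF' eps0 tailL P' (- lm) dP' limP'
  eta' eta1' eta2' lam Hm deta' deta1' ode' lam0 eta_inc' etap' Hm0 (- b) kap.
rewrite /eta' !opprK => h; apply: h; first by rewrite lerNl.
by move=> z w bz zw; apply: hk; [rewrite lerN2|rewrite lerNl].
Qed.

Lemma weight_head_ge0 z : 0 <= P z - lm.
Proof.
have := homo_le_lim (- z) (weight_prim_nd dP') limP'.
by rewrite /P' opprK; lra.
Qed.

Lemma eigenvalue_le_left (S : R -> R) a d : primitive S (fun x => E x) ->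
  eta a <= 0 -> d <= a -> eta d < 0 ->
  lam / eps * ((S a - S d) * (P d - lm)) <= 1.
Proof.
move=> dS ea ad ed.
have := @eigenvalue_le R F' F1' eps p' k' L' dF' eps0 tailL P' (- lm) dP' limP'
  eta' eta1' eta2' lam Hm deta' deta1' ode' lam0 eta_inc' etap' Hm0
  (fun x => - S (- x)) (- a) (- d).
rewrite /eta' /P' !opprK [- lm + _]addrC [- S d + _]addrC; apply.
- exact: (primitive_reflectN dS).
- by rewrite oppr_ge0.
- by rewrite lerN2.
- by rewrite oppr_gt0.
Qed.

End LeftEigen.

(** * Crossing the barrier *)

Section Barrier.
Context {R : realType}.
Context (F F1 : R -> R) (eps p k L p' k' L' : R).
Context (dF : primitive F F1) (eps0 : 0 < eps)
  (tailR : superlinear F1 p k L)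
  (tailL : superlinear (fun x => - F1 (- x)) p' k' L').
Local Notation G := (weight F eps).
Local Notation E x := (expR (F x / eps)).
Context (P : R -> R) (lp lm : R).
Context (dP : primitive P G) (limp : P x @[x --> +oo] --> lp)
  (limm : P x @[x --> -oo] --> lm).
Context (eta eta1 eta2 : R -> R) (lam Hp Hm : R).
Context (deta : primitive eta eta1) (deta1 : primitive eta1 eta2)
  (ode : forall x, eps * eta2 x - F1 x * eta1 x = - lam * eta x)
  (lam0 : 0 < lam) (eta_inc : {homo eta : x y / x < y})
  (etap : eta x @[x --> +oo] --> Hp) (Hp0 : 0 < Hp)
  (etam : eta x @[x --> -oo] --> - Hm) (Hm0 : 0 < Hm).
Local Notation J := (flux F eps eta1 lam).

Let lam_ge0 : 0 <= lam := ltW lam0.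
Let eps_ge0 : 0 <= eps := ltW eps0.

Context (x0 x1 : R) (x00 : x0 < 0) (x10 : 0 < x1)
  (F_dec : forall x y, 0 <= x -> x <= y -> y <= x1 -> F y <= F x)
  (F_inc : forall x y, x0 <= x -> x <= y -> y <= 0 -> F x <= F y).

Let G_ge0 x : 0 <= G x. Proof. exact/ltW/weight_gt0. Qed.
Let E_ge0 x : 0 <= E x. Proof. exact: expR_ge0. Qed.

Lemma weight_inc x y : F y <= F x -> G x <= G y.
Proof. by move=> Fxy; rewrite /weight ler_expR ler_pM2r ?invr_gt0// lerN2. Qed.

(* Between the two wells the barrier at 0 dominates: a quantity with density
   bounded by G changes little on the scale set by E. *)
Lemma barrier_frozen (K K1 : R -> R) c z : primitive K K1 ->
  (forall x, `|K1 x| <= c * G x) -> x0 <= z <= x1 ->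
  `|E z * (K z - K 0)| <= c * (x1 - x0).
Proof.
move=> dK hK /andP[z0 z1]; have [x00' x10'] := (x00, x10).
have c0 : 0 <= c.
  rewrite -(pmulr_lge0 c (weight_gt0 F eps 0)); exact: le_trans (hK 0).
have EG x : E x * G x = 1 := weight_inv F eps x.
(* F decreases away from 0 in both directions, so between 0 and z the weight is largest at z; the
   factor exp(F z / eps) then cancels G z. *)
have hGc a b : a <= b -> (forall w, a <= w <= b -> G w <= G z) ->
    `|K b - K a| <= c * G z * (b - a).
  move=> ab hG; apply: (primitive_norm dK ab) => x /hG hx.
  by apply: le_trans (hK x) _; rewrite ler_wpM2l.
rewrite normrM ger0_norm//.
have fin (u w : R) : 0 <= w -> w <= x1 - x0 -> u <= c * G z * w -> E z * u <= c * (x1 - x0).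
  move=> w0 w1 h; apply: le_trans (ler_wpM2l (E_ge0 z) h) _.
  rewrite (_ : E z * _ = (E z * G z) * (c * w)); last by ring.
  by rewrite EG mul1r ler_wpM2l.
have [zp|/ltW zn] := leP 0 z.
  have zle : z <= x1 - x0 by lra.
  apply: (fin _ z zp zle).
  have := hGc _ _ zp; rewrite subr0; apply=> w /andP[w0 wz].
  by apply: weight_inc; exact: F_dec.
have z0' : 0 <= - z by lra.
have zle : - z <= x1 - x0 by lra.
rewrite distrC; apply: (fin _ (- z) z0' zle).
have := hGc _ _ zn; rewrite sub0r; apply=> w /andP[w0 wz].
by apply: weight_inc; exact: F_inc.
Qed.

(** Integrates [barrier_frozen]: in u' = m exp(F / eps) K the factor K may be replaced by its value
    at the top of the barrier. Used with K the flux, the mass to the right and the mass to the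
    left. *)
Lemma barrier_integral (S u K K1 : R -> R) c m x y :
  primitive S (fun x => E x) -> 0 <= m ->
  primitive u (fun x => m * (E x * K x)) -> primitive K K1 ->
  (forall x, `|K1 x| <= c * G x) -> x0 <= x -> x <= y -> y <= x1 ->
  `|u y - u x - m * K 0 * (S y - S x)| <= m * (c * (x1 - x0)) * (y - x).
Proof.
move=> dS m0 du dK hK x0x xy yx1.
have d := primitiveB du (primitiveZ (m * K 0) dS).
have := @primitive_norm _ _ _ x y (m * (c * (x1 - x0))) d xy.
rewrite (_ : u y - _ - (u x - _) = u y - u x - m * K 0 * (S y - S x)); last by ring.
apply=> z /andP[xz zy].
rewrite (_ : _ - _ = m * (E z * (K z - K 0))); last by ring.
rewrite normrM (ger0_norm m0) ler_wpM2l//.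
by apply: (barrier_frozen dK hK); rewrite (le_trans x0x xz) (le_trans zy yx1).
Qed.

(** J increases as long as eta <= 0, so only the stretch between the zero r of eta and 0 can lose
    flux. There F increases, hence eta(z) G(z) <= (lam / eps) J(r) (z - r), and the total loss is at
    most (lam / eps) x0^2 J(r). *)
Lemma flux_barrier_ge b : x0 <= b -> b <= 0 -> eta b < 0 -> lam / eps * x0 ^+ 2 <= 1 ->
  (1 - lam / eps * x0 ^+ 2) * (- eta b * (P b - lm)) <= J 0.
Proof.
move=> x0b b0 eb small; have [x00' x10'] := (x00, x10).
have dJ := flux_primitive dF eps0 deta1 ode lam0.
have Jb := flux_ge_left dF eps0 tailL dP limm deta deta1 ode lam0 eta_inc etam Hm0 b.
have nd := eta_nd deta eta_inc.
have Jg0 x := flux_ge0 F eps0 deta lam0 eta_inc x.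
have {}Jb : (1 - lam / eps * x0 ^+ 2) * (- eta b * (P b - lm)) <= (1 - lam / eps * x0 ^+ 2) * J b.
  by rewrite ler_wpM2l// subr_ge0.
have q0 : 0 <= lam / eps * x0 ^+ 2 by rewrite mulr_ge0 ?divr_ge0 ?sqr_ge0.
have [e0|e0] := leP (eta 0) 0.
  have h : J b <= J 0.
    apply: primitive_le dJ b0 _ => x /andP[_ x0'].
    by rewrite mulr_ge0// oppr_ge0; apply: le_trans e0; exact: nd.
  apply: le_trans Jb _; apply: le_trans h.
  by rewrite ler_piMl// lerBlDr lerDl.
have [r rb er] : exists2 r, b <= r <= 0 & eta r = 0.
  have := @IVT R eta b 0 0 b0 (continuous_subspaceT (primitive_continuous deta)).
  rewrite (min_idPl (nd _ _ b0)) (max_idPr (nd _ _ b0)) (ltW e0) (ltW eb) => /(_ isT).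
  by move=> [c]; rewrite in_itv/=; exists c.
move: rb => /andP[br r0].
have Jr x : J x <= J r.
  have [xr|/ltW rx] := leP x r.
    apply: primitive_le dJ xr _ => y /andP[_ yr].
    by rewrite mulr_ge0// oppr_ge0 -er nd.
  apply: primitive_ge dJ rx _ => y /andP[ry _].
  by rewrite mulNr oppr_le0 mulr_ge0// -er nd.
have [S dS] := primitive_exists (primitive_continuous (primitive_expR (primitiveZ (eps^-1) dF))).
have {}dS : primitive S (fun x => E x).
  by move=> x; have := dS x; rewrite mulrC.
have etaG z : r <= z -> z <= 0 -> eta z * G z <= lam / eps * J r * - x0.
  move=> rz z0; have c0 : 0 <= lam / eps * J r by apply: mulr_ge0 => //; exact: divr_ge0.
  have h1 : eta z - eta r <= lam / eps * J r * E z * (z - r).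
    apply: primitive_ub deta rz _ => x /andP[rx xz].
    rewrite (eta1_flux F eps0 eta1 lam0) -(mulrA _ (J r)) ler_wpM2l ?divr_ge0//.
    rewrite mulrC ler_pM// ler_expR ler_pM2r ?invr_gt0// F_inc//; lra.
  rewrite er subr0 in h1.
  apply: le_trans (ler_wpM2r (G_ge0 z) h1) _.
  rewrite (_ : _ * G z = lam / eps * J r * (E z * G z) * (z - r)); last by ring.
  rewrite weight_inv mulr1 ler_wpM2l//; lra.
have h : J r - J 0 <= lam / eps * J r * x0 ^+ 2.
  have : - (lam / eps * J r * - x0) * (0 - r) <= J 0 - J r.
    apply: primitive_lb dJ r0 _ => x /andP[rx xz].
    by rewrite mulNr lerN2; exact: etaG.
  have : lam / eps * J r * - x0 * (0 - r) <= lam / eps * J r * - x0 * - x0.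
    apply: ler_wpM2l; last by lra.
    by apply: mulr_ge0; [apply: mulr_ge0 => //; exact: divr_ge0|rewrite oppr_ge0 ltW].
  by rewrite expr2; lra.
apply: le_trans Jb _.
have := ler_wpM2l (_ : 0 <= 1 - lam / eps * x0 ^+ 2) (Jr b).
rewrite subr_ge0 => /(_ small); lra.
Qed.

(** J(0) is J(d) plus the integral of eta G over [0, d], where eta >= - Hm. *)
Lemma flux_barrier_ge_right d : 0 <= d ->
  eta d * (lp - P d) - Hm * (P d - P 0) <= J 0.
Proof.
move=> d0.
have dJ := flux_primitive dF eps0 deta1 ode lam0.
have h : J d - Hm * P d <= J 0 - Hm * P 0.
  apply: (primitive_ge (primitiveB dJ (primitiveZ Hm dP)) d0) => x _.
  rewrite (_ : _ - _ = - ((eta x + Hm) * G x)); last by ring.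
  by rewrite oppr_le0 mulr_ge0// -lerBlDr sub0r (eta_ge_lim deta eta_inc etam).
have := flux_ge dF eps0 tailR dP limp deta deta1 ode lam0 eta_inc etap Hp0 d.
lra.
Qed.

(** The sign of eta at 0 decides whether the Hardy type bound is used to the right or to the left of
    0. In each case S and P are bounded below by rectangles, of heights exp(F d / eps) and G y on
    the right; the sum of the two resulting bounds covers both cases. *)
Lemma eigenvalue_bound d y d' y' kap : 0 < d -> d < y -> y < x1 ->
  x0 < y' -> y' < d' -> d' < 0 -> kap <= F d - F y -> kap <= F d' - F y' ->
  lam / eps <= ((d * (x1 - y))^-1 + (- d' * (y' - x0))^-1) * expR (- kap / eps).
Proof.
move=> d0 dy yx1 x0y' y'd' d'0 k1 k2; have [x00' x10'] := (x00, x10).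
have [S dS] := primitive_exists (primitive_continuous (primitive_expR (primitiveZ (eps^-1) dF))).
have {}dS : primitive S (fun x => E x).
  by move=> x; have := dS x; rewrite mulrC.
have nd := eta_nd deta eta_inc.
have key (s n a c u v : R) : 0 < a -> 0 < c -> a * E u <= s -> c * G v <= n -> kap <= F u - F v ->
   lam / eps * (s * n) <= 1 -> lam / eps <= (a * c)^-1 * expR (- kap / eps).
  move=> a0 c0 hs hn hk h1.
  rewrite mulNr expRN -invfM -[leRHS]div1r ler_pdivlMr ?mulr_gt0 ?expR_gt0//.
  apply: le_trans h1; rewrite ler_wpM2l ?divr_ge0//.
  apply: le_trans (_ : (a * E u) * (c * G v) <= _); last first.
    by rewrite ler_pM// mulr_ge0// ltW.
  rewrite (_ : (a * E u) * _ = a * c * (E u * G v)); last by ring.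
  by rewrite weight_ratio ler_wpM2l ?(ltW (mulr_gt0 a0 c0))// ler_expR ler_pM2r ?invr_gt0.
have i1 : 0 < d * (x1 - y) by rewrite mulr_gt0// subr_gt0.
have i2 : 0 < - d' * (y' - x0) by rewrite mulr_gt0 ?oppr_gt0// subr_gt0.
rewrite mulrDl.
have [e0|e0] := leP 0 (eta 0).
  have := eigenvalue_le dF eps0 tailR dP limp deta deta1 ode lam0 eta_inc etap Hp0 dS e0 (ltW d0) (le_lt_trans e0 (eta_inc d0)).
  move=> h; apply: le_trans (key _ _ d (x1 - y) d y d0 _ _ _ k1 h) _.
  - by rewrite subr_gt0.
  - rewrite mulrC; have := @primitive_lb _ _ _ _ _ (E d) dS (ltW d0); rewrite subr0; apply=> x /andP[xx xd].
    by rewrite ler_expR ler_pM2r ?invr_gt0// F_dec//; lra.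
  - apply: le_trans (_ : P x1 - P y <= _).
      rewrite mulrC; have := @primitive_lb _ _ _ _ _ (G y) dP (ltW yx1); apply=> x /andP[xx xd].
      by apply: weight_inc; rewrite F_dec//; lra.
    have := homo_le_lim x1 (weight_prim_nd dP) limp.
    have := weight_prim_nd dP (ltW dy); lra.
  by rewrite lerDl mulr_ge0 ?expR_ge0// invr_ge0 ltW.
have := eigenvalue_le_left dF eps0 tailL dP limm deta deta1 ode lam0 eta_inc etam Hm0 dS (ltW e0) (ltW d'0) (lt_trans (eta_inc d'0) e0).
move=> h; apply: le_trans (key _ _ (- d') (y' - x0) d' y' _ _ _ _ k2 h) _.
- by rewrite oppr_gt0.
- by rewrite subr_gt0.
- rewrite mulrC; have := @primitive_lb _ _ _ _ _ (E d') dS (ltW d'0); rewrite sub0r; apply=> x /andP[xx xd].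
  by rewrite ler_expR ler_pM2r ?invr_gt0// F_inc//; lra.
- apply: le_trans (_ : P y' - P x0 <= _).
    rewrite mulrC; have := @primitive_lb _ _ _ _ _ (G y') dP (ltW x0y'); apply=> x /andP[xx xd].
    by apply: weight_inc; rewrite F_inc//; lra.
  have := weight_head_ge0 dP limm x0; have := weight_prim_nd dP (ltW y'd'); lra.
by rewrite lerDr mulr_ge0 ?expR_ge0// invr_ge0 ltW.
Qed.

End Barrier.

(** * Small-noise asymptotics *)

(** P is the distribution function of the unnormalized Gibbs measure, up to a constant, so lp - lm
    is its total mass; S is the scale function of the diffusion; Hp and - Hm are the limits of
    eta. *)
Record spectral_data (R : realType) (F F1 : R -> R) (eps : R) (P S : R -> R)
    (lp lm : R) (eta eta1 eta2 : R -> R) (lam Hp Hm : R) : Prop := SpectralData {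
  sd_dP : primitive P (weight F eps);
  sd_dS : primitive S (fun x => expR (F x / eps));
  sd_lp : P x @[x --> +oo] --> lp;
  sd_lm : P x @[x --> -oo] --> lm;
  sd_deta : primitive eta eta1;
  sd_deta1 : primitive eta1 eta2;
  sd_ode : forall x, eps * eta2 x - F1 x * eta1 x = - lam * eta x;
  sd_lam : 0 < lam;
  sd_inc : {homo eta : x y / x < y};
  sd_Hp : eta x @[x --> +oo] --> Hp;
  sd_Hp0 : 0 < Hp;
  sd_Hm : eta x @[x --> -oo] --> - Hm;
  sd_Hm0 : 0 < Hm }.

Section SmallNoise.
Context {R : realType}.
Implicit Types (f g h : R -> R).

Definition lim0 f (l : R) : Prop := f eps @[eps --> 0^'+] --> l.

Lemma near0_pos (e : R) : 0 < e -> \forall eps \near (0 : R)^'+, 0 < eps < e.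
Proof.
move=> e0; near=> x; apply/andP; split; near: x; first exact: nbhs_right_gt.
exact: nbhs_right_lt.
Unshelve. all: by end_near.
Qed.

Lemma lim0_eq f g l : (forall eps, 0 < eps -> f eps = g eps) -> lim0 f l -> lim0 g l.
Proof.
move=> fg; apply: cvg_trans; apply: near_eq_cvg.
by near=> x; apply: fg; near: x; exact: nbhs_right_gt.
Unshelve. all: by end_near.
Qed.

Lemma lim0_squeeze f g h l : (\forall eps \near 0^'+, f eps <= g eps <= h eps) ->
  lim0 f l -> lim0 h l -> lim0 g l.
Proof. by move=> fgh; exact: (squeeze_cvgr fgh). Qed.

Lemma lim0_near1 f g : lim0 g 0 -> (\forall eps \near 0^'+, 1 - g eps <= f eps <= 1) ->
  lim0 f 1.
Proof.
move=> g0 fg; apply: (@lim0_squeeze (fun eps => 1 - g eps) _ (fun=> 1) _ fg).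
  by rewrite -[X in lim0 _ X]subr0; apply: cvgB => //; exact: cvg_cst.
exact: cvg_cst.
Qed.

Lemma lim0_cst (l : R) : lim0 (fun=> l) l. Proof. exact: cvg_cst. Qed.
Arguments lim0_cst l : clear implicits.

Lemma lim0D f g a b : lim0 f a -> lim0 g b -> lim0 (fun x => f x + g x) (a + b).
Proof. by move=> fa gb; apply: cvgD. Qed.
Lemma lim0B f g a b : lim0 f a -> lim0 g b -> lim0 (fun x => f x - g x) (a - b).
Proof. by move=> fa gb; apply: cvgB. Qed.
Lemma lim0M f g a b : lim0 f a -> lim0 g b -> lim0 (fun x => f x * g x) (a * b).
Proof. by move=> fa gb; apply: cvgM. Qed.
Lemma lim0V f a : a != 0 -> lim0 f a -> lim0 (fun x => (f x)^-1) a^-1.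
Proof. by move=> a0 fa; apply: cvgV. Qed.

Lemma lim0_mulr (c : R) f a : lim0 f a -> lim0 (fun x => f x * c) (a * c).
Proof. by move=> fa; apply: (lim0M fa); exact: lim0_cst. Qed.

Lemma lim0_1B f a : lim0 f a -> lim0 (fun x => 1 - f x) (1 - a).
Proof. by move=> fa; exact: (lim0B (lim0_cst 1) fa). Qed.

Lemma lim0_small f g : (\forall eps \near 0^'+, `|f eps| <= g eps) ->
  lim0 g 0 -> lim0 f 0.
Proof.
move=> fg g0; apply: (@lim0_squeeze (fun x => - g x) _ g) => //.
  by apply: filterS fg => x; rewrite ler_norml.
by rewrite -oppr0; apply: cvgN.
Qed.

Lemma lim0_exp (c C : R) : 0 < c -> lim0 (fun eps => C * expR (- c / eps)) 0.
Proof.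
move=> c0; apply: (@lim0_small _ (fun eps => `|C| / c * eps)).
  have := near0_pos ltr01; apply: filterS => x /andP[x0 x1].
  rewrite normrM -mulrA ler_wpM2l// ger0_norm ?expR_ge0//.
  have cx : 0 < c / x by rewrite divr_gt0.
  rewrite mulNr expRN -[leRHS]invrK lef_pV2 ?posrE ?expR_gt0 ?invr_gt0 ?mulr_gt0 ?invr_gt0//.
  by rewrite invfM invrK; have := expR_ge1Dx (c / x); lra.
rewrite -(mulr0 (`|C| / c)); apply: lim0M; first exact: lim0_cst.
by apply: cvg_at_right_filter; exact: cvg_id.
Qed.

Lemma lim0_le_exp f (c C : R) : 0 < c ->
  (forall eps, 0 < eps -> eps <= 1 -> `|f eps| <= C * expR (- c / eps)) ->
  lim0 f 0.
Proof.
move=> c0 hf; apply: lim0_small (lim0_exp C c0).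
by have := near0_pos ltr01; apply: filterS => x /andP[x0 /ltW]; exact: hf.
Qed.

End SmallNoise.
Arguments lim0_cst {R} l.

Section Asymptotics.
Context {R : realType}.
Context (F F1 : R -> R) (p k L p' k' L' x0 x1 : R).
Context (dF : primitive F F1)
  (tailR : superlinear F1 p k L)
  (tailL : superlinear (fun x => - F1 (- x)) p' k' L')
  (x00 : x0 < 0) (x10 : 0 < x1) (x1L : x1 <= L) (x0L : - x0 <= L')
  (F_decl : forall x y, x <= y -> y <= x0 -> F y <= F x)
  (F_inc : forall x y, x0 <= x -> x <= y -> y <= 0 -> F x <= F y)
  (F_dec : forall x y, 0 <= x -> x <= y -> y <= x1 -> F y <= F x)
  (F_incr : forall x y, x1 <= x -> x <= y -> F x <= F y)
  (F_sinc : forall x y, x0 < x -> x < y -> y < 0 -> F x < F y)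
  (F_sdec : forall x y, 0 < x -> x < y -> y < x1 -> F y < F x)
  (F01 : F x0 < F x1).
Context (P S eta eta1 eta2 : R -> R -> R) (lp lm lam Hp Hm : R -> R).
Context (sd : forall eps, 0 < eps -> spectral_data F F1 eps (P eps) (S eps)
  (lp eps) (lm eps) (eta eps) (eta1 eps) (eta2 eps) (lam eps) (Hp eps) (Hm eps)).

(** N and M are the masses to the right and to the left of x, Z is the total mass, and D is the
    integral of exp(F / eps) from one well to the other. *)
Let J0 eps := flux F eps (eta1 eps) (lam eps) 0.
Let N eps x := lp eps - P eps x.
Let M eps x := P eps x - lm eps.
Let Z eps := lp eps - lm eps.
Let D eps := S eps x1 - S eps x0.

(** Strict monotonicity is given on open intervals and the weak one on closed intervals; passing
    through two interior points recovers strictness up to the endpoints. The next two lemmas argue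
    alike. *)
Lemma F_lt_0l b : x0 <= b -> b < 0 -> exists2 y, b < y < 0 & F b < F y.
Proof.
move=> x0b b0; have h : b < b / 2 < 0 by lra.
have h2 : b / 2 < b / 4 < 0 by lra.
exists (b / 4); first by lra.
apply: le_lt_trans (_ : F (b / 2) < _); last by apply: F_sinc; lra.
by apply: F_inc; lra.
Qed.

Lemma F_lt_0r c : 0 < c -> c <= x1 -> exists2 y, 0 < y < c & F c < F y.
Proof.
move=> c0 cx1; have h : 0 < c / 4 < c / 2 by lra.
exists (c / 4); first by lra.
apply: le_lt_trans (_ : F (c / 2) < _); first by apply: F_dec; lra.
by apply: F_sdec; lra.
Qed.

Lemma F_gt_x1 c : 0 <= c -> c < x1 -> exists2 y, c < y < x1 & F y < F c.
Proof.
move=> c0 cx1; exists ((c + 3 * x1) / 4); first by lra.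
apply: lt_le_trans (_ : F ((c + x1) / 2) <= _); first by apply: F_sdec; lra.
by apply: F_dec; lra.
Qed.

Lemma F1_lt_F0 : F x1 < F 0.
Proof.
have [|y hy Fy] := F_lt_0r x10; first by [].
by apply: lt_le_trans Fy _; apply: F_dec; lra.
Qed.

Lemma F_near_right (a e : R) : 0 < e -> exists2 d, 0 < d & forall x, `|x - a| <= d -> `|F x - F a| < e.
Proof.
move=> e0; have := primitive_continuous dF (x := a).
move=> /cvgrPdist_lt /(_ e e0) [d /= d0 hd].
exists (d / 2); first by rewrite divr_gt0.
move=> x xa; rewrite distrC; apply: hd; rewrite /= distrC.
by apply: le_lt_trans xa _; lra.
Qed.

Lemma F_ge_min b w : x0 <= b -> b <= 0 -> b <= w -> Num.min (F b) (F x1) <= F w.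
Proof.
move=> x0b b0 bw; rewrite ge_min; have [w0|/ltW w0] := leP w 0.
  by rewrite F_inc.
apply/orP; right; have [w1|/ltW w1] := leP w x1; first by apply: F_dec; lra.
exact: F_incr.
Qed.

(** Provides the constant kap of [eta_near]: beyond d, no descent exceeds the one from d to the
    bottom x1. [F_drop_left] does the same at the other well. *)
Lemma F_drop_right d z w : 0 <= d -> d <= x1 -> d <= z -> z <= w ->
  F z - F w <= F d - F x1.
Proof.
move=> d0 dx1 dz zw.
have dx : F x1 <= F d by apply: F_dec.
have [zx|/ltW xz] := leP z x1; last by have := F_incr xz zw; lra.
have h1 : F z <= F d by apply: F_dec; lra.
have h2 : F x1 <= F w.
  have [wx|/ltW xw] := leP w x1; first by apply: F_dec; lra.
  exact: F_incr.
lra.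
Qed.

Lemma F_drop_left b z w : x0 <= b -> b <= 0 -> w <= z -> z <= b ->
  F z - F w <= F b - F x0.
Proof.
move=> x0b b0 wz zb.
have dx : F x0 <= F b by apply: F_inc.
have [zx|/ltW xz] := leP z x0; first by have := F_decl wz zx; lra.
have h1 : F z <= F b by apply: F_inc; lra.
have h2 : F x0 <= F w.
  have [wx|/ltW xw] := leP w x0; first exact: F_decl.
  by apply: F_inc; lra.
lra.
Qed.

(** The lower barrier F 0 - F x1 governs the rate: on the left the rise F 0 - F x0 is larger, so the
    same kap is available there. *)
Lemma eigenvalue_exp (kap : R) : kap < F 0 - F x1 -> exists C : R,
  forall eps, 0 < eps -> lam eps / eps <= C * expR (- kap / eps).
Proof.
move=> hk; have [x00' x10'] := (x00, x10).
(* Half of the slack may be lost near the top of the barrier and half near the bottom of a well.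
   Below, the caps x1 / 3 and - x0 / 3 keep d < y and y' < d'. *)
pose e := (F 0 - F x1 - kap) / 2.
have e0 : 0 < e by rewrite /e; lra.
have [d1 d10 h1] := F_near_right 0 e0.
have [d2 d20 h2] := F_near_right x1 e0.
have [d3 d30 h3] := F_near_right x0 e0.
pose d := Num.min d1 (x1 / 3).
have dp : 0 < d by rewrite /d lt_min d10/=; lra.
have dd1 : d <= d1 by rewrite /d ge_min lexx.
have dx1 : d <= x1 / 3 by rewrite /d ge_min lexx orbT.
pose y := x1 - Num.min d2 (x1 / 3).
have yp : 0 < Num.min d2 (x1 / 3) by rewrite lt_min d20/=; lra.
have yd2 : Num.min d2 (x1 / 3) <= d2 by rewrite ge_min lexx.
have yx1 : Num.min d2 (x1 / 3) <= x1 / 3 by rewrite ge_min lexx orbT.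
pose d' := - Num.min d1 (- x0 / 3).
have dp' : 0 < Num.min d1 (- x0 / 3) by rewrite lt_min d10/=; lra.
have dd1' : Num.min d1 (- x0 / 3) <= d1 by rewrite ge_min lexx.
have dx1' : Num.min d1 (- x0 / 3) <= - x0 / 3 by rewrite ge_min lexx orbT.
pose y' := x0 + Num.min d3 (- x0 / 3).
have yp' : 0 < Num.min d3 (- x0 / 3) by rewrite lt_min d30/=; lra.
have yd2' : Num.min d3 (- x0 / 3) <= d3 by rewrite ge_min lexx.
have yx1' : Num.min d3 (- x0 / 3) <= - x0 / 3 by rewrite ge_min lexx orbT.
have a1 : `|F d - F 0| < e by apply: h1; rewrite subr0 gtr0_norm.
have a2 : `|F y - F x1| < e.
  by apply: h2; rewrite /y addrC addKr normrN gtr0_norm.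
have a3 : `|F d' - F 0| < e by apply: h1; rewrite subr0 normrN gtr0_norm.
have a4 : `|F y' - F x0| < e.
  by apply: h3; rewrite /y' addrC addKr gtr0_norm.
exists ((d * (x1 - y))^-1 + (- d' * (y' - x0))^-1) => eps eps0.
have [dP dS slp slm deta deta1 ode lam0 inc sHp Hp0 sHm Hm0] := sd eps0.
have F01' := F01.
apply: (eigenvalue_bound dF eps0 tailR tailL dP slp slm deta deta1 ode lam0 inc sHp Hp0 sHm Hm0 x00 x10 F_dec F_inc) => //.
- by rewrite /y; lra.
- by rewrite /y; lra.
- by rewrite /y'; lra.
- by rewrite /y' /d'; lra.
- by rewrite /d'; lra.
- by move: a1 a2; rewrite !ltr_norml /e; lra.
- by move: a3 a4; rewrite !ltr_norml /e; lra.
Qed.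

Lemma eigenvalue_lim0 : lim0 (fun eps => lam eps / eps) 0.
Proof.
have h : 0 < (F 0 - F x1) / 2 by have := F1_lt_F0; lra.
have [|C hC] := @eigenvalue_exp ((F 0 - F x1) / 2); first by lra.
apply: (lim0_le_exp (c := (F 0 - F x1) / 2) (C := C) h) => eps e0 _.
rewrite ger0_norm ?hC// divr_ge0 ?(ltW e0)// ltW//.
exact: (sd_lam (sd e0)).
Qed.

(** The error term of [eta_near]: an exponent kap' strictly between kap and F 0 - F x1 is admissible
    for lam, and exp(- kap' / eps) beats exp(kap / eps). *)
Lemma near_error_lim0 (kap A B c : R) : 0 <= kap -> kap < F 0 - F x1 -> 0 <= A -> 0 <= B -> 0 < c ->
  lim0 (fun eps => lam eps * (A * (A + eps / c) * (expR (kap / eps) / eps) + B)) 0.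
Proof.
move=> k0 hk A0 B0 c0.
pose kap' := (kap + (F 0 - F x1)) / 2.
have hk' : kap' < F 0 - F x1 by rewrite /kap'; lra.
have [C hC] := eigenvalue_exp hk'.
apply: (@lim0_le_exp _ _ (kap' - kap) (C * (A * (A + c^-1) + B))); first by rewrite /kap'; lra.
move=> eps e0 e1; have l0 := ltW (sd_lam (sd e0)).
have E1 : 1 <= expR (kap / eps).
  by rewrite -[leLHS]expR0 ler_expR divr_ge0 ?(ltW e0).
have c0' : 0 < c^-1 by rewrite invr_gt0.
have ec : eps / c <= c^-1 by rewrite ler_piMl// ltW.
have ec0 : 0 <= eps / c by rewrite divr_ge0 ?ltW.
have Ek0 := expR_ge0 (kap / eps).
rewrite ger0_norm; last first.
  rewrite mulr_ge0// addr_ge0// mulr_ge0 ?divr_ge0 ?(ltW e0)// mulr_ge0// addr_ge0//.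
rewrite (_ : lam eps * _ = (lam eps / eps) * (A * (A + eps / c) * expR (kap / eps) + B * eps)); last first.
  by field; rewrite !gt_eqF.
have -> : - (kap' - kap) / eps = - kap' / eps + kap / eps by rewrite -mulrDl opprB addrC.
rewrite expRD.
apply: le_trans (_ : (lam eps / eps) * ((A * (A + c^-1) + B) * expR (kap / eps)) <= _).
  rewrite ler_wpM2l ?divr_ge0 ?(ltW e0)// mulrDl lerD//.
    by rewrite ler_wpM2r// ler_wpM2l// lerD2l.
  by rewrite ler_wpM2l//; lra.
rewrite (_ : C * _ * _ = (C * expR (- kap' / eps)) * ((A * (A + c^-1) + B) * expR (kap / eps))); last by ring.
rewrite ler_wpM2r ?hC// mulr_ge0// addr_ge0// mulr_ge0// addr_ge0// ltW//.
Qed.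

Lemma eta_right_lim d : 0 < d -> d <= x1 -> lim0 (fun eps => eta eps d / Hp eps) 1.
Proof.
move=> d0 dx1; have [p1 k0 L0 _] := tailR; have x1L' := x1L.
have Fd : F d < F 0.
  have [y hy Fy] := F_lt_0r d0 dx1.
  by apply: lt_le_trans Fy _; apply: F_dec; lra.
have Fd1 : F x1 <= F d by apply: F_dec => //; exact: ltW.
have c0 : 0 < k * L `^ p by rewrite mulr_gt0// powR_gt0.
have B0 : 0 <= L `^ (1 - p) / (k * (p - 1)).
  by rewrite divr_ge0 ?powR_ge0// mulr_ge0 ?subr_ge0 ?(ltW k0) ?(ltW p1).
have h := @near_error_lim0 (F d - F x1) (L - d) _ _ _ _ _ B0 c0.
apply: (lim0_near1 (h _ _ _)); [by lra|by lra|by lra|].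
have := near0_pos (@ltr01 R); apply: filterS => eps /andP[e0 _].
have [dP dS slp slm deta deta1 ode lam0 inc sHp Hp0 sHm Hm0] := sd e0.
have h1 := eta_near dF e0 tailR dP slp deta deta1 ode lam0 inc sHp Hp0 (le_trans dx1 x1L)
  (fun z w => @F_drop_right d z w (ltW d0) dx1).
have h2 := eta_le_lim deta inc sHp d.
rewrite ler_pdivlMr// ler_pdivrMr// mul1r h2 andbT mulrBl mul1r.
by rewrite lerBlDr -lerBlDl; apply: le_trans h1 _; rewrite mulrAC.
Qed.

(** In the left well eta is under control only while the rise F b - F x0 stays below F 0 - F x1, the
    exponent available for lam. As F x0 < F x1, this excludes points near 0, and b is taken close to
    x0. *)
Lemma exists_left_well : exists b, [/\ x0 < b, b < 0, F b < F x1 & F b - F x0 < F 0 - F x1].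
Proof.
have [x00' F01'] := (x00, F01); have h0 := F1_lt_F0.
have e0 : 0 < Num.min (F x1 - F x0) (F 0 - F x1) by rewrite lt_min !subr_gt0 F01'.
have [d d0 hd] := F_near_right x0 e0.
have m0 : 0 < Num.min d (- x0 / 2) by rewrite lt_min d0/=; lra.
have m1 : Num.min d (- x0 / 2) <= d by rewrite ge_min lexx.
have m2 : Num.min d (- x0 / 2) <= - x0 / 2 by rewrite ge_min lexx orbT.
have := hd (x0 + Num.min d (- x0 / 2)).
rewrite addrC addKr gtr0_norm// => /(_ m1); rewrite lt_min !ltr_norml => /andP[/andP[_ h1] /andP[_ h2]].
exists (x0 + Num.min d (- x0 / 2)); split; lra.
Qed.

Lemma eta_left_lim b : x0 <= b -> b < 0 -> F b - F x0 < F 0 - F x1 ->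
  lim0 (fun eps => - eta eps b / Hm eps) 1.
Proof.
move=> x0b b0 Fb; have [p1 k0 L0 _] := tailL; have x0L0 := x0L.
have Fd1 : F x0 <= F b by apply: F_inc => //; exact: ltW.
have c0 : 0 < k' * L' `^ p' by rewrite mulr_gt0// powR_gt0.
have B0 : 0 <= L' `^ (1 - p') / (k' * (p' - 1)).
  by rewrite divr_ge0 ?powR_ge0// mulr_ge0 ?subr_ge0 ?(ltW k0) ?(ltW p1).
have h := @near_error_lim0 (F b - F x0) (L' + b) _ _ _ _ _ B0 c0.
apply: (lim0_near1 (h _ _ _)); [by lra|by lra|by lra|].
have := near0_pos (@ltr01 R); apply: filterS => eps /andP[e0 _].
have [dP dS slp slm deta deta1 ode lam0 inc sHp Hp0 sHm Hm0] := sd e0.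
have bL : - L' <= b by lra.
have h1 := eta_near_left dF e0 tailL dP slm deta deta1 ode lam0 inc sHm Hm0 bL
  (fun z w => @F_drop_left b z w x0b (ltW b0)).
have h2 := eta_ge_lim deta inc sHm b.
rewrite ler_pdivlMr// ler_pdivrMr// mul1r mulrBl mul1r.
rewrite [X in _ && X]lerNl h2 andbT lerBlDr addrC -lerBlDr opprK.
by apply: le_trans h1 _; rewrite mulrAC.
Qed.

Let G_le eps x y : 0 < eps -> F y <= F x -> weight F eps x <= weight F eps y.
Proof. by move=> e0 Fxy; rewrite /weight ler_expR ler_pM2r ?invr_gt0// lerN2. Qed.

Let nd_P eps : 0 < eps -> {homo P eps : x y / x <= y}.
Proof. by move=> e0; exact: (weight_prim_nd (sd_dP (sd e0))). Qed.

Let N_ge0 eps x : 0 < eps -> 0 <= N eps x.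
Proof. by move=> e0; exact: (weight_tail_ge0 (sd_dP (sd e0)) (sd_lp (sd e0))). Qed.

Let M_ge0 eps x : 0 < eps -> 0 <= M eps x.
Proof. by move=> e0; exact: (weight_head_ge0 (sd_dP (sd e0)) (sd_lm (sd e0))). Qed.

(** The form in which Laplace's principle is used throughout: only the order of the exponents
    matters, not the prefactors. *)
Lemma ratio_lim0 (a b : R -> R) (A B f g : R) : g < f -> 0 < B ->
  (forall eps, 0 < eps -> eps <= 1 -> 0 <= a eps <= A * expR (- f / eps)) ->
  (forall eps, 0 < eps -> B * expR (- g / eps) <= b eps) ->
  lim0 (fun eps => a eps / b eps) 0.
Proof.
move=> gf B0 ha hb; apply: (@lim0_le_exp _ _ (f - g) (A / B)); first by rewrite subr_gt0.
move=> eps e0 e1; have /andP[a0 aA] := ha _ e0 e1; have bB := hb _ e0.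
have A0 : 0 <= A by rewrite -(pmulr_lge0 _ (expR_gt0 (- f / eps))); exact: le_trans a0 aA.
have Be : 0 < B * expR (- g / eps) by rewrite mulr_gt0 ?expR_gt0.
have b0 : 0 < b eps by exact: lt_le_trans Be bB.
rewrite ger0_norm ?divr_ge0 ?(ltW b0)//.
rewrite ler_pdivrMr//; apply: le_trans aA _.
have -> : expR (- f / eps) = expR (- (f - g) / eps) * expR (- g / eps).
  by rewrite -expRD -mulrDl opprB addrAC subrr add0r.
rewrite (_ : A * _ = A / B * expR (- (f - g) / eps) * (B * expR (- g / eps))); last first.
  by field; rewrite gt_eqF.
by rewrite ler_wpM2l// mulr_ge0 ?expR_ge0// divr_ge0// ltW.
Qed.

(** To the right of b the potential is at least min(F b, F x1), and some y between x0 and b lies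
    strictly below that level because F x0 < F x1; the mass of [x0, y] then dominates. *)
Lemma tail_mass_lim b : x0 < b -> b <= 0 -> lim0 (fun eps => N eps b / Z eps) 0.
Proof.
move=> x0b b0; have [x00' F01'] := (x00, F01); have x1L' := x1L.
have [p1 k0 L0 _] := tailR.
have c0 : 0 < k * L `^ p by rewrite mulr_gt0// powR_gt0.
have [y [hy1 hy2 hy3]] : exists y, [/\ x0 < y, y < b & F y < Num.min (F b) (F x1)].
  have e0 : 0 < F x1 - F x0 by rewrite subr_gt0.
  have [d d0 hd] := F_near_right x0 e0.
    have m0 : 0 < Num.min d ((b - x0) / 4) by rewrite lt_min d0/=; lra.
    have m1 : Num.min d ((b - x0) / 4) <= d by rewrite ge_min lexx.
    have m2 : Num.min d ((b - x0) / 4) <= (b - x0) / 4 by rewrite ge_min lexx orbT.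
    have := hd (x0 + Num.min d ((b - x0) / 4)).
    rewrite addrC addKr gtr0_norm// => /(_ m1); rewrite ltr_norml => /andP[_ h1].
    exists (x0 + Num.min d ((b - x0) / 4)); split; [lra|lra|].
    rewrite lt_min; apply/andP; split; last by lra.
    apply: lt_le_trans (_ : F ((b + x0) / 2) <= _).
      by apply: F_sinc; lra.
    by apply: F_inc; lra.
apply: (@ratio_lim0 _ _ (L - b + (k * L `^ p)^-1) (y - x0) (Num.min (F b) (F x1)) (F y) hy3).
- by rewrite subr_gt0.
- move=> eps e0 e1; rewrite N_ge0//=.
  have bL : b <= L by lra.
  have := weight_tail_bound dF e0 tailR (sd_dP (sd e0)) (sd_lp (sd e0)) bL
    (fun w => @F_ge_min b w (ltW x0b) b0).
  move=> /le_trans; apply; rewrite ler_wpM2r ?expR_ge0// lerD2l ler_piMl// invr_ge0 ltW//.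
- move=> eps e0; apply: le_trans (_ : P eps y - P eps x0 <= _).
    rewrite mulrC; apply: (primitive_lb (sd_dP (sd e0)) (ltW hy1)) => x /andP[xx xy].
    by apply: G_le => //; apply: F_inc; lra.
  by have := N_ge0 y e0; have := M_ge0 x0 e0; rewrite /N /M /Z; lra.
Qed.

Lemma right_mass_lim d : 0 < d -> d < x1 -> lim0 (fun eps => (P eps d - P eps 0) / N eps 0) 0.
Proof.
move=> d0 dx1; have [y hy Fy] := F_gt_x1 (ltW d0) dx1; have [x00' F01'] := (x00, F01).
apply: (@ratio_lim0 _ _ d (x1 - y) (F d) (F y) Fy).
- by rewrite subr_gt0; case/andP: hy.
- move=> eps e0 e1; rewrite subr_ge0 nd_P ?(ltW d0)//=.
  have := @primitive_ub _ _ _ 0 d (weight F eps d) (sd_dP (sd e0)) (ltW d0).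
  rewrite subr0 mulrC; apply=> x /andP[xx xd].
  by apply: G_le => //; apply: F_dec; lra.
- move=> eps e0; apply: le_trans (_ : P eps x1 - P eps y <= _).
    rewrite mulrC; apply: (primitive_lb (sd_dP (sd e0))); first by lra.
    move=> x /andP[xx xy].
    by apply: G_le => //; apply: F_dec; lra.
  have y0 : 0 <= y by lra.
  by have := N_ge0 x1 e0; have := nd_P e0 y0; rewrite /N; lra.
Qed.

Let E_le eps x y : 0 < eps -> F x <= F y -> expR (F x / eps) <= expR (F y / eps).
Proof. by move=> e0 Fxy; rewrite ler_expR ler_pM2r ?invr_gt0. Qed.

Let nd_S eps : 0 < eps -> {homo S eps : x y / x <= y}.
Proof. by move=> e0; apply: (primitive_nd (sd_dS (sd e0))) => x; exact: expR_ge0. Qed.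

(** The scale function accumulates near 0, so the part of D away from the barrier is negligible. For
    this reason the mean exit times do not feel the radius of the target ball; [barrier_right_lim]
    is the counterpart on the other side. *)
Lemma barrier_left_lim b : x0 <= b -> b < 0 -> lim0 (fun eps => (S eps b - S eps x0) / D eps) 0.
Proof.
move=> x0b b0; have [y hy Fy] := F_lt_0l x0b b0; have [x00' x10'] := (x00, x10).
apply: (@ratio_lim0 _ _ (b - x0) (- y) (- F b) (- F y)).
- by rewrite ltrN2.
- by rewrite oppr_gt0; case/andP: hy.
- move=> eps e0 e1; rewrite subr_ge0 nd_S//= opprK mulrC.
  apply: (primitive_ub (sd_dS (sd e0)) x0b) => x /andP[xx xb].
  by apply: E_le => //; apply: F_inc; lra.
- move=> eps e0; rewrite opprK; apply: le_trans (_ : S eps 0 - S eps y <= _).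
    rewrite -(sub0r y) mulrC; apply: (primitive_lb (sd_dS (sd e0))); first by lra.
    by move=> x /andP[xx xb]; apply: E_le => //; apply: F_inc; lra.
  have h1 : x0 <= y by lra.
  by have := nd_S e0 h1; have := nd_S e0 (ltW x10'); rewrite /D; lra.
Qed.

Lemma barrier_right_lim c : 0 < c -> c <= x1 -> lim0 (fun eps => (S eps x1 - S eps c) / D eps) 0.
Proof.
move=> c0 cx1; have [y hy Fy] := F_lt_0r c0 cx1; have [x00' x10'] := (x00, x10).
apply: (@ratio_lim0 _ _ (x1 - c) y (- F c) (- F y)).
- by rewrite ltrN2.
- by case/andP: hy.
- move=> eps e0 e1; rewrite subr_ge0 nd_S//= opprK mulrC.
  apply: (primitive_ub (sd_dS (sd e0)) cx1) => x /andP[xx xb].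
  by apply: E_le => //; apply: F_dec; lra.
- move=> eps e0; rewrite opprK; apply: le_trans (_ : S eps y - S eps 0 <= _).
    rewrite -[X in X * _](subr0 y) mulrC; apply: (primitive_lb (sd_dS (sd e0))); first by lra.
    by move=> x /andP[xx xb]; apply: E_le => //; apply: F_dec; lra.
  have h1 : y <= x1 by lra.
  by have := nd_S e0 h1; have := nd_S e0 (ltW x00'); rewrite /D; lra.
Qed.


Let dP_gt (eps a b : R) : 0 < eps -> a < b -> P eps a < P eps b.
Proof.
move=> e0 ab; have [c _ h] := primitive_MVT (sd_dP (sd e0)) (ltW ab).
by rewrite -subr_gt0 h mulr_gt0 ?subr_gt0// weight_gt0.
Qed.

Let N0_gt0 eps : 0 < eps -> 0 < N eps 0.
Proof.
move=> e0; apply: lt_le_trans (_ : P eps x1 - P eps 0 <= _).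
  by rewrite subr_gt0 dP_gt.
by have := N_ge0 x1 e0; rewrite /N; lra.
Qed.

Let M0_gt0 eps : 0 < eps -> 0 < M eps 0.
Proof.
move=> e0; apply: lt_le_trans (_ : P eps 0 - P eps x0 <= _).
  by rewrite subr_gt0 dP_gt.
by have := M_ge0 x0 e0; rewrite /M; lra.
Qed.

Let Z_gt0 eps : 0 < eps -> 0 < Z eps.
Proof. by move=> e0; have := N0_gt0 e0; have := M0_gt0 e0; rewrite /N /M /Z; lra. Qed.

Let D_gt0 eps : 0 < eps -> 0 < D eps.
Proof.
move=> e0; have x01 : x0 < x1 := lt_trans x00 x10.
have [c _ h] := primitive_MVT (sd_dS (sd e0)) (ltW x01).
by rewrite /D h mulr_gt0 ?expR_gt0 ?subr_gt0.
Qed.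

(** Above, J(0) <= Hm M(0) <= Hm Z. Below, [flux_barrier_ge] at a point b of the left well, where
    eta b ~ - Hm and the mass to the left of b is almost Z. *)
Lemma flux_left_lim : lim0 (fun eps => J0 eps / (Hm eps * Z eps)) 1.
Proof.
have [b [x0b b0 _ Fb]] := exists_left_well.
have etab := eta_left_lim (ltW x0b) b0 Fb.
have Nb := tail_mass_lim x0b (ltW b0).
have small : lim0 (fun eps => lam eps / eps * x0 ^+ 2) 0.
  by rewrite -[X in lim0 _ X](mul0r (x0 ^+ 2)); exact: lim0_mulr eigenvalue_lim0.
have low : lim0 (fun eps => (1 - lam eps / eps * x0 ^+ 2) * (- eta eps b / Hm eps)
    * (1 - N eps b / Z eps)) 1.
  rewrite [X in lim0 _ X](_ : 1 = (1 - 0) * 1 * (1 - 0) :> R); last by rewrite subr0 !mulr1.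
  by apply: lim0M; [apply: lim0M => //|]; exact: lim0_1B.
apply: (lim0_squeeze _ low (lim0_cst 1)).
have e1 : \forall eps \near (0:R)^'+, 0 < - eta eps b / Hm eps by apply: (cvgr_gt _ etab).
have e2 : \forall eps \near (0:R)^'+, lam eps / eps * x0 ^+ 2 < 1 by apply: (cvgr_lt _ small).
near=> eps.
have e0 : 0 < eps by near: eps; exact: nbhs_right_gt.
have [dP dS slp slm deta deta1 ode lam0 inc sHp Hp0 sHm Hm0] := sd e0.
have Zp := Z_gt0 e0; have HZ : 0 < Hm eps * Z eps by rewrite mulr_gt0.
apply/andP; split.
  rewrite ler_pdivlMr//.
  have eb : eta eps b < 0.
    have : 0 < - eta eps b / Hm eps by near: eps.
    by rewrite pmulr_lgt0 ?invr_gt0// oppr_gt0.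
  have s1 : lam eps / eps * x0 ^+ 2 <= 1 by apply/ltW; near: eps.
  have := flux_barrier_ge dF e0 tailL dP slm deta deta1 ode lam0 inc sHm Hm0 x00 x10 F_inc (ltW x0b) (ltW b0) eb s1.
  move=> h; apply: le_trans h; rewrite le_eqVlt; apply/orP; left; apply/eqP.
  by rewrite /N /Z; field; rewrite !gt_eqF.
rewrite ler_pdivrMr// mul1r.
apply: le_trans (flux_le_left dF e0 tailL dP slm deta deta1 ode lam0 inc sHm Hm0 0) _.
rewrite ler_pM2l//; have := N_ge0 0 e0; rewrite /N /Z; lra.
Unshelve. all: by end_near.
Qed.

Lemma right_mass0_lim : lim0 (fun eps => N eps 0 / Z eps) 0.
Proof. exact: tail_mass_lim x00 (lexx 0). Qed.

(** The flux at 0 is equivalent to Hm Z and at most Hp N(0), so Hm / Hp is bounded by a quantity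
    equivalent to N(0) / Z. *)
Lemma eta_ratio_lim : lim0 (fun eps => Hm eps / Hp eps) 0.
Proof.
have a1 := flux_left_lim.
have up : lim0 (fun eps => N eps 0 / Z eps / (J0 eps / (Hm eps * Z eps))) 0.
  rewrite -[X in lim0 _ X](mul0r 1^-1); apply: lim0M right_mass0_lim _.
  by apply: lim0V a1; exact: oner_neq0.
apply: (lim0_squeeze _ (lim0_cst 0) up).
have e1 : \forall eps \near (0:R)^'+, 0 < J0 eps / (Hm eps * Z eps) by apply: (cvgr_gt _ a1).
near=> eps.
have e0 : 0 < eps by near: eps; exact: nbhs_right_gt.
have [dP dS slp slm deta deta1 ode lam0 inc sHp Hp0 sHm Hm0] := sd e0.
have Zp := Z_gt0 e0.
rewrite divr_ge0 ?(ltW Hm0) ?(ltW Hp0)//=.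
have a0 : 0 < J0 eps / (Hm eps * Z eps) by near: eps.
have := flux_le dF e0 tailR dP slp deta deta1 ode lam0 inc sHp Hp0 0.
rewrite -/(J0 eps) -/(N eps 0) => h.
rewrite ler_pdivlMr// ler_pdivlMr//.
rewrite [leLHS](_ : _ = J0 eps / Hp eps); last by field; rewrite !gt_eqF.
by rewrite ler_pdivrMr// mulrC.
Unshelve. all: by end_near.
Qed.

(** The lower bound takes d = x1 / 2 in [flux_barrier_ge_right]; eta d ~ Hp, and the interval [0, d]
    carries a negligible share of N(0). *)
Lemma flux_right_lim : lim0 (fun eps => J0 eps / (Hp eps * N eps 0)) 1.
Proof.
have [h1 h2 h3] : [/\ 0 < x1 / 2, x1 / 2 < x1 & x1 / 2 <= x1] by have x10' := x10; split; lra.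
set d := x1 / 2 in h1 h2 h3.
have r := right_mass_lim h1 h2.
have low : lim0 (fun eps => eta eps d / Hp eps * (1 - (P eps d - P eps 0) / N eps 0)
   - Hm eps / Hp eps * ((P eps d - P eps 0) / N eps 0)) 1.
  rewrite [X in lim0 _ X](_ : 1 = 1 * (1 - 0) - 0 * 0 :> R); last by rewrite subr0 mulr0 subr0 mulr1.
  apply: lim0B; last exact: lim0M eta_ratio_lim r.
  apply: lim0M; first exact: eta_right_lim.
  exact: lim0_1B.
apply: (lim0_squeeze _ low (lim0_cst 1)).
have := near0_pos (@ltr01 R); apply: filterS => eps /andP[e0 _].
have [dP dS slp slm deta deta1 ode lam0 inc sHp Hp0 sHm Hm0] := sd e0.
have Np := N0_gt0 e0; have HN : 0 < Hp eps * N eps 0 by rewrite mulr_gt0.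
apply/andP; split.
  rewrite ler_pdivlMr//.
  have := flux_barrier_ge_right dF e0 tailR dP slp deta deta1 ode lam0 inc sHp Hp0 sHm (ltW h1).
  move=> h; apply: le_trans h; rewrite le_eqVlt; apply/orP; left; apply/eqP.
  rewrite (_ : lp eps - P eps d = N eps 0 - (P eps d - P eps 0)); last by rewrite /N; ring.
  by field; rewrite !gt_eqF.
rewrite ler_pdivrMr// mul1r.
by have := flux_le dF e0 tailR dP slp deta deta1 ode lam0 inc sHp Hp0 0.
Qed.

Lemma eta_x0_lim : lim0 (fun eps => eta eps x0 / Hp eps) 0.
Proof.
apply: lim0_small eta_ratio_lim.
have [b [x0b b0 _ Fb]] := exists_left_well.
have etab := eta_left_lim (ltW x0b) b0 Fb.
have e1 : \forall eps \near (0:R)^'+, 0 < - eta eps b / Hm eps by apply: (cvgr_gt _ etab).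
near=> eps.
have e0 : 0 < eps by near: eps; exact: nbhs_right_gt.
have [dP dS slp slm deta deta1 ode lam0 inc sHp Hp0 sHm Hm0] := sd e0.
have eb : eta eps b < 0.
  have : 0 < - eta eps b / Hm eps by near: eps.
  by rewrite pmulr_lgt0 ?invr_gt0// oppr_gt0.
have := inc _ _ x0b; have := eta_ge_lim deta inc sHm x0 => h1 h2.
rewrite normrM normfV (gtr0_norm Hp0) ler_pM2r ?invr_gt0// ltr0_norm; lra.
Unshelve. all: by end_near.
Qed.

(** Integrating eta' across the barrier with the flux frozen at J(0) gives eta x1 - eta x0 = (lam /
    eps) J(0) D up to o(Hp). The left side is ~ Hp and J(0) ~ Hp N(0), which leaves lam D N(0) ~
    eps. *)
Lemma barrier_rate_lim : lim0 (fun eps => lam eps / eps * D eps * N eps 0) 1.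
Proof.
have x01 : x0 < x1 := lt_trans x00 x10.
pose err eps := (eta eps x1 - eta eps x0 - lam eps / eps * J0 eps * D eps) / Hp eps.
have err0 : lim0 err 0.
  apply: (@lim0_small _ _ (fun eps => lam eps / eps * ((1 + Hm eps / Hp eps) * (x1 - x0) * (x1 - x0)))); last first.
    rewrite -[X in lim0 _ X](mul0r ((1 + 0) * (x1 - x0) * (x1 - x0))); apply: lim0M eigenvalue_lim0 _.
    apply: lim0_mulr; apply: lim0_mulr.
    exact: (lim0D (lim0_cst 1) eta_ratio_lim).
  have := near0_pos (@ltr01 R); apply: filterS => eps /andP[e0 _].
  have [dP dS slp slm deta deta1 ode lam0 inc sHp Hp0 sHm Hm0] := sd e0.
  have lam0e : 0 <= lam eps / eps by rewrite divr_ge0 ?ltW.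
  have deta' : primitive (eta eps) (fun x => lam eps / eps * (expR (F x / eps) * flux F eps (eta1 eps) (lam eps) x)).
    by move=> x; have := deta x; rewrite (eta1_flux F e0 (eta1 eps) lam0).
  have bound x : `|- eta eps x * weight F eps x| <= (Hp eps + Hm eps) * weight F eps x.
    rewrite normrM normrN (gtr0_norm (weight_gt0 _ _ _)) ler_pM2r ?weight_gt0//.
    have := eta_ge_lim deta inc sHm x; have := eta_le_lim deta inc sHp x.
    by rewrite ler_norml; lra.
  have := barrier_integral e0 x00 x10 F_dec F_inc dS lam0e deta'
     (flux_primitive dF e0 deta1 ode lam0) bound (lexx x0) (ltW x01) (lexx x1).
  rewrite -/(J0 eps) -/(D eps) => h.
  rewrite /err normrM normfV (gtr0_norm Hp0) ler_pdivrMr//; apply: le_trans h _.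
  by rewrite le_eqVlt; apply/orP; left; apply/eqP; field; rewrite !gt_eqF.
have main : lim0 (fun eps => (eta eps x1 / Hp eps - eta eps x0 / Hp eps - err eps) / (J0 eps / (Hp eps * N eps 0))) 1.
  rewrite [X in lim0 _ X](_ : 1 = (1 - 0 - 0) / 1 :> R); last by rewrite !subr0 divr1.
  apply: lim0M.
    apply: lim0B err0; apply: lim0B eta_x0_lim.
    by apply: eta_right_lim.
  by apply: lim0V flux_right_lim; exact: oner_neq0.
have Jpos : \forall eps \near (0:R)^'+, 0 < J0 eps / (Hp eps * N eps 0) by apply: (cvgr_gt _ flux_right_lim).
apply: cvg_trans main; apply: near_eq_cvg; near=> eps.
have e0 : 0 < eps by near: eps; exact: nbhs_right_gt.
have Hp0 := sd_Hp0 (sd e0); have Np := N0_gt0 e0.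
have J0p : J0 eps != 0.
  have : 0 < J0 eps / (Hp eps * N eps 0) by near: eps.
  by apply: contraTneq => ->; rewrite mul0r ltxx.
by rewrite /err; field; rewrite J0p !gt_eqF.
Unshelve. all: by end_near.
Qed.

(** The function u solves eps u'' - F' u' = - 1 without flux at +oo. Freezing the mass lp - P at 0
    gives u x1 - u b ~ N(0) D / eps, which is ~ 1 / lam by [barrier_rate_lim]. *)
Lemma right_exit_lim (u : R -> R -> R) b : x0 <= b -> b < 0 ->
  (forall eps, 0 < eps -> primitive (u eps)
     (fun x => eps^-1 * (expR (F x / eps) * (lp eps - P eps x)))) ->
  lim0 (fun eps => lam eps * (u eps x1 - u eps b)) 1.
Proof.
move=> x0b b0 du; have bx1 : b <= x1 by have := x10; lra.
pose err eps := lam eps * (u eps x1 - u eps b - eps^-1 * N eps 0 * (S eps x1 - S eps b)).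
have err0 : lim0 err 0.
  apply: (@lim0_small _ _ (fun eps => lam eps / eps * ((x1 - x0) * (x1 - b)))); last first.
    rewrite -[X in lim0 _ X](mul0r ((x1 - x0) * (x1 - b))); exact: lim0_mulr eigenvalue_lim0.
  have := near0_pos (@ltr01 R); apply: filterS => eps /andP[e0 _].
  have [dP dS slp slm deta deta1 ode lam0 inc sHp Hp0 sHm Hm0] := sd e0.
  have bound x : `|0 - weight F eps x| <= 1 * weight F eps x.
    by rewrite sub0r normrN (gtr0_norm (weight_gt0 _ _ _)) mul1r.
  have ie : 0 <= eps^-1 by rewrite invr_ge0 ltW.
  have := barrier_integral e0 x00 x10 F_dec F_inc dS ie (du _ e0)
     (primitiveB (primitive_cst (lp eps)) dP) bound x0b bx1 (lexx x1).
  rewrite mul1r => h.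
  by rewrite /err normrM (gtr0_norm lam0) -[leRHS]mulrA ler_pM2l// mulrA.
apply: (@lim0_eq _ (fun eps => lam eps / eps * D eps * N eps 0 * (1 - (S eps b - S eps x0) / D eps) + err eps)).
  move=> eps e0; rewrite /err; have Dp := D_gt0 e0.
  rewrite (_ : S eps x1 - S eps b = D eps - (S eps b - S eps x0)); last by rewrite /D; ring.
  by field; rewrite !gt_eqF.
rewrite [X in lim0 _ X](_ : 1 = 1 * (1 - 0) + 0 :> R); last by rewrite subr0 mulr1 addr0.
apply: lim0D err0; apply: lim0M barrier_rate_lim _.
exact: lim0_1B (barrier_left_lim x0b b0).
Qed.

Lemma left_exit_lim (w : R -> R -> R) c : 0 < c -> c <= x1 ->
  (forall eps, 0 < eps -> primitive (w eps)
     (fun x => eps^-1 * (expR (F x / eps) * (P eps x - lm eps)))) ->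
  lim0 (fun eps => lam eps * (w eps c - w eps x0) * (Hm eps / Hp eps)) 1.
Proof.
move=> c0 cx1 dw; have x0c : x0 <= c by have := x00; lra.
pose err eps := lam eps * (w eps c - w eps x0 - eps^-1 * M eps 0 * (S eps c - S eps x0)).
have err0 : lim0 err 0.
  apply: (@lim0_small _ _ (fun eps => lam eps / eps * ((x1 - x0) * (c - x0)))); last first.
    rewrite -[X in lim0 _ X](mul0r ((x1 - x0) * (c - x0))); exact: lim0_mulr eigenvalue_lim0.
  have := near0_pos (@ltr01 R); apply: filterS => eps /andP[e0 _].
  have [dP dS slp slm deta deta1 ode lam0 inc sHp Hp0 sHm Hm0] := sd e0.
  have bound x : `|weight F eps x - 0| <= 1 * weight F eps x.
    by rewrite subr0 (gtr0_norm (weight_gt0 _ _ _)) mul1r.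
  have ie : 0 <= eps^-1 by rewrite invr_ge0 ltW.
  have := barrier_integral e0 x00 x10 F_dec F_inc dS ie (dw _ e0)
     (primitiveB dP (primitive_cst (lm eps))) bound (lexx x0) x0c cx1.
  rewrite mul1r => h.
  by rewrite /err normrM (gtr0_norm lam0) -[leRHS]mulrA ler_pM2l// mulrA.
have Jpos : \forall eps \near (0:R)^'+, 0 < J0 eps / (Hm eps * Z eps) by apply: (cvgr_gt _ flux_left_lim).
have main : lim0 (fun eps => lam eps / eps * D eps * N eps 0 * (1 - (S eps x1 - S eps c) / D eps)
   * ((1 - N eps 0 / Z eps) / (J0 eps / (Hm eps * Z eps)) * (J0 eps / (Hp eps * N eps 0))) + err eps * (Hm eps / Hp eps)) 1.
  rewrite [X in lim0 _ X](_ : 1 = 1 * (1 - 0) * ((1 - 0) / 1 * 1) + 0 * 0 :> R); last first.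
    by rewrite mulr0 addr0 subr0 divr1 !mulr1.
  apply: lim0D; last exact: lim0M err0 eta_ratio_lim.
  apply: lim0M.
    apply: lim0M barrier_rate_lim _.
    exact: lim0_1B (barrier_right_lim c0 cx1).
  apply: lim0M flux_right_lim; apply: lim0M.
    exact: lim0_1B right_mass0_lim.
  by apply: lim0V flux_left_lim; exact: oner_neq0.
apply: cvg_trans main; apply: near_eq_cvg; near=> eps.
have e0 : 0 < eps by near: eps; exact: nbhs_right_gt.
have [dP dS slp slm deta deta1 ode lam0 inc sHp Hp0 sHm Hm0] := sd e0.
have Dp := D_gt0 e0; have Np := N0_gt0 e0; have Zp := Z_gt0 e0.
have J0p : J0 eps != 0.
  have : 0 < J0 eps / (Hm eps * Z eps) by near: eps.
  by apply: contraTneq => ->; rewrite mul0r ltxx.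
rewrite /err.
rewrite (_ : S eps c - S eps x0 = D eps - (S eps x1 - S eps c)); last by rewrite /D; ring.
rewrite (_ : M eps 0 = Z eps - N eps 0); last by rewrite /M /Z /N; ring.
by field; rewrite J0p !gt_eqF.
Unshelve. all: by end_near.
Qed.

End Asymptotics.

(** * Line integrals and Gaussian moments *)

Section LineIntegrals.
Context {R : realType}.
Implicit Types (f g h P Q : R -> R) (a b l x y z : R).
Notation mu := (@lebesgue_measure R).

Lemma cont_emeas g (D : set R) : continuous g -> measurable_fun D (EFin \o g).
Proof.
move=> cg; apply/measurable_EFinP; apply: measurable_funTS.
exact: continuous_measurable_fun.
Qed.

Lemma ge0_integral_left g Q l : (forall x, 0 <= g x) -> continuous g ->
  primitive Q g -> Q x @[x --> -oo] --> l ->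
  (\int[mu]_(x in `]-oo, (0:R)%R[) (g x)%:E)%E = (Q 0 - l)%:E.
Proof.
move=> g0 cg Qg Ql.
rewrite integral_itv_bndo_bndc; last exact: cont_emeas.
have cg' : continuous (fun x => g (- x)).
  by move=> x; apply: (continuous_comp (f := -%R) (g := g)); [exact: oppr_continuous|exact: cg].
have dQ' := primitive_reflectN Qg.
have lQ' : - Q (- x) @[x --> +oo] --> - l by apply: cvgN; exact: cvg_reflect.
have := ge0_integral_halfline 0 (fun x => g0 (- x)) cg' dQ' lQ'.
rewrite integral_itv_obnd_cbnd; last exact: cont_emeas.
rewrite ge0_integration_by_substitution0; last 2 first.
- exact: cont_emeas.
- by move=> r; rewrite lee_fin.
under eq_integral do rewrite opprK.
by move=> ->; rewrite opprK oppr0 addrC.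
Qed.

Lemma ge0_integral_line g Q l l' : (forall x, 0 <= g x) -> continuous g ->
  primitive Q g -> Q x @[x --> -oo] --> l -> Q x @[x --> +oo] --> l' ->
  (\int[mu]_(x in [set: R]) (g x)%:E)%E = (l' - l)%:E.
Proof.
move=> g0 cg Qg Ql Ql'.
have -> : [set: R] = `]-oo, (0:R)] `|` `](0:R), +oo[.
  apply/esym/seteqP; split => // x _ /=; rewrite !in_itv/= andbT.
  by case: (leP x 0); [left|right].
rewrite ge0_integral_setU//=.
- rewrite -integral_itv_bndo_bndc; last exact: cont_emeas.
  rewrite (ge0_integral_left g0 cg Qg Ql) (ge0_integral_halfline 0 g0 cg Qg Ql').
  by rewrite -EFinD; congr (_%:E); ring.
- exact: cont_emeas.
- by move=> x _; rewrite lee_fin.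
- apply/disj_setPS => x [/=]; rewrite !in_itv/= andbT => x0 /lt_geF.
  by rewrite x0.
Qed.

Lemma signed_integral (D : set R) g h v w : measurable D ->
  continuous g -> continuous h -> (forall x, `|g x| <= h x) ->
  (\int[mu]_(x in D) (g x + h x)%:E)%E = (v + w)%:E ->
  (\int[mu]_(x in D) (h x)%:E)%E = w%:E ->
  mu.-integrable D (EFin \o g) /\ \int[mu]_(x in D) g x = v.
Proof.
move=> mD cg ch gh e1 e2.
have h0 x : 0 <= h x by rewrite (le_trans _ (gh x)).
have ih : mu.-integrable D (EFin \o h).
  apply/integrableP; split; first exact: cont_emeas.
  under eq_integral do rewrite /= ger0_norm//.
  by rewrite e2 ltry.
have ig : mu.-integrable D (EFin \o g).
  apply: le_integrable ih => //; first exact: cont_emeas.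
  by move=> x _ /=; rewrite lee_fin (ger0_norm (h0 x)).
split=> //.
have : \int[mu]_(x in D) (g x + h x) = v + w by rewrite /Rintegral e1.
have e4 : \int[mu]_(x in D) h x = w by rewrite /Rintegral e2.
by rewrite RintegralD// e4 => /addIr.
Qed.

Lemma signed_integral_right g Q h H l l' : continuous g -> continuous h ->
  (forall x, `|g x| <= h x) -> primitive Q g -> primitive H h ->
  Q x @[x --> +oo] --> l -> H x @[x --> +oo] --> l' ->
  mu.-integrable `](0:R), +oo[ (EFin \o g) /\
  \int[mu]_(x in `](0:R), +oo[) g x = l - Q 0.
Proof. exact: integral_halfline. Qed.

Lemma signed_integral_left g Q h H l l' : continuous g -> continuous h ->
  (forall x, `|g x| <= h x) -> primitive Q g -> primitive H h ->
  Q x @[x --> -oo] --> l -> H x @[x --> -oo] --> l' ->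
  mu.-integrable `]-oo, (0:R)[ (EFin \o g) /\
  \int[mu]_(x in `]-oo, (0:R)[) g x = Q 0 - l.
Proof.
move=> cg ch gh Qg Hh Ql Hl.
have h0 x : 0 <= h x by rewrite (le_trans _ (gh x)).
apply: (@signed_integral _ _ h _ (H 0 - l')) => //; last exact: ge0_integral_left Hl.
rewrite (@ge0_integral_left _ (fun x => Q x + H x) (l + l')).
- by congr (_%:E); ring.
- by move=> x; have := gh x; rewrite ler_norml; lra.
- by move=> x; apply: continuousD; [exact: cg|exact: ch].
- exact: primitiveD.
- exact: cvgD.
Qed.

End LineIntegrals.

(** * Moments of the centred normal law *)

Section NormalMoments.
Context {R : realType}.
Context (s : R) (s0 : 0 < s).
Notation mu := (@lebesgue_measure R).
Local Notation phi := (normal_pdf (0 : R) s).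
Local Notation nu := (normal_prob (0 : R) s).

(** The Radon-Nikodym derivative of the normal law agrees almost everywhere with its density, since
    both have the same integrals over measurable sets. *)
Lemma ge0_integral_normal (f : R -> \bar R) : (forall x, (0 <= f x)%E) ->
  measurable_fun [set: R] f ->
  (\int[nu]_x f x = \int[mu]_x (f x * (phi x)%:E))%E.
Proof.
move=> f0 mf.
have dom := @normal_prob_dominates R 0 s.
rewrite -(Radon_Nikodym_SigmaFinite.change_of_variables dom)//.
apply: ae_eq_integral => //.
- apply: emeasurable_funM => //; apply: (measurable_int mu).
  exact: Radon_Nikodym_SigmaFinite.f_integrable.
- apply: emeasurable_funM => //; apply/measurable_EFinP.
  exact: measurable_normal_pdf.
- apply: ae_eqe_mul2l; apply: integral_ae_eq => //.
  + exact: Radon_Nikodym_SigmaFinite.f_integrable.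
  + by apply/measurable_EFinP; exact: measurable_normal_pdf.
  + by move=> E _ mE; rewrite -Radon_Nikodym_SigmaFinite.f_integral.
Qed.

Let sn0 : s != 0. Proof. by rewrite gt_eqF. Qed.

Lemma normal_pdf_primitive : primitive phi (fun x => - (x / s ^+ 2) * phi x).
Proof.
pose q x := - x ^+ 2 / (s ^+ 2 *+ 2).
have dq : primitive q (fun x => - (x / s ^+ 2)).
  have := primitiveZ (- (s ^+ 2 *+ 2)^-1) (primitiveM (@primitive_id R) (@primitive_id R)).
  have -> : (fun x : R => - (s ^+ 2 *+ 2)^-1 * (x * x)) = q.
    by apply/funext => x; rewrite /q expr2 mulrC mulrN -mulNr.
  have -> : (fun x : R => - (s ^+ 2 *+ 2)^-1 * (x * 1 + x * 1)) = (fun x => - (x / s ^+ 2)) => //.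
  by apply/funext => x; rewrite -mulr_natl; field.
have := primitiveZ (normal_peak s) (primitive_expR dq).
have e x : phi x = normal_peak s * expR (q x).
  by rewrite normal_pdfE// /normal_fun subr0.
have -> : (fun x => normal_peak s * expR (q x)) = phi by apply/funext.
have -> : (fun x => normal_peak s * (- (x / s ^+ 2) * expR (q x))) = (fun x => - (x / s ^+ 2) * phi x) => //.
by apply/funext => x; rewrite e; ring.
Qed.

Lemma normal_pdf_cont : continuous phi.
Proof. exact: primitive_continuous normal_pdf_primitive. Qed.

Lemma normal_pdf_even x : phi (- x) = phi x.
Proof. by rewrite !normal_pdfE// /normal_fun !subr0 sqrrN. Qed.

Lemma normal_pdf_decay x : 0 < x -> x * phi x <= 2 * s ^+ 2 * normal_peak s / x.
Proof.
move=> x0; have pk := normal_peak_ge0 s; have s2 : 0 < s ^+ 2 by rewrite exprn_gt0.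
have e : phi x <= normal_peak s * (2 * s ^+ 2 / x ^+ 2).
  rewrite normal_pdfE// /normal_fun subr0 ler_wpM2l//.
  have t0 : 0 < x ^+ 2 / (2 * s ^+ 2) by rewrite divr_gt0 ?exprn_gt0 ?mulr_gt0.
  rewrite mulNr -mulr_natl expRN -[leRHS]invrK lef_pV2 ?posrE ?expR_gt0//; last first.
    by rewrite invr_gt0 divr_gt0 ?mulr_gt0 ?exprn_gt0.
  rewrite invf_div; have := expR_ge1Dx (x ^+ 2 / (2 * s ^+ 2)); lra.
have := ler_wpM2l (ltW x0) e; move=> /le_trans; apply.
by rewrite le_eqVlt; apply/orP; left; apply/eqP; field; rewrite gt_eqF.
Qed.

Lemma cvg0_pinfty_decay (f : R -> R) (c : R) :
  (forall x, 1 <= x -> `|f x| <= c / x) -> f x @[x --> +oo] --> (0 : R).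
Proof.
move=> hf.
have c0 : 0 <= c by have := le_trans (normr_ge0 _) (hf 1 (lexx 1)); rewrite divr1.
apply/cvgrPdist_lt => e e0.
have : \forall x \near +oo, Num.max 1 (c / e + 1) < x by apply: nbhs_pinfty_gt; rewrite num_real.
apply: filterS => x; rewrite gt_max => /andP[x1 xc]; rewrite sub0r normrN.
have x0 : 0 < x by lra.
apply: le_lt_trans (hf x (ltW x1)) _.
by rewrite ltr_pdivrMr// mulrC -ltr_pdivrMr//; lra.
Qed.

Lemma normal_pdf_xcvg : x * phi x @[x --> +oo] --> (0 : R).
Proof.
apply: (@cvg0_pinfty_decay _ (2 * s ^+ 2 * normal_peak s)) => x x1.
rewrite ger0_norm; first by apply: normal_pdf_decay; lra.
by rewrite mulr_ge0 ?normal_pdf_ge0//; lra.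
Qed.

Lemma normal_pdf_cvg : phi x @[x --> +oo] --> (0 : R).
Proof.
apply: (@cvg0_pinfty_decay _ (2 * s ^+ 2 * normal_peak s)) => x x1.
rewrite ger0_norm ?normal_pdf_ge0//.
apply: le_trans (normal_pdf_decay _); last by lra.
by rewrite ler_peMl ?normal_pdf_ge0.
Qed.

Lemma cvg_ninfty_reflect (f : R -> R) (l : R) : f (- x) @[x --> +oo] --> l ->
  f x @[x --> -oo] --> l.
Proof. by move=> h; apply/cvgNy_compNP. Qed.

Lemma normal_pdf_xcvgN : x * phi x @[x --> -oo] --> (0 : R).
Proof.
apply: cvg_ninfty_reflect; rewrite -[X in _ --> X]oppr0.
have -> : (fun x => - x * phi (- x)) = (fun x => - (x * phi x)).
  by apply/funext => x; rewrite normal_pdf_even mulNr.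
by apply: cvgN; exact: normal_pdf_xcvg.
Qed.

Lemma normal_pdf_cvgN : phi x @[x --> -oo] --> (0 : R).
Proof.
apply: cvg_ninfty_reflect.
have -> : (fun x => phi (- x)) = phi by apply/funext => x; rewrite normal_pdf_even.
exact: normal_pdf_cvg.
Qed.

Let cvgZ_ (F : set_system R) {FF : Filter F} (c : R) (f : R -> R) (l : R) :
  f x @[x --> F] --> l -> c * f x @[x --> F] --> c * l.
Proof. by move=> h; apply: cvgM => //; exact: cvg_cst. Qed.

Lemma normal_cdf_exists : exists Phi : R -> R, exists l1 l2 : R,
  [/\ primitive Phi phi, Phi x @[x --> -oo] --> l1, Phi x @[x --> +oo] --> l2
    & l2 - l1 = 1].
Proof.
have [Phi dPhi] := primitive_exists normal_pdf_cont.
have s2 : 0 < s ^+ 2 by rewrite exprn_gt0.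
have p0 x : 0 <= phi x by exact: normal_pdf_ge0.
have up (Q : R -> R) : primitive Q phi -> exists l : R, Q x @[x --> +oo] --> l.
  move=> dQ; apply: (eventually_bounded_cvg (c := Q 1 + s ^+ 2 * phi 1) (z := 1)).
    exact: primitive_nd dQ _.
  move=> y y1.
  (* Beyond 1 the function Q + s^2 phi has derivative (1 - x) phi <= 0, so Q is bounded there. *)
  have := primitive_ge (primitiveD dQ (primitiveZ (s ^+ 2) normal_pdf_primitive)) y1.
  move=> h; apply: le_trans (h _).
    by rewrite lerDl mulr_ge0// ltW.
  move=> x /andP[x1 _]; rewrite (_ : _ + _ = (1 - x) * phi x); last by field.
  by rewrite mulr_le0_ge0// subr_le0.
have [l2 h2] := up _ dPhi.
have [l1 h1] : exists l : R, - Phi (- x) @[x --> +oo] --> l.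
  apply: up; have := primitive_reflectN dPhi.
  suff -> : (fun x => phi (- x)) = phi by [].
  by apply/funext => x; rewrite normal_pdf_even.
have {}h1 : Phi x @[x --> -oo] --> - l1.
  apply: cvg_ninfty_reflect.
  have -> : (fun x => Phi (- x)) = (fun x => - (- Phi (- x))) by apply/funext => x; rewrite opprK.
  exact: cvgN.
exists Phi, (- l1), l2; split => //.
have := ge0_integral_line p0 normal_pdf_cont dPhi h1 h2.
by rewrite integral_normal_pdf => -[].
Qed.

Lemma normal_poly_integral (g Q : R -> R) (l1 l2 : R) : (forall x, 0 <= g x) -> continuous g ->
  primitive Q (fun x => g x * phi x) -> Q x @[x --> -oo] --> l1 -> Q x @[x --> +oo] --> l2 ->
  nu.-integrable [set: R] (EFin \o g) /\ \int[nu]_(x in [set: R]) g x = l2 - l1.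
Proof.
move=> g0 cg dQ h1 h2.
have e : (\int[nu]_x (g x)%:E = (l2 - l1)%:E)%E.
  rewrite ge0_integral_normal//; last exact: cont_emeas.
  under eq_integral do rewrite -EFinM.
  apply: ge0_integral_line dQ h1 h2.
    by move=> x; rewrite mulr_ge0// normal_pdf_ge0.
  by move=> x; apply: continuousM; [exact: cg|exact: normal_pdf_cont].
split; last by rewrite /Rintegral e.
apply/integrableP; split; first exact: cont_emeas.
under eq_integral do rewrite /= ger0_norm//.
by rewrite e ltry.
Qed.

Lemma normal_moment2 : nu.-integrable [set: R] (EFin \o (fun x => x ^+ 2)) /\
  \int[nu]_(x in [set: R]) (x ^+ 2) = s ^+ 2.
Proof.
have [Phi [l1 [l2 [dPhi h1 h2 e]]]] := normal_cdf_exists.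
have [] := @normal_poly_integral (fun x => x ^+ 2) (fun x => s ^+ 2 * Phi x - s ^+ 2 * (x * phi x))
  (s ^+ 2 * l1 - s ^+ 2 * 0) (s ^+ 2 * l2 - s ^+ 2 * 0).
- by move=> x; rewrite sqr_ge0.
- by move=> x; exact: exprn_continuous.
- have := primitiveB (primitiveZ (s ^+ 2) dPhi) (primitiveZ (s ^+ 2) (primitiveM (@primitive_id R) normal_pdf_primitive)).
  have -> // : (fun x : R => s ^+ 2 * phi x - s ^+ 2 * (x * (- (x / s ^+ 2) * phi x) + phi x * 1)) = (fun x => x ^+ 2 * phi x).
  by apply/funext => x; field.
- by apply: cvgB; apply: cvgZ_ => //; exact: normal_pdf_xcvgN.
- by apply: cvgB; apply: cvgZ_ => //; exact: normal_pdf_xcvg.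
by move=> i ->; split=> //; rewrite !mulr0 !subr0 -mulrBr e mulr1.
Qed.

Lemma normal_moment1 : nu.-integrable [set: R] (EFin \o id) /\
  \int[nu]_(x in [set: R]) x = 0.
Proof.
have [Phi [l1 [l2 [dPhi h1 h2 e]]]] := normal_cdf_exists.
have [i2 e2] := normal_moment2.
have i0 : nu.-integrable [set: R] (EFin \o cst (1 : R)).
  exact: finite_measure_integrable_cst.
(* The identity function changes sign, so its integral is read off from that of (1 + x)^2 = 1 + 2 x
   + x^2. *)
have [i3 e3] : nu.-integrable [set: R] (EFin \o (fun x => (1 + x) ^+ 2)) /\
  \int[nu]_(x in [set: R]) ((1 + x) ^+ 2) = 1 + s ^+ 2.
  have [] := @normal_poly_integral (fun x => (1 + x) ^+ 2) (fun x => (1 + s ^+ 2) * Phi x - s ^+ 2 * (x * phi x) - 2 * s ^+ 2 * phi x)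
    ((1 + s ^+ 2) * l1 - s ^+ 2 * 0 - 2 * s ^+ 2 * 0) ((1 + s ^+ 2) * l2 - s ^+ 2 * 0 - 2 * s ^+ 2 * 0).
  - by move=> x; rewrite sqr_ge0.
  - have d := primitiveD (primitive_cst (1 : R)) (@primitive_id R).
    exact: (primitive_continuous (primitiveM d d)).
  - have := primitiveB (primitiveB (primitiveZ (1 + s ^+ 2) dPhi) (primitiveZ (s ^+ 2) (primitiveM (@primitive_id R) normal_pdf_primitive)))
      (primitiveZ (2 * s ^+ 2) normal_pdf_primitive).
    have -> // : (fun x : R => (1 + s ^+ 2) * phi x - s ^+ 2 * (x * (- (x / s ^+ 2) * phi x) + phi x * 1) - 2 * s ^+ 2 * (- (x / s ^+ 2) * phi x)) = (fun x => (1 + x) ^+ 2 * phi x).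
    by apply/funext => x; field.
  - apply: cvgB; first (apply: cvgB); apply: cvgZ_ => //; [exact: normal_pdf_xcvgN|exact: normal_pdf_cvgN].
  - apply: cvgB; first (apply: cvgB); apply: cvgZ_ => //; [exact: normal_pdf_xcvg|exact: normal_pdf_cvg].
  by move=> i ->; split=> //; rewrite !mulr0 !subr0 -mulrBr e mulr1.
have i1 : nu.-integrable [set: R] (EFin \o id).
  apply: (le_integrable _ _ _ (integrableD _ i0 i2)) => //.
    by apply/measurable_EFinP.
  move=> x _ /=; rewrite lee_fin (ger0_norm (_ : 0 <= 1 + x ^+ 2)); last by rewrite addr_ge0 ?sqr_ge0.
  by rewrite ler_norml; apply/andP; split; have := sqr_ge0 (x - 1); have := sqr_ge0 (x + 1); nra.
split=> //.
have : \int[nu]_(x in [set: R]) ((1 + x) ^+ 2) = \int[nu]_(x in [set: R]) (1 + (2 * x + x ^+ 2)).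
  by apply: eq_Rintegral => x _; ring.
have i1' : nu.-integrable [set: R] (EFin \o (fun x => 2 * x)).
  by have := integrableZl measurableT 2 i1.
rewrite e3 RintegralD//; last first.
  by have := integrableD measurableT i1' i2.
rewrite RintegralD// RintegralZl// e2.
have -> : \int[nu]_(x in [set: R]) (1 : R) = 1.
  by rewrite Rintegral_cst// [X in fine X](_ : _ = 1%E) ?mulr1//; exact: (@probability_setT _ _ _ nu).
lra.
Qed.

(** An inequality is enough: the antiderivative Q differs from 3 s^4 Phi by a term of constant sign
    on each half-line, so monotonicity gives its limits and their bounds without studying the decay
    of x^3 phi. *)
Lemma normal_moment4 : nu.-integrable [set: R] (EFin \o (fun x => x ^+ 4)) /\
  \int[nu]_(x in [set: R]) (x ^+ 4) <= 3 * s ^+ 4.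
Proof.
have [Phi [l1 [l2 [dPhi h1 h2 e]]]] := normal_cdf_exists.
pose Q x := 3 * s ^+ 4 * Phi x - (s ^+ 2 * x ^+ 3 + 3 * s ^+ 4 * x) * phi x.
have dQ : primitive Q (fun x => x ^+ 4 * phi x).
  have d3 : primitive (fun x : R => x ^+ 3) (fun x => 3 * x ^+ 2).
    have := primitiveM (@primitive_id R) (primitiveM (@primitive_id R) (@primitive_id R)).
    have -> : (fun x : R => x * (x * x)) = (fun x => x ^+ 3) by apply/funext => x; ring.
    have -> // : (fun x : R => x * (x * 1 + x * 1) + x * x * 1) = (fun x => 3 * x ^+ 2).
    by apply/funext => x; ring.
  have := primitiveB (primitiveZ (3 * s ^+ 4) dPhi)
    (primitiveM (primitiveD (primitiveZ (s ^+ 2) d3) (primitiveZ (3 * s ^+ 4) (@primitive_id R))) normal_pdf_primitive).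
  suff -> : (fun x : R => 3 * s ^+ 4 * phi x - ((s ^+ 2 * x ^+ 3 + 3 * s ^+ 4 * x) * (- (x / s ^+ 2) * phi x) + phi x * (s ^+ 2 * (3 * x ^+ 2) + 3 * s ^+ 4 * 1))) = (fun x => x ^+ 4 * phi x) by [].
  by apply/funext => x; field.
have s2 : 0 < s ^+ 2 by rewrite exprn_gt0.
have s4 : 0 < s ^+ 4 by rewrite exprn_gt0.
have p0 x : 0 <= phi x by exact: normal_pdf_ge0.
have g0 (x : R) : 0 <= x ^+ 4 by rewrite exprn_even_ge0.
have gp x : 0 <= x ^+ 4 * phi x by rewrite mulr_ge0.
have ndPhi := primitive_nd dPhi p0.
have ub x : 0 <= x -> Q x <= 3 * s ^+ 4 * l2.
  move=> x0; apply: le_trans (_ : 3 * s ^+ 4 * Phi x <= _).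
    by rewrite /Q gerBl mulr_ge0// addr_ge0// mulr_ge0 ?exprn_ge0// ltW// mulr_gt0.
  apply: ler_wpM2l; first by rewrite mulr_ge0 ?(ltW s4).
  exact: homo_le_lim ndPhi h2.
have lb x : 0 <= x -> 3 * s ^+ 4 * l1 <= Q (- x).
  move=> x0; apply: le_trans (_ : 3 * s ^+ 4 * Phi (- x) <= _).
    apply: ler_wpM2l; first by rewrite mulr_ge0 ?(ltW s4).
    rewrite -lerN2; apply: (@homo_le_lim R (fun x => - Phi (- x)) (- l1) x).
      by move=> u v uv; rewrite lerN2 ndPhi// lerN2.
    by apply: cvgN; exact: cvg_reflect.
  rewrite /Q lerDl oppr_ge0 mulr_le0_ge0//.
  rewrite (_ : _ + _ = - (s ^+ 2 * x ^+ 3 + 3 * s ^+ 4 * x)); last by ring.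
  by rewrite oppr_le0 addr_ge0// mulr_ge0 ?exprn_ge0// ltW// mulr_gt0.
have [m2 hm2] : exists l : R, Q x @[x --> +oo] --> l.
  by apply: (eventually_bounded_cvg (c := 3 * s ^+ 4 * l2) (z := 0)) => //; exact: primitive_nd dQ gp.
have [m1 hm1] : exists l : R, - Q (- x) @[x --> +oo] --> l.
  apply: (eventually_bounded_cvg (c := - (3 * s ^+ 4 * l1)) (z := 0)).
    by apply: (primitive_nd (primitive_reflectN dQ)).
  by move=> y y0; rewrite lerN2 lb.
have hm1' : Q x @[x --> -oo] --> - m1.
  apply: cvg_ninfty_reflect.
  have -> : (fun x => Q (- x)) = (fun x => - (- Q (- x))) by apply/funext => x; rewrite opprK.
  exact: cvgN.
have [i4 e4] := normal_poly_integral g0 (fun x => @exprn_continuous _ 4 x) dQ hm1' hm2.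
split => //; rewrite e4.
have b2 := cvg_pinfty_le ub hm2.
have b1 : m1 <= - (3 * s ^+ 4 * l1).
  by apply: cvg_pinfty_le hm1 => y; rewrite lerN2; exact: lb.
have -> : 3 * s ^+ 4 = 3 * s ^+ 4 * l2 - 3 * s ^+ 4 * l1 by rewrite -mulrBr e mulr1.
lra.
Qed.

End NormalMoments.

(** * One Euler step *)

Section TestFunction.
Context {R : realType}.
Implicit Types (a b c x y z : R).

(** Composing a solution v with the projection onto [b - 1, L + 1] makes it bounded and Lipschitz on
    the line, without changing it near [b, L]. *)
Definition clamp b c x := Num.max b (Num.min x c).

Lemma clamp_in b c x : b <= c -> b <= clamp b c x <= c.
Proof. by move=> bc; rewrite /clamp le_max lexx/= ge_max bc ge_min lexx orbT. Qed.

Lemma clamp_id b c x : b <= x <= c -> clamp b c x = x.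
Proof. by move=> /andP[bx xc]; rewrite /clamp (min_idPl xc) (max_idPr bx). Qed.

Lemma clamp_lip b c x y : `|clamp b c x - clamp b c y| <= `|x - y|.
Proof.
rewrite /clamp.
have h (u v w : R) : `|Num.max w u - Num.max w v| <= `|u - v|.
  by case: (leP w u); case: (leP w v) => h1 h2; rewrite ?subrr ?normr0//; rewrite !ler_norml; have := ler_norm (u - v); have := ler_norm (v - u); rewrite distrC => h3 h4; lra.
have h' (u v w : R) : `|Num.min u w - Num.min v w| <= `|u - v|.
  by case: (leP u w); case: (leP v w) => h1 h2; rewrite ?subrr ?normr0//; rewrite !ler_norml; have := ler_norm (u - v); have := ler_norm (v - u); rewrite distrC => h3 h4; lra.
exact: le_trans (h _ _ _) (h' _ _ _).
Qed.

Lemma continuous_bounded (g : R -> R) b c : continuous g -> exists2 M, 0 <= M &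
  forall x, b <= x <= c -> `|g x| <= M.
Proof.
move=> cg; have [bc|cb] := leP b c; last first.
  by exists 0 => // x /andP[bx xc]; have := le_lt_trans (le_trans bx xc) cb; rewrite ltxx.
have cn : {within `[b, c], continuous (fun x => `|g x|)}.
  apply: continuous_subspaceT => x; apply: (continuous_comp (cg x)).
  exact: norm_continuous.
have [m _ hm] := EVT_max bc cn.
by exists `|g m| => // x xbc; apply: hm; rewrite in_itv.
Qed.

Context (v v1 v2 v3 : R -> R).
Context (dv : primitive v v1) (dv1 : primitive v1 v2) (dv2 : primitive v2 v3)
  (cv3 : continuous v3).

Lemma test_lip b c : exists2 M, 0 <= M & forall x y,
  `|v (clamp b c x) - v (clamp b c y)| <= M * `|x - y|.
Proof.
have [M M0 hM] := continuous_bounded b c (primitive_continuous dv1).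
exists M => // x y.
have [bc|cb] := leP b c; last first.
  rewrite (_ : clamp b c x = clamp b c y) ?subrr ?normr0 ?mulr_ge0//.
  have h (z : R) : clamp b c z = b.
    rewrite /clamp; apply/max_idPl; rewrite ge_min (ltW cb) orbT//.
  by rewrite !h.
apply: le_trans (_ : M * `|clamp b c x - clamp b c y| <= _); last first.
  by rewrite ler_wpM2l// clamp_lip.
have /andP[x1 x2] := clamp_in x bc; have /andP[y1 y2] := clamp_in y bc.
have [xy|/ltW yx] := leP (clamp b c x) (clamp b c y).
  rewrite distrC [X in _ * X]distrC (ger0_norm (_ : 0 <= clamp b c y - _)) ?subr_ge0//.
  apply: (primitive_norm dv xy) => z /andP[z1 z2]; apply: hM; lra.
rewrite (ger0_norm (_ : 0 <= clamp b c x - _)) ?subr_ge0//.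
by apply: (primitive_norm dv yx) => z /andP[z1 z2]; apply: hM; lra.
Qed.

Lemma test_bounded b c : b <= c -> exists2 M, 0 <= M & forall x, `|v (clamp b c x)| <= M.
Proof.
move=> bc; have [M M0 hM] := continuous_bounded b c (primitive_continuous dv).
by exists M => // x; apply: hM; exact: clamp_in.
Qed.

Lemma MVT_norm (g g1 : R -> R) (M : R) x y : primitive g g1 ->
  (forall z, Num.min x y <= z <= Num.max x y -> `|g1 z| <= M) ->
  `|g y - g x| <= M * `|y - x|.
Proof.
move=> dg; have [xy|/ltW yx] := leP x y => hM.
  by rewrite (ger0_norm (_ : 0 <= y - x)) ?subr_ge0//; exact: primitive_norm dg xy hM.
rewrite distrC [X in _ * X]distrC (ger0_norm (_ : 0 <= x - y)) ?subr_ge0//.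
exact: primitive_norm dg yx hM.
Qed.

Lemma taylor2 b c : exists2 K, 0 <= K & forall x y, b <= x <= c ->
  b - 1 <= y <= c + 1 ->
  `|v y - v x - v1 x * (y - x) - v2 x / 2 * (y - x) ^+ 2| <= K * `|y - x| ^+ 3.
Proof.
have [M M0 hM] := continuous_bounded (b - 1) (c + 1) cv3.
exists M => // x y /andP[bx xc] /andP[b1 c1].
have btw z : Num.min x y <= z <= Num.max x y -> b - 1 <= z <= c + 1 /\ `|z - x| <= `|y - x|.
  case: (leP x y) => xy /andP[z1 z2].
    split; first by lra.
    by rewrite !ger0_norm; lra.
  split; first by lra.
  by rewrite distrC [`|y - x|]distrC !ger0_norm; lra.
have sub (z w : R) : Num.min x y <= z <= Num.max x y ->
    Num.min x z <= w <= Num.max x z -> Num.min x y <= w <= Num.max x y.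
  by case: (leP x y); case: (leP x z) => ? ? /andP[? ?] /andP[? ?]; lra.
have s2 z : Num.min x y <= z <= Num.max x y -> `|v2 z - v2 x| <= M * `|y - x|.
  move=> hz; apply: le_trans (_ : M * `|z - x| <= _).
    by apply: MVT_norm dv2 _ => w hw; apply: hM; apply: (btw w (sub _ _ hz hw)).1.
  by rewrite ler_wpM2l//; exact: (btw z hz).2.
have s1 z : Num.min x y <= z <= Num.max x y ->
    `|v1 z - v1 x - v2 x * (z - x)| <= M * `|y - x| ^+ 2.
  move=> hz; have d := primitiveB dv1 (primitiveZ (v2 x) (@primitive_id R)).
  have := @MVT_norm _ _ (M * `|y - x|) x z d.
  rewrite (_ : v1 z - _ - (v1 x - _) = v1 z - v1 x - v2 x * (z - x)); last by ring.
  move=> h; apply: le_trans (h _) _.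
    by move=> w hw; rewrite mulr1; exact: s2 (sub _ _ hz hw).
  by rewrite expr2 mulrA ler_wpM2l ?mulr_ge0//; exact: (btw z hz).2.
have dq : primitive (fun z => v2 x / 2 * ((z - x) * (z - x))) (fun z => v2 x * (z - x)).
  have h := primitiveB (@primitive_id R) (primitive_cst x).
  have := primitiveZ (v2 x / 2) (primitiveM h h).
  have -> // : (fun z : R => v2 x / 2 * ((z - x) * (1 - 0) + (z - x) * (1 - 0))) = (fun z => v2 x * (z - x)).
  by apply/funext => z; field.
have d := primitiveB (primitiveB dv (primitiveZ (v1 x) (@primitive_id R))) dq.
have := @MVT_norm _ _ (M * `|y - x| ^+ 2) x y d.
rewrite (_ : _ - _ - _ - (v x - _ - _) = v y - v x - v1 x * (y - x) - v2 x / 2 * (y - x) ^+ 2); last by ring.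
move=> h; apply: le_trans (h _) _.
  by move=> z hz; rewrite mulr1; exact: s1.
by rewrite -mulrA -exprSr.
Qed.

(** If y leaves [b - 1, c + 1] then |y - x| >= 1, so every term is dominated by a multiple of |y -
    x|^3; the cubic remainder thus survives the freezing of v for all y, as a Gaussian increment
    requires. *)
Lemma test_taylor b c : b <= c -> exists2 K, 0 <= K & forall x y, b <= x <= c ->
  `|v (clamp (b - 1) (c + 1) y) - v x - v1 x * (y - x) - v2 x / 2 * (y - x) ^+ 2|
    <= K * `|y - x| ^+ 3.
Proof.
move=> bc; have [K K0 hK] := taylor2 b c.
have [M0 M00 h0] := continuous_bounded (b - 1) (c + 1) (primitive_continuous dv).
have [M1 M10 h1] := continuous_bounded b c (primitive_continuous dv1).
have [M2 M20 h2] := continuous_bounded b c (primitive_continuous dv2).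
exists (K + 2 * M0 + M1 + M2) => [|x y xbc]; first by rewrite !addr_ge0// mulr_ge0.
have /andP[bx xc] := xbc.
have k0 (t : R) : 0 <= t -> 0 <= t ^+ 3 by move=> t0; rewrite exprn_ge0.
have [ybc|yout] := boolP (b - 1 <= y <= c + 1).
  rewrite (clamp_id ybc); apply: le_trans (hK _ _ xbc ybc) _.
  by rewrite ler_wpM2r ?k0// -!addrA lerDl !addr_ge0// mulr_ge0.
have d1 : 1 <= `|y - x|.
  move: yout; rewrite negb_and -!ltNge => /orP[yl|yr].
    by rewrite distrC ger0_norm; lra.
  by rewrite ger0_norm; lra.
set t := `|y - x| in d1 *.
have bc1 : b - 1 <= c + 1 by lra.
have f0 : `|v (clamp (b - 1) (c + 1) y)| <= M0 by apply: h0; exact: clamp_in.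
have f1 : `|v x| <= M0 by apply: h0; lra.
have f2 : `|v1 x * (y - x)| <= M1 * t by rewrite normrM ler_wpM2r// h1.
have f3 : `|v2 x / 2 * (y - x) ^+ 2| <= M2 * t ^+ 2.
  rewrite normrM normrX ler_wpM2r ?exprn_ge0// normrM; apply: le_trans (_ : `|v2 x| <= _); last exact: h2.
  have h2' : `|(2:R)^-1| <= 1 by rewrite ger0_norm ?invr_ge0//; lra.
  by rewrite ler_piMr.
have t1 : t <= t ^+ 3 by rewrite (exprS t 2) ler_peMr ?exprn_ege1//; lra.
have t2 : t ^+ 2 <= t ^+ 3 by rewrite (exprSr t 2) ler_peMr ?exprn_ge0//; lra.
have t3 : 1 <= t ^+ 3 by rewrite exprn_ege1.
apply: le_trans (ler_normB _ _) _; apply: le_trans (lerD (ler_normB _ _) f3) _.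
apply: le_trans (lerD (lerD (ler_normB _ _) f2) (lexx _)) _.
have g1 := ler_wpM2l M10 t1; have g2 := ler_wpM2l M20 t2.
have g3 : 2 * M0 * 1 <= 2 * M0 * t ^+ 3 by rewrite ler_wpM2l// mulr_ge0.
have g4 : 0 <= K * t ^+ 3 by rewrite mulr_ge0// k0//; lra.
by rewrite !mulrDl; lra.
Qed.

End TestFunction.

Lemma bounded_integrable (R : realType) d (T : measurableType d) (P : probability T R)
    (g : T -> R) (C : R) : measurable_fun [set: T] g ->
  (forall w, `|g w| <= C) -> P.-integrable [set: T] (EFin \o g).
Proof.
move=> mg gC; have ic : P.-integrable [set: T] (EFin \o cst C).
  exact: finite_measure_integrable_cst.
apply: le_integrable ic => //; first exact/measurable_EFinP.
by move=> w _ /=; rewrite lee_fin (le_trans (gC w))// ler_norm.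
Qed.

(** * Expectations of products with an independent Gaussian *)

Section Independence.
Context {R : realType} d (T : measurableType d) (P : probability T R).
Context (A0 : set (set T)) (xi : T -> R) (s : R).
Context (mxi : measurable_fun [set: T] xi)
  (A0m : A0 `<=` measurable)
  (indep : forall A (B : set R), A0 A -> measurable B ->
     P (A `&` [set w | B (xi w)]) = (P A * normal_prob 0 s B)%E).
Local Notation nu := (normal_prob (0 : R) s).

Context (H : T -> R) (mH : forall B : set R, measurable B -> A0 (H @^-1` B)).

Let mH' : measurable_fun [set: T] (H : T -> measurableTypeR R).
Proof. by move=> _ B mB; rewrite setTI; apply: A0m; exact: mH. Qed.

Let X : {mfun T >-> measurableTypeR R} :=
  HB.pack (H : T -> measurableTypeR R) (@isMeasurableFun.Build _ _ T (measurableTypeR R) H mH').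
Let joint (w : T) : measurableTypeR R * measurableTypeR R := (H w, xi w).
Let mjoint : measurable_fun [set: T] joint.
Proof. by apply/measurable_fun_pairP; split; [exact: mH'|exact: mxi]. Qed.
Let XJ : {mfun T >-> (measurableTypeR R * measurableTypeR R)%type} :=
  HB.pack joint (isMeasurableFun.Build _ _ _ _ joint mjoint).

Let joint_prod (C : set (measurableTypeR R * measurableTypeR R)) : measurable C ->
  (distribution P X \x nu)%E C = distribution P XJ C.
Proof.
apply: product_measure_unique => A B mA mB.
rewrite /= /distribution /pushforward /= -(indep (mH mA) mB).
by congr (P _).
Qed.

(** The joint law of (H, xi) agrees with the product law on rectangles, hence everywhere; Tonelli's
    theorem concludes. *)
Lemma indep_ge0 (phi : R -> R) : measurable_fun [set: R] phi -> (forall y, 0 <= phi y) ->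
  (forall w, 0 <= H w) ->
  (\int[P]_w (H w * phi (xi w))%:E = \int[P]_w (H w)%:E * \int[nu]_y (phi y)%:E)%E.
Proof.
move=> mphi phi0 H0.
(* The absolute value keeps the integrand nonnegative on the whole plane; it disappears on the range
   of H. *)
pose f (z : measurableTypeR R * measurableTypeR R) : \bar R := (`|z.1| * phi z.2)%:E.
have mf : measurable_fun [set: measurableTypeR R * measurableTypeR R] f.
  apply/measurable_EFinP; apply: measurable_funM.
    by apply: measurableT_comp => //; exact: measurable_fst.
  by apply: measurableT_comp => //; exact: measurable_snd.
have f0 z : (0 <= f z)%E by rewrite lee_fin mulr_ge0.
transitivity (\int[distribution P XJ]_z f z)%E.
  rewrite ge0_integral_distribution//; apply: eq_integral => w _ /=.
  by rewrite /f /= (ger0_norm (H0 w)).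
transitivity (\int[(distribution P X \x nu)%E]_z f z)%E.
  by apply: eq_measure_integral => C mC _; apply/esym; exact: joint_prod.
rewrite fubini_tonelli1//.
transitivity (\int[distribution P X]_x (`|x|%:E * \int[nu]_y (phi y)%:E))%E.
  apply: eq_integral => x _; rewrite /fubini_F /f /=.
  under eq_integral do rewrite EFinM.
  rewrite ge0_integralZl//.
  - by apply/measurable_EFinP.
  - by move=> y _; rewrite lee_fin.
rewrite ge0_integralZr//.
- rewrite ge0_integral_distribution//; last by apply/measurable_EFinP.
  congr (_ * _)%E; apply: eq_integral => w _ /=.
  by rewrite (ger0_norm (H0 w)).
- by apply/measurable_EFinP.
- by apply: integral_ge0 => y _; rewrite lee_fin.
Qed.

End Independence.

Section IndependenceSigned.
Context {R : realType} d (T : measurableType d) (P : probability T R).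
Context (A0 : set (set T)) (xi : T -> R) (s : R).
Context (mxi : measurable_fun [set: T] xi)
  (A0m : A0 `<=` measurable)
  (indep : forall A (B : set R), A0 A -> measurable B ->
     P (A `&` [set w | B (xi w)]) = (P A * normal_prob 0 s B)%E).
Local Notation nu := (normal_prob (0 : R) s).
Context (H : T -> R) (M : R) (phi : R -> R).
Context (mH : forall B : set R, measurable B -> A0 (H @^-1` B))
  (HM : forall w, `|H w| <= M) (mphi : measurable_fun [set: R] phi)
  (iphi : nu.-integrable [set: R] (EFin \o phi)).

Let mH' : measurable_fun [set: T] (H : T -> measurableTypeR R).
Proof. by move=> _ B mB; rewrite setTI; apply: A0m; exact: mH. Qed.
Let mHR : measurable_fun [set: T] H. Proof. exact: mH'. Qed.
Let X : {mfun T >-> measurableTypeR R} :=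
  HB.pack (H : T -> measurableTypeR R) (@isMeasurableFun.Build _ _ T (measurableTypeR R) H mH').
Let joint (w : T) : measurableTypeR R * measurableTypeR R := (H w, xi w).
Let mjoint : measurable_fun [set: T] joint.
Proof. by apply/measurable_fun_pairP; split; [exact: mH'|exact: mxi]. Qed.
Let XJ : {mfun T >-> (measurableTypeR R * measurableTypeR R)%type} :=
  HB.pack joint (isMeasurableFun.Build _ _ _ _ joint mjoint).
Let f (z : measurableTypeR R * measurableTypeR R) : \bar R := (z.1 * phi z.2)%:E.

Let mf : measurable_fun [set: measurableTypeR R * measurableTypeR R] f.
Proof.
apply/measurable_EFinP; apply: measurable_funM; first exact: measurable_fst.
by apply: measurableT_comp => //; exact: measurable_snd.
Qed.

Lemma indep_integrable : P.-integrable [set: T] (fun w => (H w * phi (xi w))%:E).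
Proof.
have mp : measurable_fun [set: T] (fun w => phi (xi w)) by exact: measurableT_comp.
have mHa (B : set R) : measurable B -> A0 ((fun w => `|H w|) @^-1` B).
  move=> mB; rewrite (_ : _ @^-1` B = H @^-1` ((fun x : R => `|x|) @^-1` B))//; apply: mH.
  by rewrite -[X in measurable X]setTI; exact: (@normr_measurable R setT).
apply/integrableP; split; first by apply/measurable_EFinP; exact: measurable_funM.
under eq_integral do rewrite /= normrM.
rewrite (indep_ge0 mxi A0m indep mHa (phi := fun y => `|phi y|))//; last first.
  exact: measurableT_comp.
have [_ h1] := integrableP _ _ _ (bounded_integrable P mHR HM).
have [_ h2] := integrableP _ _ _ iphi.
rewrite /= in h1 h2.
by rewrite lte_mul_pinfty//; [exact: integral_ge0|rewrite ge0_fin_numE//; exact: integral_ge0].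
Qed.

(** Same product law as in the nonnegative case, now with Fubini's theorem: H is bounded and phi is
    integrable. *)
Lemma indep_Rintegral : \int[P]_w (H w * phi (xi w)) = \int[P]_w H w * \int[nu]_y phi y.
Proof.
have jp C : measurable C -> (distribution P X \x nu)%E C = distribution P XJ C.
  apply: product_measure_unique => A B mA mB.
  rewrite /= /distribution /pushforward /= -(indep (mH mA) mB).
  by congr (P _).
have ifJ : (distribution P X \x nu)%E.-integrable [set: measurableTypeR R * measurableTypeR R] f.
  apply/integrable12ltyP => //.
  under eq_integral.
    move=> x _; rewrite /f /=.
    under eq_integral do rewrite normrM EFinM.
    rewrite ge0_integralZl//; last first.
      by apply/measurable_EFinP; exact: measurableT_comp.
    over.
  have [_ h1] := integrableP _ _ _ (bounded_integrable P mHR HM).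
  have [_ h2] := integrableP _ _ _ iphi.
  have mn : measurable_fun [set: measurableTypeR R] (fun x : measurableTypeR R => `|x|%:E).
    by apply/measurable_EFinP; exact: (@normr_measurable R setT).
  have n0 : (0 <= \int[nu]_x `|phi x|%:E)%E by apply: integral_ge0.
  rewrite ge0_integralZr//.
  rewrite ge0_integral_distribution//.
  have p0 : (0 <= \int[P]_x ((fun y : measurableTypeR R => `|y|%:E) \o X) x)%E.
    by apply: integral_ge0 => x _ /=; rewrite lee_fin.
  by apply: lte_mul_pinfty => //; rewrite ge0_fin_numE.
have e : (\int[P]_w (H w * phi (xi w))%:E = \int[P]_w (H w)%:E * \int[nu]_y (phi y)%:E)%E.
  transitivity (\int[distribution P XJ]_z f z)%E.
    rewrite integral_distribution//; last exact: indep_integrable.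
  transitivity (\int[(distribution P X \x nu)%E]_z f z)%E.
    by apply: eq_measure_integral => C mC _; apply/esym; exact: jp.
  rewrite -integral12_prod_meas1//.
  transitivity (\int[distribution P X]_x (x%:E * \int[nu]_y (phi y)%:E))%E.
    apply: eq_integral => x _; rewrite /fubini_F /f /=.
    under eq_integral do rewrite EFinM.
    by rewrite integralZl.
  have fp : (\int[nu]_y (phi y)%:E)%E \is a fin_num by exact: integrable_fin_num.
  rewrite -(fineK fp) integralZr//; last first.
    have mn : measurable_fun [set: measurableTypeR R] (fun x : measurableTypeR R => `|x|%:E).
      by apply/measurable_EFinP; exact: (@normr_measurable R setT).
    apply/integrableP; split; first by apply/measurable_EFinP.
    rewrite (ge0_integral_distribution X mn)//.
    by have [_] := integrableP _ _ _ (bounded_integrable P mHR HM).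
  rewrite integral_distribution//; exact: (bounded_integrable P mHR HM).
rewrite /Rintegral e fineM//; first exact: integrable_fin_num (bounded_integrable P mHR HM).
exact: integrable_fin_num.
Qed.

End IndependenceSigned.

(** Splits the cubic Taylor remainder into even powers, whose Gaussian moments are explicit. The
    weight r is free: over T / h steps the error totals about T (r + h / r), small when r is small
    and h much smaller. *)
Lemma pow3_le (R : realType) (r t : R) : 0 < r -> 0 <= t ->
  t ^+ 3 <= r * t ^+ 2 + t ^+ 4 / r.
Proof.
move=> r0 t0; have [tr|/ltW rt] := leP t r.
  apply: le_trans (_ : r * t ^+ 2 <= _).
    by rewrite exprS ler_wpM2r// exprn_ge0.
  by rewrite lerDl divr_ge0 ?exprn_ge0// ltW.
apply: le_trans (_ : t ^+ 4 / r <= _); last by rewrite lerDr mulr_ge0 ?exprn_ge0// ltW.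
by rewrite ler_pdivlMr// (exprSr t 3) ler_wpM2l// exprn_ge0.
Qed.

Section SubAlgebra.
Context {R : realType} d (T : measurableType d).
Context (A0 : set (set T)) (A0s : sigma_algebra [set: T] A0).
Context (X : T -> R) (mX : forall B : set R, measurable B -> A0 (X @^-1` B)).

(** The set T is given the smaller sigma-algebra A0 as its own measurable structure, so that
    ordinary measurability lemmas apply to it. *)
Lemma sub_adapted (A : set T) (g : R -> R) (B : set R) : A0 A -> continuous g ->
  measurable B -> A0 ((fun w => \1_A w * g (X w)) @^-1` B).
Proof.
move=> AA cg mB.
have idA : <<s A0 >> = A0 by exact: sigma_algebra_id.
pose T' := g_sigma_algebraType A0.
have mX' : measurable_fun [set: T'] (X : T' -> R).
  by move=> _ C mC; rewrite setTI; rewrite /measurable /= idA; exact: mX.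
have mA : measurable (A : set T') by rewrite /measurable /= idA.
have : measurable_fun [set: T'] (fun w : T' => \1_(A : set T') w * g (X w) : R).
  apply: measurable_funM; first exact: measurable_indic.
  by apply: measurableT_comp => //; exact: continuous_measurable_fun.
by move=> /(_ measurableT B mB); rewrite setTI /measurable /= idA.
Qed.

End SubAlgebra.

Lemma step_arith (R : realType) (a b c e : R) : a <= c -> b <= e -> 0 <= c -> 0 <= e ->
  a + b + c + 3 * e <= (4 + 2) * (c + e).
Proof. lra. Qed.

(** * The generator along one Euler step *)

Section OneStep.
Context {R : realType}.
Context (F1 v v1 v2 v3 : R -> R) (eps b L : R).
Context (eps0 : 0 < eps) (bL : b <= L) (cF1 : continuous F1)
  (dv : primitive v v1) (dv1 : primitive v1 v2) (dv2 : primitive v2 v3)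
  (cv3 : continuous v3) (ode : forall x, eps * v2 x - F1 x * v1 x = - 1).

Local Notation f := (fun x => v (clamp (b - 1) (L + 1) x)).
Local Notation sg := (Num.sqrt (2 * eps)).

Lemma test_continuous : continuous f.
Proof.
move=> x; have [M M0 hM] := test_lip dv dv1 (b - 1) (L + 1).
apply/cvgrPdist_lt => e e0.
have M1 : 0 < M + 1 by lra.
near=> y; apply: le_lt_trans (hM _ _) _.
apply: le_lt_trans (_ : (M + 1) * `|x - y| < _); first by rewrite ler_wpM2r//; lra.
rewrite mulrC -ltr_pdivlMr//; near: y.
by apply: cvgr_dist_lt; [exact: cvg_id|rewrite divr_gt0].
Unshelve. all: by end_near.
Qed.

Lemma one_step_pointwise : exists2 C, 0 <= C & forall x h r y, b <= x <= L ->
  0 < h -> h <= 1 -> 0 < r -> r <= 1 ->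
  `|f (x - h * F1 x + sg * y) - f x
    - (- h * (v1 x * F1 x) + h ^+ 2 * (v2 x / 2 * F1 x ^+ 2)
       + sg * (v1 x - h * (v2 x * F1 x)) * y + eps * v2 x * y ^+ 2)|
  <= C * (r * h ^+ 2 + h ^+ 4 / r) + C * r * y ^+ 2 + C / r * y ^+ 4.
Proof.
have [K K0 hK] := test_taylor dv dv1 dv2 cv3 bL.
have [C1 C10 hC1] := continuous_bounded b L cF1.
have sg2 : sg ^+ 2 = 2 * eps by rewrite sqr_sqrtr// mulr_ge0// ltW.
(* From (a + b)^2 <= 2 a^2 + 2 b^2, applied to D = - h F1 x + sg y and then to the resulting bound
   of D^2, with sg^2 = 2 eps. *)
pose C := K * (2 * C1 ^+ 2 + 4 * eps + 8 * C1 ^+ 4 + 32 * eps ^+ 2).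
have e0 := ltW eps0.
have c2 : 0 <= C1 ^+ 2 by rewrite exprn_ge0.
have c4 : 0 <= C1 ^+ 4 by rewrite exprn_ge0.
have e2 : 0 <= eps ^+ 2 by rewrite exprn_ge0.
exists C; first by rewrite /C mulr_ge0//; lra.
move=> x h r y xb h0 h1 r0 r1.
set D := - h * F1 x + sg * y.
have h_ge0 := ltW h0.
have fx : f x = v x by rewrite clamp_id//; lra.
have := hK x (x + D) xb; rewrite (_ : x + D - x = D); last by ring.
rewrite fx (_ : x - h * F1 x + sg * y = x + D); last by rewrite /D; ring.
have -> : v (clamp (b - 1) (L + 1) (x + D)) - v x - v1 x * D - v2 x / 2 * D ^+ 2 =
  v (clamp (b - 1) (L + 1) (x + D)) - v x - (- h * (v1 x * F1 x) + h ^+ 2 * (v2 x / 2 * F1 x ^+ 2) + sg * (v1 x - h * (v2 x * F1 x)) * y + eps * v2 x * y ^+ 2).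
  have -> : D ^+ 2 = h ^+ 2 * F1 x ^+ 2 - 2 * h * F1 x * sg * y + 2 * eps * y ^+ 2.
    by have := sg2; rewrite /D; move: sg => s s2; rewrite -s2; ring.
  by rewrite /D; field.
move=> hD; apply: le_trans hD _.
have y2 : 0 <= y ^+ 2 by rewrite sqr_ge0.
have y4 : 0 <= y ^+ 4 by rewrite exprn_even_ge0.
have F2 : F1 x ^+ 2 <= C1 ^+ 2.
  by rewrite -[F1 x ^+ 2]real_normK ?num_real// lerXn2r ?nnegrE ?hC1.
have D2 : D ^+ 2 <= 2 * C1 ^+ 2 * h ^+ 2 + 4 * eps * y ^+ 2.
  apply: le_trans (_ : 2 * (h * F1 x) ^+ 2 + 2 * (sg * y) ^+ 2 <= _).
    by rewrite /D; have := sqr_ge0 (h * F1 x + sg * y); nra.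
  rewrite !exprMn sg2; have := ler_wpM2l (sqr_ge0 h) F2; lra.
have D4 : D ^+ 4 <= 8 * C1 ^+ 4 * h ^+ 4 + 32 * eps ^+ 2 * y ^+ 4.
  have D2' : 0 <= D ^+ 2 by rewrite sqr_ge0.
  have -> : D ^+ 4 = (D ^+ 2) ^+ 2 by rewrite -exprM.
  apply: le_trans (_ : (2 * C1 ^+ 2 * h ^+ 2 + 4 * eps * y ^+ 2) ^+ 2 <= _).
    by rewrite lerXn2r ?nnegrE// addr_ge0// mulr_ge0// ?mulr_ge0// sqr_ge0.
  have := sqr_ge0 (2 * C1 ^+ 2 * h ^+ 2 - 4 * eps * y ^+ 2).
  have -> : C1 ^+ 4 = (C1 ^+ 2) ^+ 2 by rewrite -exprM.
  have -> : h ^+ 4 = (h ^+ 2) ^+ 2 by rewrite -exprM.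
  have -> : y ^+ 4 = (y ^+ 2) ^+ 2 by rewrite -exprM.
  move: (C1 ^+ 2) (h ^+ 2) (y ^+ 2) => u1 u2 u3; nra.
have nD : `|D| ^+ 2 = D ^+ 2 by rewrite real_normK// num_real.
have nD4 : `|D| ^+ 4 = D ^+ 4.
  by rewrite (_ : 4%N = (2 * 2)%N)// !exprM nD.
apply: le_trans (ler_wpM2l K0 (pow3_le r0 (normr_ge0 D))) _; rewrite nD nD4.
have r0' : 0 <= r^-1 by rewrite invr_ge0 ltW.
have i1 := ler_wpM2l (ltW r0) D2.
have i2 := ler_wpM2r r0' D4.
have h2 : 0 <= h ^+ 2 by rewrite sqr_ge0.
have h4 : 0 <= h ^+ 4 by rewrite exprn_ge0.
have i3 : r * D ^+ 2 + D ^+ 4 / r <= (2 * C1 ^+ 2 + 4 * eps + 8 * C1 ^+ 4 + 32 * eps ^+ 2) *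
    (r * h ^+ 2 + h ^+ 4 / r + r * y ^+ 2 + y ^+ 4 / r).
  have p1 : 0 <= r * h ^+ 2 by rewrite mulr_ge0// ltW.
  have p2 : 0 <= h ^+ 4 / r by rewrite mulr_ge0.
  have p3 : 0 <= r * y ^+ 2 by rewrite mulr_ge0// ltW.
  have p4 : 0 <= y ^+ 4 / r by rewrite mulr_ge0.
  apply: le_trans (lerD i1 i2) _.
  rewrite (_ : r * (2 * C1 ^+ 2 * h ^+ 2 + 4 * eps * y ^+ 2) +
    (8 * C1 ^+ 4 * h ^+ 4 + 32 * eps ^+ 2 * y ^+ 4) / r = 2 * C1 ^+ 2 * (r * h ^+ 2) + 4 * eps * (r * y ^+ 2)
     + (8 * C1 ^+ 4 * (h ^+ 4 / r) + 32 * eps ^+ 2 * (y ^+ 4 / r))); last by ring.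
  move: (r * h ^+ 2) (h ^+ 4 / r) (r * y ^+ 2) (y ^+ 4 / r) p1 p2 p3 p4 => u1 u2 u3 u4 p1 p2 p3 p4.
  move: (C1 ^+ 2) c2 (C1 ^+ 4) c4 (eps ^+ 2) e2 => k1 k10 k2 k20 k3 k30.
  have q (k u : R) : 0 <= k -> 0 <= u -> 0 <= k * u by exact: mulr_ge0.
  have := (q _ _ k10 p1, q _ _ k10 p2, q _ _ k10 p3, q _ _ k10 p4).
  have := (q _ _ k20 p1, q _ _ k20 p2, q _ _ k20 p3, q _ _ k20 p4).
  have := (q _ _ k30 p1, q _ _ k30 p2, q _ _ k30 p3, q _ _ k30 p4).
  have := (q _ _ e0 p1, q _ _ e0 p2, q _ _ e0 p3, q _ _ e0 p4).
  move=> [[[? ?] ?] ?] [[[? ?] ?] ?] [[[? ?] ?] ?] [[[? ?] ?] ?]; nra.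
apply: le_trans (ler_wpM2l K0 i3) _; rewrite /C le_eqVlt; apply/orP; left; apply/eqP; ring.
Qed.

Context d (T : measurableType d) (P : probability T R).

(** The event A and the position X belong to the past, and xi is independent of it with variance h:
    the term linear in xi has mean 0, the quadratic one contributes h eps v2, and the equation for v
    turns the whole order h into - h P(A). *)
Lemma one_step : exists2 C, 0 <= C & forall (A0 : set (set T)) (X xi : T -> R) (A : set T) h r,
  sigma_algebra [set: T] A0 -> A0 `<=` measurable ->
  (forall B : set R, measurable B -> A0 (X @^-1` B)) ->
  measurable_fun [set: T] xi ->
  (forall A (B : set R), A0 A -> measurable B ->
     P (A `&` [set w | B (xi w)]) = (P A * normal_prob 0 (Num.sqrt h) B)%E) ->
  A0 A -> (forall w, A w -> b <= X w <= L) ->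
  0 < h -> h <= 1 -> 0 < r -> r <= 1 ->
  `|\int[P]_w (\1_A w * (f (X w - h * F1 (X w) + sg * xi w) - f (X w))) + h * fine (P A)|
    <= C * (r * h + h ^+ 2 / r).
Proof.
have [C0 C00 hC] := one_step_pointwise.
have [V V0 hV] := continuous_bounded b L (primitive_continuous dv2).
have [V1 V10 hV1] := continuous_bounded b L (primitive_continuous dv).
have [C1 C10 hC1] := continuous_bounded b L cF1.
have bL1 : b - 1 <= L + 1 by have := bL; lra.
have [Bf Bf0 hBf] := test_bounded dv bL1.
have e0 := ltW eps0.
(* The first summand pays for the Taylor error, with E xi^2 = h and E xi^4 <= 3 h^2; the second for
   the h^2 term left over from the squared drift. *)
exists (C0 * (4 + 2) + V * C1 ^+ 2); first by rewrite addr_ge0// mulr_ge0// exprn_ge0.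
move=> A0 X xi A h r A0s A0m mX mxi ind AA Ab h0 h1 r0 r1.
have s0 : 0 < Num.sqrt h by rewrite sqrtr_gt0.
have s2 : Num.sqrt h ^+ 2 = h by rewrite sqr_sqrtr// ltW.
have s4 : Num.sqrt h ^+ 4 = h ^+ 2 by rewrite (_ : 4%N = (2 * 2)%N)// exprM s2.
have [i1 m1] := normal_moment1 s0.
have [i2 m2] := normal_moment2 s0.
have [i4 m4] := normal_moment4 s0.
have mA : measurable A by exact: A0m.
have mXT : measurable_fun [set: T] X by move=> _ B mB; rewrite setTI; apply: A0m; exact: mX.
have c1 : continuous v1 := primitive_continuous dv1.
have c2 : continuous v2 := primitive_continuous dv2.
have cM (g1 g2 : R -> R) : continuous g1 -> continuous g2 -> continuous (fun x => g1 x * g2 x).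
  by move=> h1' h2' x; apply: continuousM; [exact: h1'|exact: h2'].
have cD (g1 g2 : R -> R) : continuous g1 -> continuous g2 -> continuous (fun x => g1 x + g2 x).
  by move=> h1' h2' x; apply: continuousD; [exact: h1'|exact: h2'].
have cC (c : R) : continuous (fun _ : R => c : R) by exact: cst_continuous.
pose g0 x := - h * (v1 x * F1 x) + h ^+ 2 * (v2 x / 2 * F1 x ^+ 2).
pose g1 x := sg * (v1 x + - h * (v2 x * F1 x)).
pose g2 x := eps * v2 x.
have cF2 : continuous (fun x => F1 x ^+ 2).
  by move=> x; have := cM _ _ cF1 cF1 x.
have cg0 : continuous g0 by apply: cD; apply: (cM _ _ (cC _)); [exact: cM|apply: (cM) => //; exact: (cM _ _ c2 (cC _))].
have cg1 : continuous g1 by apply: (cM _ _ (cC _)); apply: cD => //; apply: (cM _ _ (cC _)); exact: cM.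
have cg2 : continuous g2 by exact: (cM _ _ (cC _)).
have bnd (g : R -> R) : continuous g -> exists M, forall w, `|\1_A w * g (X w)| <= M.
  move=> cg; have [M M0 hM] := continuous_bounded b L cg; exists M => w.
  rewrite indicE; have [wA|_] := boolP (w \in A); last by rewrite mul0r normr0.
  by rewrite mul1r hM// Ab//; exact: set_mem.
have [M0 hM0] := bnd _ cg0; have [M1 hM1] := bnd _ cg1; have [M2 hM2] := bnd _ cg2.
have a0 B := @sub_adapted R _ T A0 A0s X mX A g0 B AA cg0.
have a1 B := @sub_adapted R _ T A0 A0s X mX A g1 B AA cg1.
have a2 B := @sub_adapted R _ T A0 A0s X mX A g2 B AA cg2.
have mg (g : R -> R) : continuous g -> measurable_fun [set: T] (fun w => \1_A w * g (X w)).
  move=> cg; apply: measurable_funM; first exact: measurable_indic.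
  by apply: measurableT_comp => //; exact: continuous_measurable_fun.
have I0 : P.-integrable [set: T] (EFin \o (fun w => \1_A w * g0 (X w))).
  by apply: bounded_integrable hM0; exact: mg.
have mid : measurable_fun [set: R] (fun x : R => x) by exact: measurable_id.
have I1 : P.-integrable [set: T] (EFin \o (fun w => \1_A w * g1 (X w) * xi w)).
  exact: (@indep_integrable R _ T P A0 xi _ mxi A0m ind _ M1 (fun x => x) a1 hM1 mid i1).
have msq : measurable_fun [set: R] (fun x : R => x ^+ 2) by apply: continuous_measurable_fun => x; exact: exprn_continuous.
have mp4 : measurable_fun [set: R] (fun x : R => x ^+ 4) by apply: continuous_measurable_fun => x; exact: exprn_continuous.
have I2 : P.-integrable [set: T] (EFin \o (fun w => \1_A w * g2 (X w) * xi w ^+ 2)).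
  exact: (@indep_integrable R _ T P A0 xi _ mxi A0m ind _ M2 (fun x => x ^+ 2) a2 hM2 msq i2).
have E1 : \int[P]_w (\1_A w * g1 (X w) * xi w) = 0.
  rewrite (@indep_Rintegral R _ T P A0 xi _ mxi A0m ind _ M1 (fun x => x) a1 hM1 mid i1).
  by rewrite m1 mulr0.
have E2 : \int[P]_w (\1_A w * g2 (X w) * xi w ^+ 2) = h * \int[P]_w (\1_A w * g2 (X w)).
  rewrite (@indep_Rintegral R _ T P A0 xi _ mxi A0m ind _ M2 (fun x => x ^+ 2) a2 hM2 msq i2).
  by rewrite m2 s2 mulrC.
have IJ2 : P.-integrable [set: T] (EFin \o (fun w => \1_A w * g2 (X w))).
  by apply: bounded_integrable hM2; exact: mg.
have one (B : set R) : measurable B -> A0 ((fun _ : T => 1 : R) @^-1` B).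
  move=> mB; have [A1 A2 A3] := A0s.
  have [h1B|h1B] := pselect (B 1).
    by rewrite (_ : _ @^-1` B = [set: T]); [rewrite -setC0 -setTD; exact: A2|apply/seteqP; split].
  by rewrite (_ : _ @^-1` B = set0)//; apply/seteqP; split.
have one1 (w : T) : `|(1 : R)| <= 1 by rewrite normr1.
have Ix2 : P.-integrable [set: T] (EFin \o (fun w => 1 * xi w ^+ 2)).
  exact: (@indep_integrable R _ T P A0 xi _ mxi A0m ind _ 1 (fun x => x ^+ 2) one one1 msq i2).
have Ix4 : P.-integrable [set: T] (EFin \o (fun w => 1 * xi w ^+ 4)).
  exact: (@indep_integrable R _ T P A0 xi _ mxi A0m ind _ 1 (fun x => x ^+ 4) one one1 mp4 i4).
have P1 : \int[P]_(w in [set: T]) (1 : R) = 1.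
  by rewrite Rintegral_cst// [X in fine X](_ : _ = 1%E) ?mulr1//; exact: (@probability_setT _ _ _ P).
have Ex2 : \int[P]_w (1 * xi w ^+ 2) = h.
  rewrite (@indep_Rintegral R _ T P A0 xi _ mxi A0m ind _ 1 (fun x => x ^+ 2) one one1 msq i2).
  by rewrite P1 mul1r m2 s2.
have Ex4 : \int[P]_w (1 * xi w ^+ 4) <= 3 * h ^+ 2.
  rewrite (@indep_Rintegral R _ T P A0 xi _ mxi A0m ind _ 1 (fun x => x ^+ 4) one one1 mp4 i4).
  by rewrite P1 mul1r -s4.
pose U w := \1_A w * (f (X w - h * F1 (X w) + sg * xi w) - f (X w)).
pose Q w := \1_A w * g0 (X w) + \1_A w * g1 (X w) * xi w + \1_A w * g2 (X w) * xi w ^+ 2.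
have IQ : P.-integrable [set: T] (EFin \o Q).
  exact: (integrableD measurableT (integrableD measurableT I0 I1) I2).
have mU : measurable_fun [set: T] U.
  apply: measurable_funM; first exact: measurable_indic.
  apply: measurable_funB.
    apply: (measurableT_comp (continuous_measurable_fun test_continuous)).
    apply: measurable_funD; last by apply: measurable_funM.
    apply: measurable_funB => //; apply: measurable_funM => //.
    by apply: measurableT_comp => //; exact: continuous_measurable_fun.
  exact: (measurableT_comp (continuous_measurable_fun test_continuous)).
have U2 w : `|U w| <= 2 * Bf.
  rewrite /U normrM; apply: le_trans (_ : 1 * (Bf + Bf) <= _); last by rewrite mul1r mulr_natl mulr2n.
  apply: ler_pM => //; first by rewrite indicE; case: (_ \in _); rewrite ?normr1 ?normr0.
  by apply: le_trans (ler_normB _ _) _; rewrite lerD.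
have IU : P.-integrable [set: T] (EFin \o U) := bounded_integrable P mU U2.
(* Once xi is integrated out, eps v2 - F1 v1 = - 1 replaces the order h coefficient by - h. *)
have EQ : \int[P]_w Q w = \int[P]_w (\1_A w * (- h + h ^+ 2 * (v2 (X w) / 2 * F1 (X w) ^+ 2))).
  rewrite /Q RintegralD//; last exact: (integrableD measurableT I0 I1).
  rewrite RintegralD// E1 E2 addr0 -RintegralZl// -RintegralD//; last first.
    exact: (integrableZl measurableT h IJ2).
  apply: eq_Rintegral => w _; rewrite /g0 /g2 [h * (_ * _)]mulrCA -mulrDr; congr (_ * _).
  have -> : eps * v2 (X w) = F1 (X w) * v1 (X w) - 1 by rewrite -(ode (X w)); ring.
  ring.
have EQ' : `|\int[P]_w Q w + h * fine (P A)| <= h ^+ 2 * (V * C1 ^+ 2).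
  pose g3 x := h ^+ 2 * (v2 x / 2 * F1 x ^+ 2).
  have cg3 : continuous g3 by apply: (cM _ _ (cC _)); apply: (cM) => //; exact: (cM _ _ c2 (cC _)).
  have b3 w : `|\1_A w * g3 (X w)| <= h ^+ 2 * (V * C1 ^+ 2).
    have p : 0 <= h ^+ 2 * (V * C1 ^+ 2) by rewrite !mulr_ge0// ?exprn_ge0// ltW.
    rewrite indicE; have [wA|_] := boolP (w \in A); last by rewrite mul0r normr0.
    have Xb : b <= X w <= L by apply: Ab; exact: set_mem.
    rewrite mul1r /g3 normrM normrX (ger0_norm (ltW h0)) ler_wpM2l ?exprn_ge0// ?(ltW h0)//.
    rewrite normrM normrX (normrM (v2 _)).
    have h2' : `|(2:R)^-1| <= 1 by rewrite ger0_norm ?invr_ge0// invf_le1// ler1n.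
    apply: ler_pM; rewrite ?mulr_ge0//.
      by rewrite -[leRHS]mulr1; apply: ler_pM => //; exact: hV.
    by rewrite lerXn2r ?nnegrE// hC1.
  have I3 : P.-integrable [set: T] (EFin \o (fun w => \1_A w * g3 (X w))).
    by apply: bounded_integrable b3; exact: mg.
  have IA : P.-integrable [set: T] (EFin \o (\1_A : T -> R)).
    by apply: (@bounded_integrable _ _ _ _ _ 1) => [|w]; [exact: measurable_indic|rewrite indicE; case: (_ \in _); rewrite ?normr1 ?normr0].
  have -> : \int[P]_w Q w = - h * \int[P]_w (\1_A w) + \int[P]_w (\1_A w * g3 (X w)).
    rewrite EQ -RintegralZl// -RintegralD//; last exact: (integrableZl measurableT (- h) IA).
    by apply: eq_Rintegral => w _; rewrite /g3; ring.
  have -> : \int[P]_w (\1_A w) = fine (P A) by rewrite /Rintegral integral_indic// setIT.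
  rewrite mulNr addrAC addNr add0r.
  apply: le_trans (le_normr_Rintegral _ I3) _ => //.
  rewrite -[leRHS]mulr1 -P1 -RintegralZl//; last exact: finite_measure_integrable_cst.
  apply: le_Rintegral => //.
  - have := integrable_norm I3; exact.
  - exact: (finite_measure_integrable_cst P (h ^+ 2 * (V * C1 ^+ 2) * 1)).
  - by move=> w _; rewrite mulr1.
have arith (a1' a2' a3' a4' : R) : a1' <= a3' -> a2' <= a4' -> 0 <= a3' -> 0 <= a4' ->
  a1' + a2' + a3' + 3 * a4' <= (4 + 2) * (a3' + a4') by exact: step_arith.
have EU : `|\int[P]_w U w - \int[P]_w Q w| <= C0 * (4 + 2) * (r * h + h ^+ 2 / r).
  rewrite -RintegralB//.
  pose W w := C0 * (r * h ^+ 2 + h ^+ 4 / r) * 1 + C0 * r * (1 * xi w ^+ 2) + C0 / r * (1 * xi w ^+ 4).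
  have IUQ : P.-integrable [set: T] (EFin \o (fun w => U w - Q w)) := integrableB measurableT IU IQ.
  have Ic : P.-integrable [set: T] (EFin \o (fun w : T => C0 * (r * h ^+ 2 + h ^+ 4 / r) * 1)).
    exact: finite_measure_integrable_cst.
  have IW1 : P.-integrable [set: T] (EFin \o (fun w : T => C0 * (r * h ^+ 2 + h ^+ 4 / r) * 1 + C0 * r * (1 * xi w ^+ 2))).
    exact: (integrableD measurableT Ic (integrableZl measurableT (C0 * r) Ix2)).
  have IW : P.-integrable [set: T] (EFin \o W).
    exact: (integrableD measurableT IW1 (integrableZl measurableT (C0 / r) Ix4)).
  apply: le_trans (le_normr_Rintegral _ IUQ) _ => //.
  apply: le_trans (_ : \int[P]_w W w <= _).
    apply: le_Rintegral => //.
      by have := integrable_norm IUQ; exact.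
    move=> w _; rewrite /U /Q /W !mulr1 !mul1r.
    have r0' := ltW r0.
    have Wp : 0 <= C0 * (r * h ^+ 2 + h ^+ 4 / r) + C0 * r * xi w ^+ 2 + C0 / r * xi w ^+ 4.
      rewrite !addr_ge0//; first rewrite mulr_ge0// addr_ge0//.
      - by rewrite mulr_ge0// exprn_ge0// ltW.
      - by rewrite divr_ge0// exprn_ge0// ltW.
      - by rewrite mulr_ge0 ?sqr_ge0// mulr_ge0.
      - by rewrite mulr_ge0 ?divr_ge0// exprn_even_ge0.
    rewrite indicE; have [wA|_] := boolP (w \in A); last by rewrite !mul0r !addr0 subr0 normr0.
    have Xb : b <= X w <= L by apply: Ab; exact: set_mem.
    have := hC (X w) h r (xi w) Xb h0 h1 r0 r1.
    by rewrite !mul1r /g0 /g1 /g2 (_ : v1 (X w) - _ = v1 (X w) + - h * (v2 (X w) * F1 (X w))); last by ring.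
  rewrite /W RintegralD//; last exact: (integrableZl measurableT (C0 / r) Ix4).
  rewrite RintegralD//; last exact: (integrableZl measurableT (C0 * r) Ix2).
  rewrite (RintegralZl (C0 * r) measurableT Ix2) (RintegralZl (C0 / r) measurableT Ix4).
  rewrite Rintegral_cst// [X in fine X](_ : _ = 1%E); last exact: (@probability_setT _ _ _ P).
  rewrite Ex2 !mulr1.
  have r0' := ltW r0.
  have h0' := ltW h0.
  have h22 : h ^+ 2 <= h by rewrite expr2 ler_piMr.
  have h44 : h ^+ 4 <= h ^+ 2.
    by rewrite (_ : 4%N = (2 + 2)%N)// exprD ler_piMr ?exprn_ge0// exprn_ile1.
  have ri : 0 <= r^-1 by rewrite invr_ge0.
  have k1 : r * h ^+ 2 <= r * h by rewrite ler_wpM2l.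
  have k2 : h ^+ 4 / r <= h ^+ 2 / r by rewrite ler_wpM2r.
  have k3 : C0 / r * \int[P]_w (1 * xi w ^+ 4) <= C0 / r * (3 * h ^+ 2) by rewrite ler_wpM2l// divr_ge0.
  apply: le_trans (lerD (lexx _) k3) _.
  have k4 : 0 <= r * h by rewrite mulr_ge0.
  have k5 : 0 <= h ^+ 2 / r by rewrite divr_ge0 ?exprn_ge0.
  rewrite (_ : C0 / r * (3 * h ^+ 2) = C0 * (3 * (h ^+ 2 / r))); last by ring.
  rewrite -(mulrA C0 r h) -!mulrDr -(mulrA C0 (4 + 2)) ler_wpM2l//.
  exact: arith.
rewrite -/(U _) (_ : _ + _ = (\int[P]_w U w - \int[P]_w Q w) + (\int[P]_w Q w + h * fine (P A))); last by rewrite /U; ring.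
apply: le_trans (ler_normD _ _) _; apply: le_trans (lerD EU EQ') _.
rewrite mulrDl lerD2l mulrC ler_wpM2l ?mulr_ge0 ?exprn_ge0//.
have r0' := ltW r0.
apply: le_trans (_ : h ^+ 2 / r <= _); last by rewrite lerDr mulr_ge0// ltW.
by rewrite ler_peMr ?exprn_ge0// ?invf_ge1// ltW.
Qed.

End OneStep.

(** * The Euler scheme along a path *)

Section PathContinuity.
Context {R : realType}.
Local Notation mu := (@lebesgue_measure R).
Implicit Types (g : R -> R) (x : R -> R).

(** Prolonging a path by its initial value to negative times makes it continuous on the whole line,
    where continuity is easier to use. *)
Lemma halfline_continuous x : {within `[0, +oo[, continuous x} ->
  continuous (fun u : R => x (Num.max 0 u)).
Proof.
move=> /continuous_within_itvcyP[cx x0] u.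
have [u0|u0|->] := ltgtP u 0.
- rewrite /continuous_at (max_idPl (ltW u0)).
  apply: cvg_trans (_ : x 0 @[_ --> u] --> x 0); last exact: cvg_cst.
  apply: near_eq_cvg; near=> y; rewrite (max_idPl _)//.
  by near: y; exact: lt_le_nbhsl.
- rewrite /continuous_at (max_idPr (ltW u0)); have cu : x y @[y --> u] --> x u.
    by apply: cx; rewrite in_itv/= u0.
  apply: cvg_trans cu; apply: near_eq_cvg; near=> y; rewrite (max_idPr _)//.
  by near: y; exact: lt_le_nbhsr.
- rewrite /continuous_at maxxx; apply/cvgrPdist_lt => e e0.
  move/cvgrPdist_lt : x0 => /(_ e e0); rewrite near_withinE => /nbhs_ballP[r /= r0 hr].
  apply/nbhs_ballP; exists r => // y /= ry.
  have [y0|y0] := leP y 0; first by rewrite subrr normr0.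
  by apply: hr.
Unshelve. all: by end_near.
Qed.

Lemma continuous_rat_le g M : continuous g -> (forall q : rat, g (ratr q) <= M) ->
  forall s, g s <= M.
Proof.
move=> cg gq s; rewrite leNgt; apply/negP => Ms.
have oU : open (g @^-1` [set y | M < y]) by apply: open_comp => // y _; exact: cg.
have [y [/= My [q _ qy]]] := dense_rat (ex_intro _ s Ms) oU.
by have := lt_le_trans My; rewrite -qy => /(_ _ (gq q)); rewrite ltxx.
Qed.

Lemma uniform_step g (T e : R) : continuous g -> 0 < T -> 0 < e ->
  exists N0, forall N, (N0 <= N)%N -> forall s u, 0 <= s <= T -> `|s - u| <= T / N%:R ->
    `|g s - g u| <= e.
Proof.
move=> cg T0 e0.
have := (compact_near_coveringP `[0, T]).1 (@segment_compact R 0 T).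
move=> /(_ nat \oo (fun N s => forall u, `|s - u| <= T / N%:R -> `|g s - g u| <= e)).
case.
  move=> s _ /=.
  have /cvgrPdist_lt/(_ (e / 2)) cs := cg s.
  have /cs : 0 < e / 2 by rewrite divr_gt0.
  move=> /nbhs_ballP[r /= r0 hr].
  exists (ball s (r / 2), [set N | T / N%:R < r / 2]).
    split; first by apply: nbhsx_ballx; rewrite divr_gt0.
    have h : T / N%:R @[N --> \oo] --> (0 : R).
      rewrite -(mulr0 T); apply: cvgM; first exact: cvg_cst.
      by apply/cvgr0Pnorm_lt => e' e'0; near=> N; near: N; have /cvgr0Pnorm_lt/(_ _ e'0) := @cvg_harmonic R; case=> N0 _ h; exists N0.+1 => // -[|N] //= N0N; have := h N N0N; rewrite /harmonic.
    move/cvgrPdist_lt : h => /(_ (r / 2)) h; have /h : 0 < r / 2 by rewrite divr_gt0.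
    by apply: filterS => N; rewrite sub0r normrN; apply: le_lt_trans; exact: ler_norm.
  move=> [s' N] /= [hs' hN] u hu.
  have h1 : `|g s - g s'| < e / 2.
    by apply: hr; apply: le_ball hs'; rewrite ler_pdivrMr// ler_peMr// ?(ltW r0)// ler1n.
  have h2 : `|g s - g u| < e / 2.
    apply: hr; rewrite /ball /= (splitr r).
    rewrite (_ : s - u = (s - s') + (s' - u)); last by ring.
    by apply: le_lt_trans (ler_normD _ _) _; apply: ltrD => //; exact: le_lt_trans hu hN.
  rewrite (_ : g s' - g u = (g s - g u) - (g s - g s')); last by ring.
  by apply: le_trans (ler_normB _ _) _; rewrite (splitr e) lerD// ltW.
move=> N0 _ h; exists N0 => N N0N s u hs; apply: (h N N0N s) => //=; by rewrite in_itv.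
Unshelve. all: by end_near.
Qed.

End PathContinuity.

(** * Telescoping up to the exit from an interval *)

Section StoppedSum.
Context {R : realType}.

(** Here p k is the test function at the k-th grid point of the path and q k its value after one
    Euler step from there. The increments telescope up to c each as long as the path is alive at the
    next grid point; after the last alive index m no comparison of q m with p m.+1 is assumed, hence
    the second alternative ends at q m. *)
Lemma stopped_telescope (N : nat) (c : R) (p q : nat -> R) (alive : nat -> Prop) :
  0 <= c -> alive 0%N -> (forall k, alive k.+1 -> alive k) ->
  (forall k, (k < N)%N -> alive k.+1 -> `|q k - p k.+1| <= c) ->
  (alive N /\
   `|\sum_(k < N) (`[< alive k >]%:R * (q k - p k)) - (p N - p 0%N)| <= N%:R * c) \/
  (exists m, [/\ (m < N)%N, alive m, ~ alive m.+1 &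
   `|\sum_(k < N) (`[< alive k >]%:R * (q k - p k)) - (q m - p 0%N)| <= N%:R * c]).
Proof.
move=> c0 a0 dec; elim: N => [|N IH] step.
  by left; split => //; rewrite big_ord0 subrr sub0r oppr0 normr0 mul0r.
have {}IH := IH (fun k kN => step k (ltnW kN)).
have mono k m : (k <= m)%N -> alive m -> alive k.
  by move=> /subnK <-; elim: (m - k)%N => // i h; rewrite addSn => /dec.
rewrite big_ord_recr /=; set Z := \sum_(k < N) _ in IH *.
rewrite -natr1 mulrDl mul1r.
have [aN|aN] := pselect (alive N); last first.
  case: IH => [[]//|[m [mN am am1 hm]]].
  right; exists m; split => //; first exact: ltnW.
  by rewrite (asboolF aN) mul0r addr0; apply: le_trans hm _; rewrite lerDl.
rewrite (asboolT aN) mul1r.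
case: IH => [[_ hZ]|[m [mN am am1 hm]]]; last by case: am1; exact: mono aN.
have [aN1|aN1] := pselect (alive N.+1).
  left; split => //.
  rewrite (_ : _ - _ = (Z - (p N - p 0%N)) + (q N - p N.+1)); last by ring.
  by apply: le_trans (ler_normD _ _) _; apply: lerD => //; exact: step.
right; exists N; split => //.
rewrite (_ : _ - _ = Z - (p N - p 0%N)); last by ring.
by apply: le_trans hZ _; rewrite lerDl.
Qed.

End StoppedSum.

Section PathSum.
Context {R : realType}.
Local Notation mu := (@lebesgue_measure R).
Context (F1 f g W : R -> R) (sg b L M x T : R).
Context (cF1 : continuous F1) (cg : continuous g) (M0 : 0 <= M) (T0 : 0 < T)
  (flip : forall y z, `|f y - f z| <= M * `|y - z|)
  (sde : forall t, 0 <= t ->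
     g t = x - \int[mu]_(s in `[0, t]) F1 (g s) + sg * W t).

Definition alive t := forall s, 0 <= s <= t -> b <= g s <= L.

(** The Brownian increment is common to both points, so their difference is the integral of F1(g s)
    - F1(g t) over one cell. *)
Lemma euler_error (t h D : R) : 0 <= t -> 0 <= h ->
  (forall s, t <= s <= t + h -> `|F1 (g s) - F1 (g t)| <= D) ->
  `|(g t - h * F1 (g t) + sg * (W (t + h) - W t)) - g (t + h)| <= h * D.
Proof.
move=> t0 h0 hD.
have th : t <= t + h by rewrite lerDl.
have cFg : continuous (fun s => F1 (g s)) by move=> s; apply: continuous_comp; [exact: cg|exact: cF1].
have e1 := sde t0; have := sde (le_trans t0 th); rewrite (Rintegral_itv_cat cFg t0 th).
have D0 : 0 <= D by apply: le_trans (hD t _); rewrite ?lexx.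
set I := \int[mu]_(_ in `[t, _]) _ => e2.
have cstI (k : R) : \int[mu]_(s in `[t, t + h]) k = k * h.
  rewrite Rintegral_cst//= lebesgue_measure_itv/= lte_fin.
  case: ltP => [_|]; first by rewrite -EFinD /= addrC addKr.
  by rewrite gerDl => h0'; rewrite (le_anti (introT andP (conj h0' h0))) mulr0.
have cD : continuous (fun s => F1 (g s) - F1 (g t)).
  by move=> s; apply: continuousB; [exact: cFg|exact: cvg_cst].
have iF := continuous_integrable_itv t (t + h) cFg.
have ic (k : R) := continuous_integrable_itv t (t + h) (@cst_continuous R R k).
have e3 : \int[mu]_(s in `[0, t]) F1 (g s) = x + sg * W t - g t by rewrite e1; ring.
have -> : g t - h * F1 (g t) + sg * (W (t + h) - W t) - g (t + h) =
   \int[mu]_(s in `[t, t + h]) (F1 (g s) - F1 (g t)).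
  by rewrite (RintegralB _ iF (ic (F1 (g t))))// cstI e2 e3 /I; ring.
have iD := continuous_integrable_itv t (t + h) cD.
apply: le_trans (le_normr_Rintegral _ iD) _ => //.
rewrite mulrC -cstI; apply: (le_Rintegral _ _ (ic D)) => //.
  by have := integrable_norm iD; exact.
Qed.

Context (N : nat) (N0 : (0 < N)%N).
Local Notation h := (T / N%:R).
Local Notation t := (fun k : nat => k%:R * h).
Let q k := f (g (t k) - h * F1 (g (t k)) + sg * (W (t k.+1) - W (t k))).
Let p k := f (g (t k)).
Let Z := \sum_(k < N) (`[< alive (t k) >]%:R * (q k - p k)).

Let h0 : 0 < h. Proof. by rewrite divr_gt0// ltr0n. Qed.
Let t0 k : 0 <= t k. Proof. by rewrite mulr_ge0// ltW. Qed.
Let tS k : t k.+1 = t k + h. Proof. by rewrite /= -natr1 mulrDl mul1r. Qed.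
Let tN : t N = T. Proof. by rewrite /= mulrC mulfVK// pnatr_eq0 -lt0n. Qed.
Let tle k : (k <= N)%N -> t k <= T.
Proof. by move=> kN; rewrite -[leRHS]tN /= ler_wpM2r ?(ltW h0)// ler_nat. Qed.

Lemma aliveS s u : s <= u -> alive u -> alive s.
Proof. by move=> su au r /andP[r0 rs]; apply: au; rewrite r0 (le_trans rs su). Qed.

Hypothesis a0 : alive 0.

Let step k D : (k < N)%N ->
  (forall s, t k <= s <= t k + h -> `|F1 (g s) - F1 (g (t k))| <= D) ->
  `|q k - p k.+1| <= M * (h * D).
Proof.
move=> kN hD; apply: le_trans (flip _ _) _; rewrite ler_wpM2l// tS.
exact: euler_error (t0 k) (ltW h0) hD.
Qed.

Lemma path_sum D :
  (forall s u, 0 <= s <= T -> `|s - u| <= h -> `|g s - g u| <= D) ->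
  (forall s u, 0 <= s <= T -> `|s - u| <= h -> `|F1 (g s) - F1 (g u)| <= D) ->
  exists2 s, 0 <= s <= T /\ alive s &
    `|Z - (f (g s) - f (g 0))| <= M * (2 * T + 1) * D /\
    (s = T \/ exists2 u, `|g s - g u| <= D & ~ b <= g u <= L).
Proof.
move=> gD FD.
have D0 : 0 <= D by apply: le_trans (gD 0 0 _ _); rewrite ?lexx ?subrr ?normr0 ?(ltW h0)// ltW.
have MhD : 0 <= M * (h * D) by rewrite mulr_ge0// mulr_ge0// ltW.
have near_cell k s : (k < N)%N -> t k <= s <= t k + h -> `|t k - s| <= h.
  move=> kN /andP[s1 s2]; rewrite distrC ger0_norm; [lra|by rewrite subr_ge0].
have range k : (k < N)%N -> 0 <= t k <= T by move=> kN; rewrite t0 tle// ltnW.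
have st k : (k < N)%N -> `|q k - p k.+1| <= M * (h * D).
  move=> kN; apply: step => // s hs; rewrite distrC; apply: FD; first exact: range.
  exact: near_cell hs.
have p0 : p 0%N = f (g 0) by rewrite /p mul0r.
have NM : N%:R * (M * (h * D)) = M * T * D.
  by rewrite -{2}tN; ring.
have MTD : 0 <= M * T * D by rewrite -NM mulr_ge0.
have MD : 0 <= M * D by rewrite mulr_ge0.
have := @stopped_telescope R N (M * (h * D)) p q (fun k => alive (t k)) MhD.
case.
- by rewrite mul0r.
- by move=> k; apply: aliveS; rewrite tS lerDl ltW.
- by move=> k kN _; exact: st.
- move=> [aN hZ]; exists T; first by split; [rewrite (ltW T0) lexx|rewrite -tN].
  split; last by left.
  have e1 : f (g T) - f (g 0) = p N - p 0%N by rewrite p0 /p tN.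
  rewrite e1; apply: le_trans hZ _; rewrite NM; have -> : M * (2 * T + 1) * D = M * T * D + (M * T * D + M * D) by ring.
  by rewrite lerDl addr_ge0.
- move=> [m [mN am am1 hZ]]; exists (t m); first by split=> //; exact: range.
  split; last first.
    right; apply: contrapT => /forall2NP hu; apply: am1 => s /andP[s0 sm].
    have [sm'|/ltW sm'] := leP s (t m); first by apply: am; rewrite s0.
    have [|/contrapT//] := hu s; case; apply: gD; first exact: range.
    by apply: near_cell => //; rewrite sm' -tS.
  rewrite (_ : _ - _ = (Z - (q m - p 0%N)) + (q m - p m.+1) + (p m.+1 - p m)); last by rewrite p0 /p; ring.
  apply: le_trans (ler_normD _ _) _; apply: le_trans (lerD (ler_normD _ _) (lexx _)) _.
  have h3 : `|p m.+1 - p m| <= M * D.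
    apply: le_trans (flip _ _) _; rewrite ler_wpM2l// distrC; apply: gD; first exact: range.
    by apply: near_cell => //; rewrite tS lexx lerDl ltW.
  apply: le_trans (lerD (lerD hZ (st m mN)) h3) _; rewrite NM.
  have hT : h <= T by rewrite ler_pdivrMr ?ltr0n// ler_peMr ?(ltW T0)// ler1n.
  have MhT : M * (h * D) <= M * T * D by rewrite -(mulrA M T D) ler_wpM2l// ler_wpM2r.
  lra.
Qed.

(** A bound independent of N and of the path, as needed for dominated convergence. Only cells on
    which the path stays in [b, L] are compared, so F1 is bounded by C1 there. *)
Lemma path_sum_bounded C1 Bf : 0 <= C1 -> (forall y, b <= y <= L -> `|F1 y| <= C1) ->
  (forall y, `|f y| <= Bf) -> `|Z| <= M * T * (2 * C1) + 2 * Bf.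
Proof.
move=> C10 hC1 hBf.
have Mh : 0 <= M * (h * (2 * C1)) by rewrite mulr_ge0// mulr_ge0 ?(ltW h0)// mulr_ge0.
have bound X Y : `|Z - (f X - f Y)| <= N%:R * (M * (h * (2 * C1))) ->
    `|Z| <= M * T * (2 * C1) + 2 * Bf.
  have -> : N%:R * (M * (h * (2 * C1))) = M * T * (2 * C1) by rewrite -{2}tN; ring.
  move=> hZ; rewrite (_ : Z = (Z - (f X - f Y)) + (f X - f Y)); last by ring.
  apply: le_trans (ler_normD _ _) _; apply: lerD => //.
  by apply: le_trans (ler_normB _ _) _; have := hBf X; have := hBf Y; lra.
have := @stopped_telescope R N (M * (h * (2 * C1))) p q (fun k => alive (t k)) Mh.
case.
- by rewrite mul0r.
- by move=> k; apply: aliveS; rewrite tS lerDl ltW.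
- move=> k kN ak; apply: step => // s /andP[s1 s2].
  apply: le_trans (ler_normB _ _) _; rewrite (_ : 2 * C1 = C1 + C1); last by ring.
  apply: lerD; apply: hC1; apply: ak.
    by rewrite (le_trans (t0 k) s1) tS.
  by rewrite t0 tS lerDl ltW.
- by move=> [_]; exact: bound.
- by move=> [m [_ _ _]]; exact: bound.
Qed.

End PathSum.

(** * Mean exit times of the diffusion *)

Section ProbabilityIntegrals.
Context {R : realType} d (T : measurableType d) (P : probability T R).

Lemma Rintegral_prob_cst (c : R) : \int[P]_(w in [set: T]) c = c.
Proof.
by rewrite Rintegral_cst// [X in fine X](_ : _ = 1%E) ?mulr1//; exact: (@probability_setT _ _ _ P).
Qed.

Lemma integrable_sumR (f : nat -> T -> R) N :
  (forall k, P.-integrable [set: T] (EFin \o f k)) ->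
  P.-integrable [set: T] (EFin \o (fun w => \sum_(k < N) f k w)).
Proof.
move=> h; elim: N => [|N IH].
  rewrite (_ : _ \o _ = EFin \o cst (0 : R)); first exact: finite_measure_integrable_cst.
  by apply/funext => w /=; rewrite big_ord0.
rewrite (_ : _ \o _ = (fun w => (\sum_(k < N) f k w)%:E + (f N w)%:E)%E).
  exact: (integrableD measurableT IH (h N)).
by apply/funext => w /=; rewrite big_ord_recr EFinD.
Qed.

Lemma Rintegral_sumR (f : nat -> T -> R) N :
  (forall k, P.-integrable [set: T] (EFin \o f k)) ->
  \int[P]_w (\sum_(k < N) f k w) = \sum_(k < N) \int[P]_w f k w.
Proof.
move=> h; elim: N => [|N IH].
  under eq_Rintegral do rewrite big_ord0.
  by rewrite big_ord0 Rintegral_prob_cst.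
rewrite big_ord_recr /= -IH -RintegralD//; last exact: integrable_sumR.
by apply: eq_Rintegral => w _; rewrite big_ord_recr.
Qed.

Lemma integrable_indicR (A : set T) : measurable A ->
  P.-integrable [set: T] (EFin \o (\1_A : T -> R)).
Proof.
move=> mA; apply: (@bounded_integrable _ _ _ _ _ 1) => [|w]; first exact: measurable_indic.
by rewrite indicE; case: (_ \in _); rewrite ?normr1 ?normr0.
Qed.

Lemma Rintegral_indicR (A : set T) : measurable A -> \int[P]_w (\1_A w) = fine (P A).
Proof. by move=> mA; rewrite /Rintegral integral_indic// setIT. Qed.

(** The negative part min(U N, 0) is dominated by K and tends to 0 almost surely, so its integral
    tends to 0. The bounds that may depend on N only ensure integrability of each U N. *)
Lemma integral_eventually_ge (U : nat -> T -> R) (K : R) :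
  (forall N, measurable_fun [set: T] (U N)) ->
  (forall N, exists C, forall w, `|U N w| <= C) ->
  {ae P, forall w, forall N, `|U N w| <= K} ->
  {ae P, forall w, forall e, 0 < e -> exists N0, forall N, (N0 <= N)%N -> - e <= U N w} ->
  forall e, 0 < e -> exists N0, forall N, (N0 <= N)%N -> - e <= \int[P]_w U N w.
Proof.
move=> mU bU UK Uge e e0.
pose V N w := Num.min (U N w) 0.
have mV N : measurable_fun [set: T] (V N) by apply: measurable_minr.
have VU N w : `|V N w| <= `|U N w|.
  by rewrite /V; case: (leP (U N w) 0); rewrite ?normr0.
have iU N : P.-integrable [set: T] (EFin \o U N).
  by have [C hC] := bU N; exact: bounded_integrable hC.
have iV N : P.-integrable [set: T] (EFin \o V N).
  by have [C hC] := bU N; apply: bounded_integrable (fun w => le_trans (VU N w) (hC w)).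
have := @dominated_convergence _ T R P setT measurableT (fun N w => (V N w)%:E) (cst 0%E) (cst K%:E).
case.
- by move=> N; apply/measurable_EFinP.
- exact: measurable_cst.
- apply: filterS Uge => w hw _; apply: cvg_EFin; first by near=> N.
  apply/cvgr0Pnorm_le => e' e'0; have [N0 hN] := hw _ e'0.
  exists N0 => // N /= N0N; have := hN N N0N; rewrite /V /=.
  by case: (leP (U N w) 0) => u0 hu; rewrite ?normr0 ?(ltW e'0)// ler0_norm//; lra.
- exact: finite_measure_integrable_cst.
- apply: filterS UK => w hw N _ /=; rewrite lee_fin; exact: le_trans (VU N w) (hw N).
move=> _ _; rewrite integral0 => /fine_cvgP[_] /cvgr0Pnorm_le/(_ _ e0)[N0 _ h].
exists N0 => N N0N; have := h N N0N; rewrite /= => hN.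
apply: le_trans (_ : \int[P]_w V N w <= _).
  by rewrite lerNl; apply: le_trans hN; rewrite -normrN ler_norm.
by apply: le_Rintegral => // w _; rewrite /V ge_min lexx.
Unshelve. all: by end_near.
Qed.

End ProbabilityIntegrals.

(** * Expected time spent in an interval *)

Section Diffusion.
Context {R : realType} d (T : measurableType d) (P : probability T R).
Context (G : R -> set (set T)) (W X : R -> T -> R) (F1 : R -> R) (eps x : R).
Context (fil : filtration G) (bm : brownian_motion P G W) (adX : adapted G X)
  (X0 : forall w, X 0 w = x)
  (cX : forall w, {within `[0, +oo[, continuous (X ^~ w)})
  (sde : {ae P, forall w, forall t, 0 <= t ->
          X t w = X 0 w
                  - (\int[lebesgue_measure]_(s in `[0, t]) F1 (X s w))
                  + Num.sqrt (2 * eps) * W t w})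
  (eps0 : 0 < eps) (cF1 : continuous F1).

Definition trajectory w (s : R) := X (Num.max 0 s) w.
Definition inside b L t := [set w | alive (trajectory w) b L t].

Lemma path_continuous w : continuous (trajectory w).
Proof. exact: (halfline_continuous (@cX w)). Qed.

Lemma path_pos w s : 0 <= s -> trajectory w s = X s w.
Proof. by move=> s0; rewrite /trajectory (max_idPr s0). Qed.

Lemma path0 w : trajectory w 0 = x. Proof. by rewrite path_pos// X0. Qed.

Let Gs t : sigma_algebra [set: T] (G t) := (fil.1 t).1.
Let Gm t : G t `<=` measurable := (fil.1 t).2.
Let Gle s t : s <= t -> G s `<=` G t := fil.2 s t.

(** By continuity of the paths, staying in [b, L] up to t is a countable intersection of conditions
    at single times. *)
Lemma inside_adapted b L t : 0 <= t -> G t (inside b L t).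
Proof.
(* The map c sends the line onto [0, t], so rational q supply countably many times in [0, t] and the
   density of the rationals in the line can be used as it is. *)
move=> t0; pose c (q : R) := t * clamp 0 1 q.
have c0 q : 0 <= c q <= t.
  have /andP[c1 c2] := clamp_in q (@ler01 R).
  by rewrite /c mulr_ge0//= ler_piMr.
pose A (n : nat) := if unpickle n is Some q then X (c (ratr q : R)) @^-1` `[b, L] else setT.
have AG n : G t (A n).
  rewrite /A; case: (unpickle n) => [q|].
    have /andP[q0 q1] := c0 (ratr q).
    by apply: (Gle q1); apply: adX => //; exact: measurable_itv.
  by have [g0 gC _] := Gs t; rewrite -(setD0 setT); exact: gC.
have -> : inside b L t = ~` \bigcup_n (~` A n).
  rewrite setC_bigcup; under eq_bigcapr do rewrite setCK.
  apply/seteqP; split => [w wB n _|w wA s s0t].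
    rewrite /A; case: (unpickle n) => [q|//] /=; rewrite in_itv/=.
    have /andP[q0 q1] := c0 (ratr q).
    by rewrite -path_pos//; apply: wB; exact: c0.
  have wq (q : rat) : b <= X (c (ratr q)) w <= L.
    by have := wA (pickle q) I; rewrite /A pickleK /= in_itv.
  have gc : continuous (fun u => trajectory w (c u)).
    move=> u; apply: continuous_comp; last exact: path_continuous.
    rewrite /continuous_at /c; apply: cvgM; first exact: cvg_cst.
    apply/cvgrPdist_lt => e e0; near=> y; apply: le_lt_trans (clamp_lip _ _ _ _) _.
    by near: y; apply: cvgr_dist_lt; [exact: cvg_id|].
  have [u us] : exists u, c u = s.
    have [t00|t00] := eqVneq t 0.
      exists 0; rewrite /c t00 mul0r; apply/eqP; rewrite eq_le; move: s0t; rewrite t00 => /andP[-> ->]//.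
    have tp : 0 < t by rewrite lt_neqAle eq_sym t00.
    exists (s / t); rewrite /c clamp_id; first by field.
    by move: s0t => /andP[s0 st]; rewrite divr_ge0//= ler_pdivrMr// mul1r.
  have hX q : trajectory w (c q) = X (c q) w by have /andP[? _] := c0 q; rewrite path_pos.
  rewrite -us; apply/andP; split.
    rewrite -lerN2; apply: (@continuous_rat_le _ (fun u => - trajectory w (c u))) => [y|q].
      by apply: (@continuousN _ _ _ (fun u => trajectory w (c u))); exact: gc.
    by rewrite lerN2 hX; have /andP[] := wq q.
  apply: (@continuous_rat_le _ (fun u => trajectory w (c u))) => // q.
  by rewrite hX; have /andP[] := wq q.
have [g0 gC gU] := Gs t; rewrite -setTD; apply: (gC); apply: gU => n.
by rewrite -setTD; exact: gC.
Unshelve. all: by end_near.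
Qed.

Lemma inside_measurable b L t : 0 <= t -> measurable (inside b L t).
Proof. by move=> t0; apply: (Gm (t := t)); exact: inside_adapted. Qed.

Lemma insideS b L s t : s <= t -> inside b L t `<=` inside b L s.
Proof. by move=> st w; exact: aliveS. Qed.

Let mX t : 0 <= t -> measurable_fun [set: T] (X t).
Proof. by move=> t0 _ B mB; rewrite setTI; apply: (Gm (t := t)); exact: adX. Qed.
Let mW t : 0 <= t -> measurable_fun [set: T] (W t).
Proof.
by move=> t0 _ B mB; rewrite setTI; apply: (Gm (t := t)); have [a _ _ _] := bm; exact: a.
Qed.

Context (v v1 v2 v3 : R -> R) (b L : R).
Context (bL : b <= L) (dv : primitive v v1) (dv1 : primitive v1 v2)
  (dv2 : primitive v2 v3) (cv3 : continuous v3)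
  (ode : forall y, eps * v2 y - F1 y * v1 y = - 1) (xbL : b <= x <= L).

Local Notation f := (fun y => v (clamp (b - 1) (L + 1) y)).
Local Notation sg := (Num.sqrt (2 * eps)).
Let euler h (k : nat) w :=
  trajectory w (k%:R * h) - h * F1 (trajectory w (k%:R * h)) + sg * (W (k.+1%:R * h) w - W (k%:R * h) w).
Let term h (k : nat) w : R :=
  \1_(inside b L (k%:R * h)) w * (f (euler h k w) - f (trajectory w (k%:R * h))).
Let Z TT (N : nat) w := \sum_(k < N) term (TT / N%:R) k w.

Let t0 (k : nat) (h : R) : 0 <= h -> 0 <= k%:R * h. Proof. by move=> h0; rewrite mulr_ge0. Qed.

Let mpath s : 0 <= s -> measurable_fun [set: T] (fun w => trajectory w s).
Proof. by move=> s0; under eq_fun do rewrite path_pos//; exact: mX. Qed.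

Let mterm h k : 0 <= h -> measurable_fun [set: T] (term h k).
Proof.
move=> h0; have k0 := t0 k h0; have k1 := t0 k.+1 h0.
have cf := continuous_measurable_fun (test_continuous (b := b) (L := L) dv dv1).
apply: measurable_funM; first by apply: measurable_indic; exact: inside_measurable.
apply: measurable_funB.
  apply: (measurableT_comp cf); apply: measurable_funD.
    apply: measurable_funB; first exact: mpath.
    apply: measurable_funM => //.
    by apply: (measurableT_comp (continuous_measurable_fun cF1)); exact: mpath.
  by apply: measurable_funM => //; apply: measurable_funB; exact: mW.
by apply: (measurableT_comp cf); exact: mpath.
Qed.

Let bL1 : b - 1 <= L + 1. Proof. by have := bL; lra. Qed.

Let term_bound Bf h k w : (forall y, `|f y| <= Bf) -> `|term h k w| <= 2 * Bf.
Proof.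
move=> hBf; rewrite /term normrM; apply: le_trans (_ : 1 * (Bf + Bf) <= _); last by rewrite mul1r mulr_natl mulr2n.
apply: ler_pM => //; first by rewrite indicE; case: (_ \in _); rewrite ?normr1 ?normr0.
by apply: le_trans (ler_normB _ _) _; rewrite lerD.
Qed.

Let iterm h k : 0 <= h -> P.-integrable [set: T] (EFin \o term h k).
Proof.
move=> h0; have [Bf _ hBf] := test_bounded dv bL1.
by apply: bounded_integrable (fun w => term_bound h k w hBf); exact: mterm.
Qed.

(** Sums [one_step] over the grid, with the past up to each grid time as sigma-algebra and the event
    that the path has stayed in [b, L]. *)
Lemma drift_sum TT e : 0 < TT -> 0 < e -> exists N0, forall N, (N0 <= N)%N ->
  `|\int[P]_w Z TT N w + TT / N%:R * \sum_(k < N) fine (P (inside b L (k%:R * (TT / N%:R))))| <= e.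
Proof.
move=> T0 e0.
have mX' k h : 0 <= h -> forall B : set R, measurable B -> G (k%:R * h) ((fun w => trajectory w (k%:R * h)) @^-1` B).
  move=> h0 B mB; have := adX (t0 k h0) mB.
  by rewrite (_ : (fun w => trajectory w (k%:R * h)) = X (k%:R * h))//; apply/funext => w; rewrite path_pos// t0.
have [_ _ _ incr] := bm.
have [C C0 hC] := @one_step R F1 v v1 v2 v3 eps b L eps0 bL cF1 dv dv1 dv2 cv3 ode d T P.
have hC' h k r : 0 < h -> h <= 1 -> 0 < r -> r <= 1 ->
  `|\int[P]_w term h k w + h * fine (P (inside b L (k%:R * h)))| <= C * (r * h + h ^+ 2 / r).
  move=> h0 h1 r0 r1; have h0' := ltW h0.
  apply: (hC (G (k%:R * h)) (fun w => trajectory w (k%:R * h)) (fun w => W (k.+1%:R * h) w - W (k%:R * h) w)) => //.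
  - exact: mX'.
  - by apply: measurable_funB; apply: mW; exact: t0.
  - move=> A B GA mB.
    have ht : k.+1%:R * h - k%:R * h = h by rewrite -natr1; ring.
    have := incr (k%:R * h) (k.+1%:R * h) A B _ GA mB.
    rewrite ht; apply; rewrite t0//= ltr_pM2r// ltr_nat//.
  - by apply: inside_adapted; exact: t0.
  - by move=> w Aw; apply: Aw; rewrite lexx t0.
(* The weight r is fixed by C r TT <= e / 2; only then is N taken so large that C TT h / r <= e /
   2. *)
pose r := Num.min 1 (e / (2 * (C * TT + 1))).
have CT : 0 < C * TT + 1 by rewrite ltr_wpDl// mulr_ge0// ltW.
have r0 : 0 < r by rewrite lt_min ltr01/= divr_gt0// mulr_gt0.
have r1 : r <= 1 by rewrite ge_min lexx.
have re : C * (r * TT) <= e / 2.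
  apply: le_trans (_ : (C * TT + 1) * r <= _).
    by rewrite mulrDl mul1r mulrCA mulrC -mulrA [TT * r]mulrC lerDl ltW.
  rewrite mulrC -ler_pdivlMr//.
  by rewrite /r ge_min; apply/orP; right; rewrite invfM mulrA.
have h_small : exists N0, forall N, (N0 <= N)%N -> TT / N.+1%:R <= 1 /\ C * (TT * (TT / N.+1%:R) / r) <= e / 2.
  pose m := Num.min 1 (e / 2 / (C * TT / r + 1)).
  have CTr : 0 < C * TT / r + 1 by rewrite ltr_wpDl// divr_ge0 ?(ltW r0)// mulr_ge0// ltW.
  have m0 : 0 < m by rewrite lt_min ltr01/= divr_gt0// divr_gt0.
  have [N0 _ hN] : \forall N \near \oo, @harmonic R N <= m / TT.
    have /cvgr0Pnorm_le := @cvg_harmonic R.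
    have mT : 0 < m / TT by rewrite divr_gt0.
    by move=> /(_ _ mT); apply: filterS => N; apply: le_trans; rewrite ler_norm.
  exists N0 => N N0N; have := hN N N0N; rewrite /harmonic ler_pdivlMr// mulrC => hm.
  split; first by rewrite (le_trans hm)// ge_min lexx.
  apply: le_trans (_ : (C * TT / r + 1) * (TT / N.+1%:R) <= _).
    have hp : 0 <= TT / N.+1%:R by rewrite divr_ge0// ltW.
    by rewrite mulrDl mul1r -[leLHS]addr0 lerD// le_eqVlt; apply/orP; left; apply/eqP; ring.
  rewrite mulrC -ler_pdivlMr//; apply: le_trans hm _.
  by rewrite /m ge_min lexx orbT.
have [N0 hN0] := h_small; exists N0.+1 => -[//|N] N0N.
have [h1 hr] := hN0 N N0N; set h := TT / N.+1%:R in h1 hr *.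
have h0 : 0 < h by rewrite divr_gt0// ltr0n.
rewrite Rintegral_sumR; last by move=> k; apply: iterm; exact: ltW.
rewrite mulr_sumr -big_split/=.
apply: le_trans (ler_norm_sum _ _ _) _.
apply: le_trans (ler_sum _ (fun (i : 'I_N.+1) _ => hC' h i r h0 h1 r0 r1)) _.
rewrite sumr_const card_ord -mulr_natl.
have e1 : N.+1%:R * h = TT by rewrite /h mulrC mulfVK// pnatr_eq0.
have gen (n c r' h' : R) : n * (c * (r' * h' + h' ^+ 2 / r')) = c * (r' * (n * h')) + c * ((n * h') * h' / r') by ring.
rewrite gen.
by rewrite e1; apply: le_trans (lerD re hr) _; rewrite -splitr.
Qed.

Let pathwise M Bf : (forall y z, `|f y - f z| <= M * `|y - z|) -> 0 <= M -> (forall y, `|f y| <= Bf) ->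
  exists2 K, 0 <= K & forall TT, 0 < TT -> {ae P, forall w,
  (forall N, `|Z TT N.+1 w| <= K * (TT + 1)) /\
  forall e, 0 < e -> exists N0, forall N, (N0 <= N)%N ->
    exists2 s, 0 <= s <= TT /\ inside b L s w &
      `|Z TT N.+1 w - (f (trajectory w s) - f x)| <= e /\
      (s = TT \/ exists2 u, `|trajectory w s - trajectory w u| <= e & ~ b <= trajectory w u <= L)}.
Proof.
move=> flip M0 fB.
have [C1 C10 hC1] := continuous_bounded b L cF1.
have Bf0 : 0 <= Bf by apply: le_trans (fB 0).
exists (M * (2 * C1) + 2 * Bf); first by rewrite addr_ge0// mulr_ge0// mulr_ge0.
move=> TT T0.
apply: filterS sde => w hw.
have hw' t : 0 <= t -> trajectory w t = x - \int[lebesgue_measure]_(s in `[0, t]) F1 (trajectory w s) + sg * W t w.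
  move=> t1; rewrite path_pos// (hw t t1) X0; congr (_ - _ + _); apply: eq_Rintegral => s.
  by rewrite inE/= in_itv/= => /andP[s0 _]; rewrite path_pos.
have a0 : alive (trajectory w) b L 0.
  by move=> s /andP[s0 s1]; rewrite (_ : s = 0) ?path0//; apply: le_anti; rewrite s1.
have EZ N : Z TT N w = \sum_(k < N) `[< alive (trajectory w) b L (k%:R * (TT / N%:R)) >]%:R *
    (f (euler (TT / N%:R) k w) - f (trajectory w (k%:R * (TT / N%:R)))).
  apply: eq_bigr => k _; rewrite /term indicE (_ : (w \in inside b L _) = `[< alive (trajectory w) b L (k%:R * (TT / N%:R)) >]); first by [].
  by apply/idP/asboolP; rewrite inE.
split.
  move=> N; rewrite EZ.
  have := @path_sum_bounded R F1 f (trajectory w) (W ^~ w) sg b L M x TT cF1 (@path_continuous w) M0 T0 flip hw' N.+1 isT a0 C1 Bf C10 hC1 fB.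
  move=> h; apply: le_trans h _; rewrite -subr_ge0.
  have q1 : 0 <= 2 * Bf * TT by rewrite mulr_ge0 ?mulr_ge0// ltW.
  have q2 : 0 <= M * (2 * C1) by rewrite mulr_ge0// mulr_ge0.
  rewrite (_ : _ - _ = M * (2 * C1) + 2 * Bf * TT); last by ring.
  exact: addr_ge0.
move=> e e0; have K0 : 0 < M * (2 * TT + 1) + 1 by rewrite ltr_wpDl// mulr_ge0// addr_ge0// mulr_ge0// ltW.
pose D := e / (M * (2 * TT + 1) + 1).
have D0 : 0 < D by rewrite divr_gt0.
have De : M * (2 * TT + 1) * D + D = e by rewrite /D; field; rewrite gt_eqF.
have MD0 : 0 <= M * (2 * TT + 1) * D by rewrite mulr_ge0 ?(ltW D0)// mulr_ge0// addr_ge0// mulr_ge0// ltW.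
have [N1 hN1] := uniform_step (path_continuous (w := w)) T0 D0.
have cFp : continuous (fun s => F1 (trajectory w s)).
  by move=> s; apply: continuous_comp; [exact: path_continuous|exact: cF1].
have [N2 hN2] := uniform_step cFp T0 D0.
exists (maxn N1 N2) => N hN.
have hN1' : (N1 <= N.+1)%N by apply: leqW; apply: leq_trans hN; exact: leq_maxl.
have hN2' : (N2 <= N.+1)%N by apply: leqW; apply: leq_trans hN; exact: leq_maxr.
have := @path_sum R F1 f (trajectory w) (W ^~ w) sg b L M x TT cF1 (@path_continuous w) M0 T0 flip hw' N.+1 isT a0 D (hN1 _ hN1') (hN2 _ hN2').
move=> [s [s0 sa] [s1 s2]]; exists s => //; rewrite EZ; split.
  rewrite path0 in s1; apply: le_trans s1 _; lra.
case: s2 => [->|[u u1 u2]]; [by left|right; exists u => //].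
apply: le_trans u1 _; lra.
Qed.

(** Left Riemann sum of t -> P(inside b L t) over [0, TT], that is, an approximation of the mean of
    the exit time from [b, L] truncated at TT. *)
Definition occupation TT (N : nat) :=
  TT / N%:R * \sum_(k < N) fine (P (inside b L (k%:R * (TT / N%:R)))).

Let iZ TT N : 0 < TT -> P.-integrable [set: T] (EFin \o Z TT N).
Proof. by move=> T0; apply: integrable_sumR => k; apply: iterm; rewrite divr_ge0// ltW. Qed.

Let mZ TT N : 0 < TT -> measurable_fun [set: T] (Z TT N).
Proof. by move=> T0; have /integrableP[/measurable_EFinP] := iZ N T0. Qed.

Let bZ TT N : exists C, forall w, `|Z TT N w| <= C.
Proof.
have [Bf _ hBf] := test_bounded dv bL1.
exists (\sum_(k < N) 2 * Bf) => w; apply: le_trans (ler_norm_sum _ _ _) _.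
by apply: ler_sum => k _; exact: term_bound.
Qed.

Let fE y : b <= y <= L -> f y = v y.
Proof. by move=> /andP[y1 y2]; rewrite clamp_id//; apply/andP; split; lra. Qed.

(** By [drift_sum] the occupation is close to v x minus the mean of v at the stopped position, and
    that position lies in [b, L], where v >= 0. *)
Lemma occupation_le : (forall y, b <= y <= L -> 0 <= v y) ->
  forall TT e, 0 < TT -> 0 < e -> exists N0, forall N, (N0 <= N)%N ->
    occupation TT N.+1 <= v x + e.
Proof.
move=> v0 TT e T0 e0.
have [M M0 flip] := test_lip dv dv1 (b - 1) (L + 1).
have [Bf Bf0 hBf] := test_bounded dv bL1.
have [K K0 hK] := pathwise flip M0 hBf; have {}hK := hK _ T0.
have e2 : 0 < e / 2 by rewrite divr_gt0.
have [N1 hN1] := drift_sum T0 e2.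
pose U N w := Z TT N.+1 w + v x.
have [] := @integral_eventually_ge R _ T P U (K * (TT + 1) + `|v x|) _ _ _ _ (e / 2) e2.
- by move=> N; apply: measurable_funD => //; exact: mZ.
- move=> N; have [C hC] := bZ TT N.+1; exists (C + `|v x|) => w.
  by apply: le_trans (ler_normD _ _) _; rewrite lerD2r.
- apply: filterS hK => w [hw _] N; apply: le_trans (ler_normD _ _) _; rewrite lerD2r.
  exact: hw.
- apply: filterS hK => w [_ hw] e' e'0; have [N0 hN0] := hw _ e'0.
  exists N0 => N N0N; have [s [s0 ss] [s1 _]] := hN0 N N0N.
  have sI : b <= trajectory w s <= L by apply: ss; move: s0 => /andP[s0 _]; rewrite s0 lexx.
  move: s1; rewrite !fE// ler_norml => /andP[s1 _].
  by have := v0 _ sI; rewrite /U; lra.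
move=> N2 hN2; exists (maxn N1 N2) => N hN.
have N1N : (N1 <= N.+1)%N by apply: leqW; apply: leq_trans hN; exact: leq_maxl.
have N2N : (N2 <= N)%N by apply: leq_trans hN; exact: leq_maxr.
have := hN2 N N2N; rewrite /U RintegralD//; [|exact: iZ|exact: finite_measure_integrable_cst].
rewrite Rintegral_prob_cst.
have := hN1 N.+1 N1N; rewrite -/(occupation TT N.+1) ler_norml => /andP[_].
have := splitr e; lra.
Qed.

(** A path that has left [b, L] is stopped near an endpoint, where v is almost 0; the term with Bf
    pays for the paths that are still inside at time TT. *)
Lemma occupation_ge : v b = 0 -> v L = 0 -> exists2 Bf, 0 <= Bf &
  forall TT e, 0 < TT -> 0 < e -> exists N0, forall N, (N0 <= N)%N ->
    v x - Bf * fine (P (inside b L TT)) - e <= occupation TT N.+1.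
Proof.
move=> vb vL.
have [M M0 flip] := test_lip dv dv1 (b - 1) (L + 1).
have [Bf Bf0 hBf] := test_bounded dv bL1.
have [K K0 hK] := pathwise flip M0 hBf.
exists Bf => // TT e T0 e0; have {}hK := hK _ T0.
have e2 : 0 < e / 2 by rewrite divr_gt0.
have [N1 hN1] := drift_sum T0 e2.
have mI := inside_measurable b L (ltW T0).
pose U N w := Bf * \1_(inside b L TT) w - (Z TT N.+1 w + v x).
have bL' : b <= L := bL.
have I1 w : `|\1_(inside b L TT) w : R| <= 1.
  by rewrite indicE; case: (_ \in _); rewrite ?normr1 ?normr0.
have [] := @integral_eventually_ge R _ T P U (Bf + (K * (TT + 1) + `|v x|)) _ _ _ _ (e / 2) e2.
- move=> N; apply: measurable_funB.
    by apply: measurable_funM => //; exact: measurable_indic.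
  by apply: measurable_funD => //; exact: mZ.
- move=> N; have [C hC] := bZ TT N.+1; exists (Bf + (C + `|v x|)) => w.
  apply: le_trans (ler_normB _ _) _; apply: lerD.
    by rewrite normrM (ger0_norm Bf0) ler_piMr.
  by apply: le_trans (ler_normD _ _) _; rewrite lerD2r.
- apply: filterS hK => w [hw _] N; apply: le_trans (ler_normB _ _) _; apply: lerD.
    by rewrite normrM (ger0_norm Bf0) ler_piMr.
  by apply: le_trans (ler_normD _ _) _; rewrite lerD2r; exact: hw.
- apply: filterS hK => w [_ hw] e' e'0.
  have M1 : 0 < M + 1 by rewrite ltr_wpDl.
  have e'' : 0 < e' / (M + 1) by rewrite divr_gt0.
  have [N0 hN0] := hw _ e''.
  exists N0 => N N0N; have [s [s0 ss] [s1 s2]] := hN0 N N0N.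
  have sI : b <= trajectory w s <= L by apply: ss; move: s0 => /andP[s0 _]; rewrite s0 lexx.
  have Me : M * (e' / (M + 1)) + e' / (M + 1) = e' by field; rewrite gt_eqF.
  have Me0 : 0 <= M * (e' / (M + 1)) by rewrite mulr_ge0// ltW.
  set D := e' / (M + 1) in e'' s1 s2 Me Me0 *.
  move: s1; rewrite ler_norml => /andP[_ s1].
  rewrite /U; case: s2 => [sT|[u u1 u2]].
    have -> : \1_(inside b L TT) w = 1 :> R by rewrite indicE mem_set// -sT.
    have := hBf (trajectory w s); rewrite ler_norml => /andP[_ hB].
    have := fE xbL; lra.
  have : f (trajectory w s) <= M * D.
    have near (y : R) : v y = 0 -> b <= y <= L -> `|trajectory w s - y| <= D -> f (trajectory w s) <= M * D.
      move=> vy ybL yD; have := flip (trajectory w s) y; rewrite (fE ybL) vy subr0 ler_norml => /andP[_ h].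
      by apply: le_trans h _; rewrite ler_wpM2l.
    move: sI u1 => /andP[sb sL]; rewrite ler_norml => /andP[u3 u4].
    have [ub|bu] := ltP (trajectory w u) b.
      by apply: (near b) => //; rewrite ?lexx// ger0_norm ?subr_ge0//; lra.
    have Lu : L < trajectory w u by rewrite ltNge; apply/negP => h; apply: u2; rewrite bu.
    by apply: (near L) => //; rewrite ?lexx ?andbT// ler0_norm ?subr_le0//; lra.
  have h0 : 0 <= Bf * \1_(inside b L TT) w by rewrite mulr_ge0.
  have := fE xbL; lra.
move=> N2 hN2; exists (maxn N1 N2) => N hN.
have N1N : (N1 <= N.+1)%N by apply: leqW; apply: leq_trans hN; exact: leq_maxl.
have N2N : (N2 <= N)%N by apply: leq_trans hN; exact: leq_maxr.
have icst := finite_measure_integrable_cst P (v x) measurableT.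
have iI := integrable_indicR P mI.
have := hN2 N N2N; rewrite /U RintegralB//; first last.
- exact: (integrableD measurableT (iZ _ T0) icst).
- exact: (integrableZl measurableT Bf iI).
rewrite RintegralD//; last exact: iZ.
rewrite RintegralZl// Rintegral_indicR// Rintegral_prob_cst.
have := hN1 N.+1 N1N; rewrite -/(occupation TT N.+1) ler_norml => /andP[h _].
have := splitr e; lra.
Qed.

End Diffusion.

Import HBSimple HBNNSimple.

Section IntegralOfArbitrary.
Context {R : realType} d (T : measurableType d) (P : probability T R).
Local Open Scope ereal_scope.

(* The integral of a nonnegative function is a supremum over the simple
   functions below it, so these bounds require no measurability of [g]. *)
Lemma le_integral_any (f g : T -> \bar R) : (forall w, 0 <= f w) ->
  (forall w, f w <= g w) -> \int[P]_w f w <= \int[P]_w g w.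
Proof.
move=> f0 fg; have g0 w : 0 <= g w by exact: le_trans (fg w).
rewrite !ge0_integralTE//; apply: ereal_sup_le => _ [h hf <-]; exists h => // w.
exact: le_trans (hf w) (fg w).
Qed.

Lemma integral_any_le (g : T -> \bar R) (M : \bar R) : (forall w, 0 <= g w) ->
  (forall (h : T -> R) (C : R), measurable_fun [set: T] h -> (forall w, 0 <= h w <= C)%R ->
     (forall w, (h w)%:E <= g w) -> \int[P]_w (h w)%:E <= M) ->
  \int[P]_w g w <= M.
Proof.
move=> g0 hM; rewrite ge0_integralTE//; apply: ge_ereal_sup => _ [h hg <-].
rewrite -integralT_nnsfun.
have [C [_ hC]] := simple_bounded (h : {sfun T >-> R}).
apply: (hM _ (C + 1)%R) => [|w|w]; [exact: measurable_funP| |exact: hg].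
rewrite fun_ge0/=; apply: le_trans (ler_norm _) (hC _ _ _ _) => //.
by rewrite ltrDl.
Qed.

End IntegralOfArbitrary.

(** The alive indices form an initial segment, so a sum of their indicators is its length. *)
Lemma count_alive (R : realType) (al : nat -> Prop) m : (forall k, al k.+1 -> al k) ->
  exists2 i, (i <= m)%N & [/\ \sum_(k < m) (`[< al k >]%:R : R) = i%:R,
    forall k, (k < i)%N -> al k & (i < m)%N -> ~ al i].
Proof.
move=> dec; elim: m => [|m [i im [si ai ni]]].
  by exists 0%N => //; split => //; rewrite big_ord0.
have mono k n : (k <= n)%N -> al n -> al k.
  by move=> /subnK <-; elim: (n - k)%N => // j h; rewrite addSn => /dec.
have [am|am] := pselect (al m).
  have E : i = m.
    apply/eqP; rewrite eqn_leq im leqNgt; apply/negP => lt_im.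
    by apply: (ni lt_im); apply: mono am; exact: ltnW.
  exists m.+1 => //; split; last by rewrite ltnn.
    by rewrite big_ord_recr /= si (asboolT am) E natr1.
  by move=> k km; apply: mono am.
exists i; first exact: leqW.
split => //; first by rewrite big_ord_recr /= si (asboolF am) addr0.
by rewrite ltnS leq_eqVlt => /orP[/eqP ->//|]; exact: ni.
Qed.

Section HittingTime.
Context {R : realType}.

Lemma hitting_time_ge0 (S : topologicalType) (z : R -> S) (H : set S) :
  (0 <= hitting_time z H)%E.
Proof.
by apply: le_ereal_inf_tmp => _ [t [t0 _] <-]; rewrite lee_fin ltW.
Qed.

Lemma hitting_time_le (S : topologicalType) (z : R -> S) (H : set S) t :
  0 < t -> H (z t) -> (hitting_time z H <= t%:E)%E.
Proof. by move=> t0 Ht; apply: ereal_inf_lbound; exists t => //; split => //; left. Qed.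

Lemma hitting_time_ge (z : R -> R) (H : set R) b L t :
  continuous (fun s : R => z (Num.max 0 s)) ->
  (forall y, b <= y <= L -> ~ H y) ->
  alive (fun s : R => z (Num.max 0 s)) b L t -> (t%:E <= hitting_time z H)%E.
Proof.
move=> cz bH al; apply: le_ereal_inf_tmp => _ [s [s0 hs] <-]; rewrite lee_fin leNgt.
apply/negP => st; have zs : b <= z s <= L.
  by have := al s; rewrite (max_idPr (ltW s0)); apply; rewrite ltW//= ltW.
case: hs => [|[l Hl lim]]; first exact: bH.
suff E : l = z s by apply: (bH (z s)) => //; rewrite -E.
have cs : z u @[u --> s^'-] --> z s.
  have := @cvg_at_left_filter R R (fun s => z (Num.max 0 s)) s _ (cz s).
  rewrite (max_idPr (ltW s0)); apply: cvg_trans; apply: near_eq_cvg.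
  by near=> u; rewrite (max_idPr _)//; near: u; exact: nbhs_left_ge.
exact: cvg_unique lim cs.
Unshelve. all: by end_near.
Qed.

End HittingTime.

(** * From occupation times to mean hitting times *)

Section DiffusionHitting.
Context {R : realType} d (T : measurableType d) (P : probability T R).
Context (G : R -> set (set T)) (W X : R -> T -> R) (F1 : R -> R) (eps x : R).
Context (fil : filtration G) (bm : brownian_motion P G W) (adX : adapted G X)
  (X0 : forall w, X 0 w = x)
  (cX : forall w, {within `[0, +oo[, continuous (X ^~ w)})
  (sde : {ae P, forall w, forall t, 0 <= t ->
          X t w = X 0 w
                  - (\int[lebesgue_measure]_(s in `[0, t]) F1 (X s w))
                  + Num.sqrt (2 * eps) * W t w})
  (eps0 : 0 < eps) (cF1 : continuous F1).
Implicit Types (H : set R) (b L : R).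

(** The continuous third derivative is carried along for the cubic Taylor remainder. *)
Definition solution (v : R -> R) := exists v1 v2 v3 : R -> R,
  [/\ primitive v v1, primitive v1 v2, primitive v2 v3 & continuous v3] /\
  forall y, eps * v2 y - F1 y * v1 y = - 1.

Local Notation inside := (inside X).
Local Notation trajectory := (trajectory X).

(** Markov's inequality in disguise: TT P(inside b L TT) is at most the occupation up to TT, hence
    at most v x + 1. *)
Lemma inside_prob_vanish b L v e : b <= x <= L -> solution v ->
  (forall y, b <= y <= L -> 0 <= v y) -> 0 < e ->
  exists2 TT, 0 < TT & fine (P (inside b L TT)) <= e.
Proof.
move=> xbL [v1 [v2 [v3 [[dv dv1 dv2 cv3] ode]]]] v0 e0.
have bL : b <= L by move: xbL => /andP[bx xL]; exact: le_trans bx xL.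
have vx := v0 x xbL.
pose TT := (v x + 1) / e.
have T0 : 0 < TT by rewrite divr_gt0// ltr_wpDl.
exists TT => //.
have [N0 hN0] := occupation_le fil bm adX X0 (@cX) sde eps0 cF1 bL dv dv1 dv2 cv3 ode xbL v0 T0 ltr01.
have := hN0 N0 (leqnn _); rewrite /occupation; set h := TT / _.
have h0 : 0 < h by rewrite divr_gt0// ltr0n.
have e1 : N0.+1%:R * h = TT by rewrite /h mulrC mulfVK// pnatr_eq0.
have mI t : 0 <= t -> P (inside b L t) \is a fin_num.
  by move=> t0; apply: fin_num_measure; exact: (inside_measurable fil adX (@cX)).
have le1 : h * \sum_(k < N0.+1) fine (P (inside b L TT)) <=
    h * \sum_(k < N0.+1) fine (P (inside b L (k%:R * h))).
  rewrite ler_wpM2l// ?(ltW h0)//; apply: ler_sum => k _.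
  have k0 : 0 <= k%:R * h by rewrite mulr_ge0// ltW.
  apply: fine_le; [exact/mI/ltW|exact: mI|].
  apply: le_measure; rewrite ?inE.
  - exact: (inside_measurable fil adX (@cX) b L (ltW T0)).
  - exact: (inside_measurable fil adX (@cX) b L k0).
  - by apply: insideS; rewrite -e1 ler_wpM2r ?(ltW h0)// ler_nat ltnW.
move=> h1; have := le_trans le1 h1.
rewrite sumr_const card_ord -mulr_natl mulrA [h * _]mulrC e1 => h2.
have : (v x + 1) * fine (P (inside b L TT)) <= (v x + 1) * e.
  by rewrite -(ler_pM2r (_ : 0 < e^-1)) ?invr_gt0// mulrAC -/TT mulfK ?gt_eqF.
by rewrite ler_pM2l// ltr_wpDl.
Qed.

(** Two solutions are used: v vanishes at both ends and gives the value of the mean exit time, while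
    u, nonnegative on [b, L], makes it unlikely to stay inside for long. *)
Lemma mean_hitting_ge H b L v u : b <= x <= L -> (forall y, b <= y <= L -> ~ H y) ->
  solution v -> v b = 0 -> v L = 0 -> solution u -> (forall y, b <= y <= L -> 0 <= u y) ->
  ((v x)%:E <= mean_hitting_time P X H)%E.
Proof.
move=> xbL bH [v1 [v2 [v3 [[dv dv1 dv2 cv3] ode]]]] vb vL su u0.
have bL : b <= L by move: xbL => /andP[bx xL]; exact: le_trans bx xL.
have [Bf Bf0 hBf] := occupation_ge fil bm adX X0 (@cX) sde eps0 cF1 bL dv dv1 dv2 cv3 ode xbL vb vL.
have mI t : 0 <= t -> measurable (inside b L t).
  by move=> t0; exact: (inside_measurable fil adX (@cX)).
apply/lee_addgt0Pr => e e0.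
(* The thirds of e pay for the paths still inside at TT, for the Riemann sum, and for the index
   shift in [phi]. *)
have e3 : 0 < e / 3 by rewrite divr_gt0.
have [TT T0 hTT] : exists2 TT, 0 < TT & Bf * fine (P (inside b L TT)) <= e / 3.
  have e4 : 0 < e / 3 / (Bf + 1) by rewrite divr_gt0// ltr_wpDl.
  have [TT T0 hT] := inside_prob_vanish xbL su u0 e4; exists TT => //.
  apply: le_trans (ler_wpM2l Bf0 hT) _.
  by rewrite mulrCA ler_piMr ?(ltW e3)// ler_pdivrMr ?mul1r ?lerDl// ltr_wpDl.
have [N1 hN1] := hBf TT (e / 3) T0 e3.
have [N2 hN2] : exists N2, forall N, (N2 <= N)%N -> TT / N.+1%:R <= e / 3.
  have /cvgr0Pnorm_le := @cvg_harmonic R.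
  have mT : 0 < e / 3 / TT by rewrite divr_gt0.
  move=> /(_ _ mT)[N2 _ h]; exists N2 => N N2N; have := h N N2N.
  rewrite /= /harmonic ger0_norm ?invr_ge0// ler_pdivlMr// mulrC//.
pose N := maxn N1 N2.
have := hN1 N (leq_maxl _ _); have := hN2 N (leq_maxr _ _).
rewrite /occupation; set h := TT / _ => he occ.
have h0 : 0 < h by rewrite divr_gt0// ltr0n.
have e1 : N.+1%:R * h = TT by rewrite /h mulrC mulfVK// pnatr_eq0.
have k0 k : 0 <= k%:R * h by rewrite mulr_ge0// ltW.
(* Right endpoints of the cells are counted, so that phi is a lower bound of the hitting time;
   compared with the occupation this loses at most one cell, of length h. *)
pose phi w : R := h * \sum_(k < N.+1) \1_(inside b L (k.+1%:R * h)) w.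
have phi0 w : 0 <= phi w.
  by rewrite mulr_ge0 ?(ltW h0)// sumr_ge0// => k _; rewrite indicE.
have indE k w : \1_(inside b L (k%:R * h)) w = `[< inside b L (k%:R * h) w >]%:R :> R.
  by rewrite indicE (_ : (w \in _) = `[< inside b L (k%:R * h) w >])//; apply/idP/asboolP; rewrite inE.
have dec w k : inside b L (k.+1%:R * h) w -> inside b L (k%:R * h) w.
  by apply: insideS; rewrite ler_wpM2r ?(ltW h0)// ler_nat.
have phit w : ((phi w)%:E <= hitting_time (X ^~ w) H)%E.
  have [i _ [si ai _]] := @count_alive R (fun k => inside b L (k.+1%:R * h) w) N.+1 (fun k => dec w k.+1).
  rewrite /phi (_ : \sum_(k < N.+1) _ = i%:R); last by rewrite -si; apply: eq_bigr => k _; rewrite indE.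
  case: i ai {si} => [|i] ai; first by rewrite mulr0 hitting_time_ge0.
  rewrite mulrC; apply: (hitting_time_ge (b := b) (L := L)) => //; last exact: ai.
  exact: (halfline_continuous (@cX w)).
apply: le_trans (_ : (\int[P]_w (phi w)%:E + e%:E <= _)%E); last first.
  by rewrite leeD2r//; apply: le_integral_any => // w; rewrite lee_fin.
have iI k := integrable_indicR P (mI _ (k0 k.+1)).
have -> : (\int[P]_w (phi w)%:E = (\int[P]_w phi w)%:E)%E.
  rewrite /Rintegral fineK//; apply: integrable_fin_num => //.
  have := integrableZl measurableT h (integrable_sumR N.+1 iI); exact.
rewrite /phi (RintegralZl h measurableT (integrable_sumR N.+1 iI)).
rewrite (Rintegral_sumR N.+1 iI) -EFinD lee_fin.
have -> : \sum_(k < N.+1) \int[P]_w (\1_(inside b L (k.+1%:R * h)) w) =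
    \sum_(k < N.+1) fine (P (inside b L (k.+1%:R * h))).
  by apply: eq_bigr => k _; rewrite Rintegral_indicR//; exact: mI.
have shift : \sum_(k < N.+1) fine (P (inside b L (k%:R * h))) <=
    1 + \sum_(k < N.+1) fine (P (inside b L (k.+1%:R * h))).
  rewrite big_ord_recl /= [X in _ <= 1 + X]big_ord_recr /= addrA.
  have p k : 0 <= fine (P (inside b L (k%:R * h))) by exact: fine_ge0.
  apply: le_trans (_ : 1 + \sum_(i < N) fine (P (inside b L (i.+1%:R * h))) <= _); last by rewrite lerDl.
  rewrite lerD2r -lee_fin fineK; last by apply: fin_num_measure; exact: mI.
  by apply: probability_le1; exact: mI.
have := ler_wpM2l (ltW h0) shift; rewrite mulrDr mulr1 => h2.
lra.
Qed.

Lemma inside_exhausts TT e : 0 <= TT -> 0 < e ->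
  exists n0, forall n, (n0 <= n)%N -> 1 - e <= fine (P (inside (- n%:R) n%:R TT)).
Proof.
move=> T0 e0; pose F n := inside (- n%:R) n%:R TT.
have mF n : measurable (F n) by exact: (inside_measurable fil adX (@cX)).
have UF : \bigcup_n F n = setT.
  apply/seteqP; split => // w _.
  have [M M0 hM] := continuous_bounded 0 TT (path_continuous (@cX) (w := w)).
  exists (Num.truncn M).+1 => // s hs; have := hM s hs; rewrite -ler_norml => h.
  by apply: le_trans h _; apply/ltW; have := truncnS_gt M; exact.
have lim : (P \o F) n @[n --> \oo] --> (1 : R)%:E.
  rewrite -[X in _ --> X](@probability_setT _ _ _ P) -UF.
  apply: nondecreasing_cvg_mu => //; first by rewrite UF.
  move=> n m nm; apply/subsetPset => w h s hs; have /andP[h1 h2] := h s hs.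
  have nm' : n%:R <= m%:R :> R by rewrite ler_nat.
  by apply/andP; split; lra.
have /fine_cvgP[_ /cvgrPdist_le/(_ e e0)[n0 _ h]] := lim.
exists n0 => n n0n; have := h n n0n; rewrite /= ler_norml => /andP[_]; lra.
Qed.

(** The point c of H separates x from every point of [-n, n] outside [bn n, Ln n]. A path confined
    to [-n, n] therefore cannot leave that interval without passing through c, and the hitting time
    is at most its exit time. *)
Lemma mean_hitting_le H v (bn Ln : nat -> R) c : H c -> c != x ->
  (forall n y, - n%:R <= y <= n%:R -> ~ (bn n <= y <= Ln n) ->
     Num.min y x <= c <= Num.max y x) ->
  solution v ->
  (\forall n \near \oo, bn n <= x <= Ln n /\ forall y, bn n <= y <= Ln n -> 0 <= v y) ->
  (mean_hitting_time P X H <= (v x)%:E)%E.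
Proof.
move=> Hc cx exitc [v1 [v2 [v3 [[dv dv1 dv2 cv3] ode]]]] [n1 _ hn1].
apply: integral_any_le => [w|phi C mphi phiC phit]; first exact: hitting_time_ge0.
(* A sample point is needed to know 0 <= C; a probability space has one. *)
have [[w0 _]|noT] := pselect (exists w : T, True); last first.
  have PT := @probability_setT _ _ _ P.
  rewrite (_ : setT = set0) ?measure0 in PT; first by case: PT => /esym/eqP; rewrite oner_eq0.
  by apply/seteqP; split => // w _; apply: noT; exists w.
pose TT := C + 1.
have C0 : 0 <= C by have /andP[p1 p2] := phiC w0; exact: le_trans p1 p2.
have T0 : 0 < TT by rewrite /TT; lra.
apply/lee_addgt0Pr => e e0.
have e2 : 0 < e / 2 by rewrite divr_gt0.
have e3 : 0 < e / 2 / TT by rewrite divr_gt0.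
have [n2 hn2] := inside_exhausts (ltW T0) e3.
pose n := maxn n1 n2.
have [xbL v0] := hn1 n (leq_maxl _ _).
have PE := hn2 n (leq_maxr _ _).
set b := bn n in xbL v0 *; set L := Ln n in xbL v0 *.
have bL : b <= L by move: xbL => /andP[bx xL]; exact: le_trans bx xL.
have [N hN] := occupation_le fil bm adX X0 (@cX) sde eps0 cF1 bL dv dv1 dv2 cv3 ode xbL v0 T0 e2.
have := hN N (leqnn _); rewrite /occupation; set h := TT / _ => occ.
have h0 : 0 < h by rewrite divr_gt0// ltr0n.
have e1 : N.+1%:R * h = TT by rewrite /h mulrC mulfVK// pnatr_eq0.
have k0 k : 0 <= k%:R * h by rewrite mulr_ge0// ltW.
have mI b' L' t : 0 <= t -> measurable (inside b' L' t).
  by move=> t0; exact: (inside_measurable fil adX (@cX)).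
set E := inside (- n%:R) n%:R TT in PE.
have mE : measurable E by apply: mI; exact: ltW.
(* As phi <= C < TT, paths that stay inside up to TT need no separate term; those that leave [-n, n]
   are charged the full TT, on an event of probability at most e / 2 / TT. *)
pose psi w : R := h * (\sum_(k < N.+1) \1_(inside b L (k%:R * h)) w) + TT * \1_(~` E) w.
have indE k w : \1_(inside b L (k%:R * h)) w = `[< inside b L (k%:R * h) w >]%:R :> R.
  by rewrite indicE (_ : (w \in _) = `[< inside b L (k%:R * h) w >])//; apply/idP/asboolP; rewrite inE.
have dec w k : inside b L (k.+1%:R * h) w -> inside b L (k%:R * h) w.
  by apply: insideS; rewrite ler_wpM2r ?(ltW h0)// ler_nat.
have hs0 w : 0 <= h * (\sum_(k < N.+1) \1_(inside b L (k%:R * h)) w) :> R.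
  by rewrite mulr_ge0 ?(ltW h0)// sumr_ge0// => k _; rewrite indicE.
have phiT w : phi w <= TT by have /andP[_ p2] := phiC w; apply: le_trans p2 _; rewrite /TT; lra.
have phipsi w : phi w <= psi w.
  have [wE|wE] := pselect (E w); last first.
    rewrite /psi [\1_(~` E) w]indicE mem_set// mulr1; apply: le_trans (phiT w) _.
    by rewrite lerDr.
  rewrite /psi [\1_(~` E) w]indicE memNset ?mulr0 ?addr0; last by move=> /(_ wE).
  have [i iN [si _ ni]] := @count_alive R (fun k => inside b L (k%:R * h) w) N.+1 (dec w).
  rewrite (_ : \sum_(k < N.+1) _ = i%:R); last by rewrite -si; apply: eq_bigr => k _; rewrite indE.
  move: iN; rewrite leq_eqVlt => /orP[/eqP ->|iN]; first by rewrite mulrC e1.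
  have /existsNP[s /not_implyP[/andP[s0 si'] sout]] := ni iN.
  have siT : s <= TT by apply: le_trans si' _; rewrite -e1 ler_wpM2r ?(ltW h0)// ler_nat ltnW.
  have sE : - n%:R <= trajectory w s <= n%:R by apply: wE; rewrite s0.
  have cpath : continuous (trajectory w) by exact: (path_continuous (@cX)).
  have := exitc n _ sE sout; rewrite minC maxC -(path0 X0 w) => hc.
  have [u us uc] := IVT s0 (continuous_subspaceT cpath) hc.
  move: us; rewrite in_itv/= => /andP[u0 us].
  have u0' : 0 < u.
    rewrite lt_neqAle u0 andbT; apply/eqP => u00; move: cx; rewrite -uc -u00 (path0 X0) eqxx//.
  have := hitting_time_le (z := X ^~ w) (H := H) u0'.
  rewrite -(path_pos X w u0) uc => /(_ Hc) ht.
  have := le_trans (phit w) ht; rewrite lee_fin => hu.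
  by rewrite mulrC; apply: le_trans hu (le_trans us si').
have iI k := integrable_indicR P (mI b L _ (k0 k)).
have iE := integrable_indicR P (measurableC mE).
have i1 : P.-integrable [set: T] (EFin \o (fun w => h * \sum_(k < N.+1) \1_(inside b L (k%:R * h)) w)).
  by have := integrableZl measurableT h (integrable_sumR N.+1 iI); exact.
have i2 : P.-integrable [set: T] (EFin \o (fun w => TT * \1_(~` E) w)).
  by have := integrableZl measurableT TT iE; exact.
have ipsi : P.-integrable [set: T] (EFin \o psi) by exact: (integrableD measurableT i1 i2).
apply: le_trans (_ : (\int[P]_w (psi w)%:E <= _)%E).
  by apply: le_integral_any => w; rewrite lee_fin//; have /andP[] := phiC w.
have -> : (\int[P]_w (psi w)%:E = (\int[P]_w psi w)%:E)%E.
  by rewrite /Rintegral fineK//; apply: integrable_fin_num.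
rewrite -EFinD lee_fin /psi RintegralD// (RintegralZl h measurableT (integrable_sumR N.+1 iI)).
rewrite (RintegralZl TT measurableT iE) (Rintegral_sumR N.+1 iI) Rintegral_indicR; last exact: measurableC.
have -> : \sum_(k < N.+1) \int[P]_w (\1_(inside b L (k%:R * h)) w) =
    \sum_(k < N.+1) fine (P (inside b L (k%:R * h))).
  by apply: eq_bigr => k _; rewrite Rintegral_indicR//; exact: mI.
have PEC : fine (P (~` E)) = 1 - fine (P E).
  by rewrite (probability_setC P mE) fineB//; exact: fin_num_measure.
have : TT * fine (P (~` E)) <= e / 2.
  rewrite mulrC -ler_pdivlMr// PEC; lra.
have := splitr e; lra.
Qed.

End DiffusionHitting.

(** * The two-state chain *)

Section ReverseFatou.
Context {R : realType} d (T : measurableType d) (P : probability T R).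

(* Applied to discretizations [S n] of a hitting time [tau]. *)
Lemma integral_ge_limsup (S : nat -> T -> R) (C l : R) (tau : T -> \bar R) :
  (forall n, measurable_fun [set: T] (S n)) -> (forall n w, 0 <= S n w <= C) ->
  (forall w s, (tau w < s%:E)%E -> exists N0, forall N, (N0 <= N)%N -> S N w <= s) ->
  (exists N0, forall N, (N0 <= N)%N -> l <= \int[P]_w S N w) ->
  (l%:E <= \int[P]_w tau w)%E.
Proof.
move=> mS SC Stau [N0 lS].
pose f n w := esups (fun k => (S k w)%:E) n.
(* The measurable function g lies below tau, and its integral is the limit of the integrals of the
   tail suprema f n, each of which dominates that of S n. *)
pose g w := limn_esup (fun k => (S k w)%:E).
have f0 n w : (0 <= f n w)%E.
  apply: le_trans (_ : (S n w)%:E <= _)%E; first by rewrite lee_fin; have /andP[] := SC n w.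
  by apply: ereal_sup_ubound; exists n => //=.
have fC n w : (f n w <= C%:E)%E.
  by apply: ge_ereal_sup => _ [k _ <-]; rewrite lee_fin; have /andP[] := SC k w.
have mf n : measurable_fun [set: T] (f n).
  have := @measurable_fun_esups _ T R setT (fun k w => (S k w)%:E) _ n; apply => k.
  by apply/measurable_EFinP.
have fg w : f n w @[n --> \oo] --> g w.
  by rewrite /g limn_esup_lim; apply: is_cvg_esups.
have g0 w : (0 <= g w)%E.
  rewrite -(cvg_lim _ (fg w))//; apply: lime_ge; last by near=> n; exact: f0.
  by apply/cvg_ex; exists (g w); exact: fg.
have gC w : (g w <= C%:E)%E.
  rewrite -(cvg_lim _ (fg w))//; apply: lime_le; last by near=> n; exact: fC.
  by apply/cvg_ex; exists (g w); exact: fg.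
have gtau w : (g w <= tau w)%E.
  rewrite leNgt; apply/negP => lt_tau_g.
  have [s s1 s2] : exists2 s : R, (tau w < s%:E)%E & (s%:E < g w)%E.
    have gfin : g w \is a fin_num by rewrite ge0_fin_numE// (le_lt_trans (gC w))// ltry.
    rewrite -(fineK gfin) in lt_tau_g *; move: (fine (g w)) lt_tau_g => y.
    case: (tau w) => [r| |]//; rewrite ?lte_fin.
      by move=> ry; exists ((r + y) / 2); rewrite lte_fin; lra.
    by exists (y - 1); [exact: ltNyr|rewrite lte_fin; lra].
  have [N1 hN1] := Stau w s s1.
  move: s2; apply/negP; rewrite -leNgt -(cvg_lim _ (fg w))//.
  apply: lime_le; first by apply/cvg_ex; exists (g w); exact: fg.
  exists N1 => // n /= N1n; apply: ge_ereal_sup => _ [k nk <-]; rewrite lee_fin.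
  exact: hN1 (leq_trans N1n nk).
apply: le_trans (le_integral_any P g0 gtau).
have lim : (\int[P]_w f n w @[n --> \oo] --> \int[P]_w g w)%E.
  apply: (@dominated_cvg _ T R P setT measurableT f g (cst C%:E)) => //.
  - exact: finite_measure_integrable_cst.
  - by move=> n w _; rewrite gee0_abs.
rewrite -(cvg_lim _ lim)//; apply: lime_ge; first by apply/cvg_ex; eexists; exact: lim.
exists N0 => // n /= N0n; apply: le_trans (_ : (\int[P]_w (S n w)%:E <= _)%E); last first.
  apply: le_integral_any => w; first by rewrite lee_fin; have /andP[] := SC n w.
  by apply: ereal_sup_ubound; exists n => //=.
have iS : P.-integrable [set: T] (EFin \o S n).
  apply: (@bounded_integrable _ _ _ _ _ C) => // w; have /andP[s0 sC] := SC n w.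
  by rewrite ger0_norm.
have := lS n N0n; rewrite -lee_fin => h; apply: le_trans h _.
by rewrite /Rintegral fineK//; exact: integrable_fin_num.
Unshelve. all: by end_near.
Qed.

End ReverseFatou.

(** * The holding time seen on a grid *)

Section ChainDiscretization.
Context {R : realType} d (T : measurableType d) (P : probability T R).
Context (a : bool -> R) (j : bool) (Y : R -> T -> bool).
Context (mc : markov_chain_from (rate_matrix a) j P Y) (a0 : 0 < a j).

(** Covers the m grid times 0, h, ..., (m - 1) h, so [stays h 1] is certain. *)
Definition stays h (m : nat) := [set w | forall k, (k < m)%N -> Y (k%:R * h) w = j].

Lemma staysS h m : stays h m.+1 = stays h m `&` [set w | Y (m%:R * h) w = j].
Proof.
apply/seteqP; split => [w hw|w [hw hm] k].
  by split => [k km|]; apply: hw => //; exact: ltnW.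
by rewrite ltnS leq_eqVlt => /orP[/eqP ->//|]; exact: hw.
Qed.

Let Yset t : [set w | Y t w = j] = Y t @^-1` [set j]. Proof. by []. Qed.

Lemma stays_adapted h m t : 0 <= h -> (forall k, (k < m)%N -> k%:R * h <= t) ->
  natural_filtration Y t (stays h m).
Proof.
move=> h0; elim: m => [|m IH] ht.
  rewrite (_ : stays h 0 = setT); last by apply/seteqP; split.
  exact: (@measurableT _ (g_sigma_algebraType [set A | exists s B, [/\ 0 <= s <= t, measurable B & A = Y s @^-1` B]])).
rewrite staysS; apply: (@measurableI _ (g_sigma_algebraType [set A | exists s B, [/\ 0 <= s <= t, measurable B & A = Y s @^-1` B]])).
  by apply: IH => k km; apply: ht; exact: leqW.
apply: sub_sigma_algebra; exists (m%:R * h), [set j]; split => //.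
by rewrite mulr_ge0//=; exact: ht.
Qed.

Lemma stays_measurable h m : 0 <= h -> measurable (stays h m).
Proof.
move=> h0; elim: m => [|m IH].
  by rewrite (_ : stays h 0 = setT)//; apply/seteqP; split.
rewrite staysS; apply: measurableI => //.
have [mY _ _ _] := mc; rewrite Yset -[X in measurable X]setTI.
by apply: mY => //; rewrite mulr_ge0.
Qed.

Lemma stay_probability : exists q : R -> R,
  [/\ forall h, 0 <= h -> 0 <= q h <= 1,
      forall h m, 0 <= h -> fine (P (stays h m.+1)) = q h ^+ m
    & forall e, 0 < e -> exists2 r, 0 < r & forall h, 0 < h < r ->
        `|(1 - q h) / h - a j| <= e].
Proof.
have [mY Y0 _ [p [p0 dp mp]]] := mc.
pose q h := p h j j; exists q.
have PT : P [set: T] = 1%E := @probability_setT _ _ _ P.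
have q1 h : 0 <= h -> P [set w | Y h w = j] = (q h)%:E.
  move=> h0; have := mp 0 h setT j j (lexx _) h0.
  rewrite (_ : [set: T] `&` [set w | Y 0 w = j] = setT); last by apply/seteqP; split => // w _; split => //=; exact: Y0.
  rewrite setTI add0r PT mul1e; apply.
  exact: (@measurableT _ (g_sigma_algebraType [set A | exists s B, [/\ 0 <= s <= 0, measurable B & A = Y s @^-1` B]])).
have stay1 h : stays h 1 = setT.
  by apply/seteqP; split => // w _ [|//] _; rewrite mul0r; exact: Y0.
split.
- move=> h h0; rewrite -2!lee_fin -q1//; rewrite measure_ge0/=.
  by apply: probability_le1; rewrite Yset -[X in measurable X]setTI; apply: mY.
- move=> h m h0; elim: m => [|m IH]; first by rewrite stay1 PT expr0.
  have hm : 0 <= m%:R * h by rewrite mulr_ge0.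
  have := mp (m%:R * h) h (stays h m.+1) j j hm h0.
  have sI : stays h m.+1 `&` [set w | Y (m%:R * h) w = j] = stays h m.+1.
    by rewrite staysS -setIA setIid.
  rewrite sI (_ : m%:R * h + h = m.+1%:R * h); last by rewrite -natr1; ring.
  rewrite -staysS => ->; last first.
    by apply: stays_adapted => // k; rewrite ltnS => km; rewrite ler_wpM2r// ler_nat.
  by rewrite fineM ?IH ?exprSr//; apply: fin_num_measure; exact: stays_measurable.
- move=> e e0; have := dp 0 j j; rewrite (bigD1 j)//= big1 ?addr0; last first.
    by move=> i ij; rewrite p0 eq_sym (negbTE ij) mul0r.
  rewrite p0 eqxx mul1r /rate_matrix eqxx => dq.
  have : (fun h => h^-1 *: (q (h *: (1 : R) + 0) - q 0)) @ 0^' --> - a j.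
    by have := @derive_val _ _ _ _ _ _ _ dq => <-; exact: ex_derive.
  move/cvgrPdist_le => /(_ e e0); rewrite near_withinE => /nbhs_ballP[r /= r0 hr].
  exists r => // h /andP[h0 hrr]; have := hr h; rewrite /ball /= sub0r normrN gtr0_norm// => /(_ hrr).
  rewrite gt_eqF// => /(_ isT); rewrite addr0 /GRing.scale /= mulr1.
  have -> : q 0 = 1 by rewrite /q p0 eqxx.
  by rewrite -normrN (_ : - (- a j - _) = (a j - (1 - q h) / h)); [rewrite distrC|field; rewrite gt_eqF].
Qed.

Let H : set bool := [set ~~ j].
Local Notation tau := (fun w => hitting_time (Y ^~ w) H).

Lemma hit_grid w h k : 0 < h -> Y (k%:R * h) w <> j -> (tau w <= (k%:R * h)%:E)%E.
Proof.
move=> h0; have [_ Y0 _ _] := mc; case: k => [|k] Yk.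
  by case: Yk; rewrite mul0r; exact: Y0.
apply: hitting_time_le; first by rewrite mulr_gt0// ltr0n.
by rewrite /H /=; case: (Y _ w) j Yk => [] [].
Qed.

Let staysE h k w : \1_(stays h k) w = `[< stays h k w >]%:R :> R.
Proof. by rewrite indicE (_ : (w \in _) = `[< stays h k w >])//; apply/idP/asboolP; rewrite inE. Qed.

Let stays_dec h w k : stays h k.+1 w -> stays h k w.
Proof. by rewrite staysS => -[]. Qed.

(** The first grid time at which the chain is not at j, truncated at M h. *)
Definition grid_time h M w : R := h * \sum_(k < M) \1_(stays h k.+1) w.

Lemma grid_timeP h M w : 0 < h -> exists2 i, (i <= M)%N &
  [/\ grid_time h M w = i%:R * h, stays h i w & (i < M)%N -> Y (i%:R * h) w <> j].
Proof.
move=> h0.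
have [i iM [si ai ni]] := @count_alive R (fun k => stays h k.+1 w) M (fun k => @stays_dec h w k.+1).
have st : stays h i w by case: i ai {iM si ni} => [_ //|i ai]; exact: ai.
exists i => //; split => //; last first.
  by move=> lt_iM; have := ni lt_iM; rewrite staysS => h1 h2; apply: h1.
rewrite /grid_time mulrC -si; congr (_ * _); apply: eq_bigr => k _; exact: staysE.
Qed.

Lemma grid_time_le h M w k : 0 < h -> Y (k%:R * h) w <> j -> grid_time h M w <= k%:R * h.
Proof.
move=> h0 Yk; have [i _ [-> st _]] := grid_timeP M w h0.
rewrite ler_wpM2r ?(ltW h0)// ler_nat leqNgt; apply/negP => ki.
exact: Yk (st k ki).
Qed.

Lemma grid_time_le_max h M w : 0 < h -> 0 <= grid_time h M w <= M%:R * h.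
Proof.
move=> h0; have [i iM [-> _ _]] := grid_timeP M w h0.
by rewrite mulr_ge0 ?(ltW h0)//= ler_wpM2r ?(ltW h0)// ler_nat.
Qed.

Lemma grid_time_measurable h M : 0 < h -> measurable_fun [set: T] (grid_time h M).
Proof.
move=> h0.
have iI k := integrable_indicR P (stays_measurable k.+1 (ltW h0)).
by have /integrableP[/measurable_EFinP] := integrableZl measurableT h (integrable_sumR M iI).
Qed.

Lemma grid_time_mean q h M : 0 < h ->
  (forall h m, 0 <= h -> fine (P (stays h m.+1)) = q h ^+ m) ->
  \int[P]_w grid_time h M w = h * \sum_(k < M) q h ^+ k.
Proof.
move=> h0 hq.
have iI k := integrable_indicR P (stays_measurable k.+1 (ltW h0)).
rewrite /grid_time (RintegralZl h measurableT (integrable_sumR M iI)) (Rintegral_sumR M iI).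
congr (_ * _); apply: eq_bigr => k _.
by rewrite Rintegral_indicR ?hq ?(ltW h0)//; exact: stays_measurable (ltW h0).
Qed.

(** Bernoulli's inequality: with s = 1 - r, the induction step is (1 - s) (1 + (M + 1) s) <= 1 + M
    s. *)
Lemma bernoulli_pow (r : R) M : 0 <= r <= 1 -> r ^+ M * (1 + M%:R * (1 - r)) <= 1.
Proof.
move=> /andP[r0 r1]; elim: M => [|M IH]; first by rewrite expr0 mul0r addr0 mul1r.
apply: le_trans IH; rewrite exprSr -mulrA ler_wpM2l ?exprn_ge0//.
rewrite -natr1; have : 0 <= (M%:R + 1) * (1 - r) ^+ 2 by rewrite mulr_ge0 ?sqr_ge0// addr_ge0.
nra.
Qed.

(** The hitting time is at most the first grid time away from j, of mean at most h / (1 - q h) <= 1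
    / kap for any kap < a j and small h. *)
Lemma chain_hitting_le : (mean_hitting_time P Y H <= (1 / a j)%:E)%E.
Proof.
have [q [q01 qm qlim]] := stay_probability.
apply: integral_any_le => [w|phi C mphi phiC phit]; first exact: hitting_time_ge0.
have [[w0 _]|noT] := pselect (exists w : T, True); last first.
  have PT := @probability_setT _ _ _ P.
  rewrite (_ : setT = set0) ?measure0 in PT; first by case: PT => /esym/eqP; rewrite oner_eq0.
  by apply/seteqP; split => // w _; apply: noT; exists w.
have C0 : 0 <= C by have /andP[p1 p2] := phiC w0; exact: le_trans p1 p2.
have iphi : P.-integrable [set: T] (EFin \o phi).
  apply: (@bounded_integrable _ _ _ _ _ C) => // w; have /andP[s0 sC] := phiC w.
  by rewrite ger0_norm.
rewrite (_ : (\int[P]_w (phi w)%:E = (\int[P]_w phi w)%:E)%E); last first.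
  by rewrite /Rintegral fineK//; exact: integrable_fin_num.
rewrite lee_fin.
have key kap : 0 < kap < a j -> \int[P]_w phi w <= 1 / kap.
  move=> /andP[kap0 kapa]; apply/ler_addgt0Pr => e e0.
  have ak : 0 < a j - kap by lra.
  have [r r0 hr] := qlim _ ak.
  pose h := r / 2; have h0 : 0 < h by rewrite /h; lra.
  have hh : 0 < h < r by rewrite h0 /h/=; lra.
  have := hr h hh; rewrite ler_norml => /andP[h1 _].
  have {h1} kq : kap * h <= 1 - q h by rewrite -ler_pdivlMr//; lra.
  have /andP[q0 q1] := q01 h (ltW h0).
  have kh : 0 < kap * h by rewrite mulr_gt0.
  (* With M kap h >= C / e, Bernoulli's inequality gives C q^M <= e, which absorbs the truncation at
     M h. *)
  pose M := (Num.truncn (C / e / (kap * h))).+1.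
  have Mb : C <= e * (M%:R * (kap * h)).
    have := truncnS_gt (C / e / (kap * h)); rewrite -/M ltr_pdivrMr// ltr_pdivrMr// => hM.
    by apply: ltW; rewrite mulrC.
  have tail : C * q h ^+ M <= e.
    have := bernoulli_pow M (q01 h (ltW h0)) => hb.
    have qM0 : 0 <= q h ^+ M by rewrite exprn_ge0.
    apply: le_trans (ler_wpM2r qM0 Mb) _.
    have MM : M%:R * (kap * h) <= 1 + M%:R * (1 - q h).
      by apply: le_trans (_ : M%:R * (1 - q h) <= _); [rewrite ler_wpM2l|rewrite lerDr].
    have := ler_wpM2l qM0 MM => h2.
    rewrite -mulrA -[leRHS]mulr1 ler_wpM2l ?(ltW e0)// mulrC; exact: le_trans h2 hb.
  have mS := stays_measurable M.+1 (ltW h0).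
  have iS := integrable_indicR P mS.
  have iG : P.-integrable [set: T] (EFin \o grid_time h M).
    apply: (@bounded_integrable _ _ _ _ _ (M%:R * h)) => [|w]; first exact: grid_time_measurable.
    by have /andP[g1 g2] := grid_time_le_max M w h0; rewrite ger0_norm.
  have iCS : P.-integrable [set: T] (EFin \o (fun w => C * \1_(stays h M.+1) w)).
    by have := integrableZl measurableT C iS; exact.
  apply: le_trans (_ : \int[P]_w (grid_time h M w + C * \1_(stays h M.+1) w) <= _).
    apply: le_Rintegral => //; first exact: (integrableD measurableT iG iCS).
    move=> w _; have [i iM [-> st ni]] := grid_timeP M w h0.
    have /andP[_ pC] := phiC w.
    have [sM|sM] := pselect (stays h M.+1 w).
      rewrite indicE mem_set// mulr1; apply: le_trans pC _; rewrite lerDr mulr_ge0// ltW//.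
    rewrite indicE memNset// mulr0 addr0.
    suff Yi : Y (i%:R * h) w <> j by rewrite -lee_fin (le_trans (phit w))// hit_grid.
    move: iM; rewrite leq_eqVlt => /orP[/eqP E|]; last exact: ni.
    by move=> Yi; apply: sM; rewrite staysS -E.
  rewrite RintegralD// (RintegralZl C measurableT iS) Rintegral_indicR// qm ?(ltW h0)//.
  rewrite (grid_time_mean _ h0 qm); apply: lerD => //.
  have := subrX1 (q h) M; set S := \sum_(k < M) _ => hS.
  have : (1 - q h) * S <= 1 by have : 0 <= q h ^+ M by [rewrite exprn_ge0]; rewrite -opprB mulNr -hS; lra.
  have S0 : 0 <= S by apply: sumr_ge0 => k _; rewrite exprn_ge0.
  move=> hS1; rewrite ler_pdivlMr//; apply: le_trans hS1.
  by rewrite (_ : h * S * kap = kap * h * S) ?ler_wpM2r//; ring.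
apply/ler_addgt0Pr => e e0.
have i0 : 0 < (a j)^-1 by rewrite invr_gt0.
have e1 : 0 < (a j)^-1 + e by lra.
have := key ((a j)^-1 + e)^-1; rewrite !div1r invrK; apply.
rewrite invr_gt0 e1/= -[ltRHS]invrK ltf_pV2 ?posrE//; lra.
Qed.

(** A grid may miss a visit to the other state, but the paths are cadlag, so a visit lasts for an
    open interval of time and fine enough grids detect it. Hence the limsup of the grid times,
    truncated at C, is at most the hitting time; then C tends to infinity. *)
Lemma chain_hitting_ge : ((1 / a j)%:E <= mean_hitting_time P Y H)%E.
Proof.
have [q [q01 qm qlim]] := stay_probability.
have [_ Y0 cad _] := mc.
have key C : 0 < C -> ((C / (1 + C * (a j + 1 / C)))%:E <= mean_hitting_time P Y H)%E.
  move=> C0.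
  pose h M := C / M.+1%:R.
  have h0 M : 0 < h M by rewrite divr_gt0// ltr0n.
  have hM M : M.+1%:R * h M = C by rewrite /h mulrC mulfVK// pnatr_eq0.
  have hsmall r : 0 < r -> exists N0, forall N, (N0 <= N)%N -> h N < r.
    move=> r0; have /cvgr0Pnorm_lt := @cvg_harmonic R.
    have mT : 0 < r / C by rewrite divr_gt0.
    move=> /(_ _ mT)[N2 _ hh]; exists N2 => N N2N; have := hh N N2N.
    by rewrite /= /harmonic ger0_norm ?invr_ge0// ltr_pdivlMr// mulrC.
  apply: (@integral_ge_limsup R _ T P (fun M => grid_time (h M) M.+1) C).
  - by move=> M; exact: grid_time_measurable.
  - by move=> M w; have := grid_time_le_max M.+1 w (h0 M); rewrite hM.
  - move=> w s /ereal_inf_lt[_ [t [t0 ht] <-]]; rewrite lte_fin => ts.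
    (* Off j on an interval ending no later than s: to the right of t if the chain has jumped by
       time t, to the left of t if only the left limit at t is in the target. *)
    have [u [r [u0 r0 urs hY]]] : exists u r, [/\ 0 <= u, 0 < r, u + r <= s &
        forall y, u < y < u + r -> Y y w <> j].
      have nj : ~~ j <> j by case: (j).
      have [right left] := cad w t (ltW t0).
      case: ht => [Ht|[l Hl lim]].
        have : \forall y \near t^'+, Y y w = Y t w.
          have := right [set Y t w]; rewrite nbhs_principalE; apply => y /= ->//.
        rewrite near_withinE => /nbhs_ballP[r /= r0 hr].
        have m0 : 0 < Num.min r (s - t) by rewrite lt_min r0/=; lra.
        exists t, (Num.min r (s - t)); split => //; first exact: ltW.
          by have : Num.min r (s - t) <= s - t by [rewrite ge_min lexx orbT]; lra.
        move=> y /andP[ty yr]; have mr : Num.min r (s - t) <= r by rewrite ge_min lexx.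
        rewrite (hr y)//; first by rewrite Ht.
        by rewrite /ball /= ltr0_norm; lra.
      have : \forall y \near t^'-, Y y w = l.
        have := lim [set l]; rewrite nbhs_principalE; apply => y /= ->//.
      rewrite near_withinE => /nbhs_ballP[r /= r0 hr].
      have m0 : 0 < Num.min r t by rewrite lt_min r0.
      have mr : Num.min r t <= r by rewrite ge_min lexx.
      have mt : Num.min r t <= t by rewrite ge_min lexx orbT.
      exists (t - Num.min r t), (Num.min r t); split => //; [lra|lra|].
      move=> y /andP[ty yr]; rewrite (hr y); [by rewrite Hl| |lra].
      by rewrite /ball /= gtr0_norm; lra.
    have [N0 hN0] := hsmall r r0; exists N0 => N N0N.
    pose k := (Num.truncn (u / h N)).+1.
    have kh1 : u < k%:R * h N by have := truncnS_gt (u / h N); rewrite ltr_pdivrMr.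
    have kh2 : k%:R * h N < u + r.
      have uh : 0 <= u / h N by rewrite divr_ge0// ltW.
      have := truncn_le (u / h N); rewrite uh ler_pdivlMr//.
      have := hN0 N N0N; rewrite /k -natr1 mulrDl mul1r; lra.
    have Yk : Y (k%:R * h N) w <> j by apply: hY; rewrite kh1.
    exact: le_trans (grid_time_le N.+1 (h0 N) Yk) (le_trans (ltW kh2) urs).
  - have c1 : 0 < 1 / C by rewrite divr_gt0.
    have [r r0 hr] := qlim _ c1.
    have [N0 hN0] := hsmall r r0; exists N0 => N N0N.
    have hh : 0 < h N < r by rewrite h0 hN0.
    have := hr _ hh; rewrite ler_norml => /andP[_ h1].
    have /andP[q0 q1] := q01 (h N) (ltW (h0 N)).
    rewrite (grid_time_mean _ (h0 N) qm).
    (* With n = N.+1 one has n = n q^n + n (1 - q^n) <= S + n (1 - q) S, which bounds the geometric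
       sum S from below. *)
    have hS := subrX1 (q (h N)) N.+1.
    have Sq : N.+1%:R * q (h N) ^+ N.+1 <= \sum_(k < N.+1) q (h N) ^+ k.
      rewrite mulr_natl -[X in _ *+ X](card_ord N.+1) -sumr_const; apply: ler_sum => k _.
      by apply: ler_wiXn2l => //; exact: ltnW.
    have S0 : 0 <= \sum_(k < N.+1) q (h N) ^+ k by apply: sumr_ge0 => k _; rewrite exprn_ge0.
    move: S0 Sq hS; set S := \sum_(k < N.+1) _ => S0 Sq hS.
    have hq : N.+1%:R * (1 - q (h N)) <= C * (a j + 1 / C).
      by rewrite -{1}(hM N) -mulrA ler_wpM2l// mulrC -ler_pdivrMr//; lra.
    have d0 : 0 < 1 + C * (a j + 1 / C).
      by rewrite ltr_pwDl// mulr_ge0 ?(ltW C0)// addr_ge0 ?(ltW c1)// ltW.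
    rewrite ler_pdivrMr//; apply: le_trans (_ : h N * N.+1%:R <= _); first by rewrite mulrC hM.
    rewrite -(mulrA (h N)) ler_wpM2l ?(ltW (h0 N))//.
    have h2 := ler_wpM2l S0 hq.
    have : N.+1%:R * ((1 - q (h N)) * S) = N.+1%:R * (1 - q (h N) ^+ N.+1).
      by congr (_ * _); rewrite -opprB mulNr -hS opprB.
    rewrite mulrBr mulr1 [in X in _ -> X]mulrDr mulr1; move: h2; rewrite (_ : S * (N.+1%:R * (1 - q (h N))) = N.+1%:R * ((1 - q (h N)) * S)); last by ring.
    move=> h2 h3; move: h2; rewrite h3; lra.
apply/lee_addgt0Pr => e e0; have aj0 := a0; set aj := a j in key aj0 *.
have ae : 0 < aj ^+ 2 * e by rewrite mulr_gt0// exprn_gt0.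
(* The defect 1 / aj - C / (2 + C aj) is at most 2 / (aj^2 C) = e. *)
pose C := 2 / (aj ^+ 2 * e).
have C0 : 0 < C by rewrite divr_gt0.
apply: le_trans (leeD2r e%:E (key C C0)); rewrite -EFinD lee_fin.
have Ca : 0 < C * aj by rewrite mulr_gt0.
have E : 1 + C * (aj + 1 / C) = 2 + C * aj by field; rewrite gt_eqF.
rewrite E -lerBlDl.
have Ce : aj * (C * aj) * e = 2 by rewrite /C; field; rewrite !gt_eqF.
have -> : 1 / aj - C / (2 + C * aj) = 2 / (aj * (2 + C * aj)).
  by field; rewrite !gt_eqF// ltr_wpDl// ltW.
rewrite ler_pdivrMr; last by rewrite mulr_gt0// ltr_wpDl// ltW.
rewrite -{1}Ce (_ : e * _ = aj * (2 + C * aj) * e); last by ring.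
by rewrite ler_pM2r// ler_pM2l// lerDr.
Qed.

End ChainDiscretization.

(** * The double-well potential *)

Section RealAnalysis.
Context {R : realType}.
Implicit Types (f F : R -> R).

Lemma derivable_primitive f : (forall x, derivable f x 1) -> primitive f (derive1 f).
Proof. by move=> df x; rewrite derive1E; exact: derivableP. Qed.

Lemma continuous_le_ends F x y d : continuous F -> 0 < d ->
  (forall t, 0 < t -> t < d -> F (x + t) <= F (y - t)) -> F x <= F y.
Proof.
move=> cF d0 h.
have lx : F (x + t) @[t --> 0^'+] --> F x.
  apply: cvg_at_right_filter; rewrite -[X in _ --> F X]addr0.
  apply: (continuous_comp (f := fun t => x + t) (g := F)); last exact: cF.
  by apply: cvgD; [exact: cvg_cst|exact: cvg_id].
have ly : F (y - t) @[t --> 0^'+] --> F y.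
  apply: cvg_at_right_filter; rewrite -[X in _ --> F X]subr0.
  apply: (continuous_comp (f := fun t => y - t) (g := F)); last exact: cF.
  by apply: cvgB; [exact: cvg_cst|exact: cvg_id].
apply: ler_cvg_to lx ly _; near=> t; apply: h; near: t.
  exact: nbhs_right_gt.
exact: nbhs_right_lt.
Unshelve. all: by end_near.
Qed.

Lemma powR_ge1 (x b : R) : 1 <= x -> 0 <= b -> 1 <= x `^ b.
Proof.
move=> x1 b0; have x0 : 0 <= x by rewrite (le_trans ler01).
have := @ge0_ler_powR R b b0 1 x; rewrite !nnegrE ler01 x0 powR1; exact.
Qed.

Lemma powR_unbounded (b K : R) : 0 < b -> exists2 x : R, 1 <= x & K < x `^ b.
Proof.
move=> b0; pose M := Num.max 1 (K + 1).
have M1 : 1 <= M by rewrite le_max lexx.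
have MK : K < M by rewrite lt_max ltrDl ltr01 orbT.
exists (M `^ b^-1).
  by rewrite powR_ge1// invr_ge0 ltW.
by rewrite -powRrM mulVf ?gt_eqF// powRr1// (le_trans ler01).
Qed.

Lemma powR_mono_unbounded (b K : R) : 0 < b -> exists2 x : R, 1 <= x & forall y, x <= y -> K <= y `^ b.
Proof.
move=> b0; have [x x1 h] := powR_unbounded K b0; exists x => // y xy.
apply: le_trans (ltW h) _; apply: ge0_ler_powR => //; rewrite ?nnegrE ?(ltW b0)//.
  by rewrite (le_trans ler01).
by rewrite (le_trans ler01)// (le_trans x1).
Qed.

(** For large z the constant c2 is at most half of c1 z^a, which leaves f^2 >= k^2 z^a with k^2 = c1
    / 2; a > 2 makes the exponent a / 2 exceed 1. *)
Lemma superlinear_of_square f (a c1 c2 z0 M : R) : 2 < a -> 0 < c1 ->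
  (forall z, z0 < z -> 0 <= f z) ->
  (forall z, 0 <= z -> c1 * z `^ a - c2 <= f z ^+ 2) ->
  exists k L : R, superlinear f (a / 2) k L /\ M <= L.
Proof.
move=> a2 c10 f0 hf.
have a0 : 0 < a by lra.
have [x x1 hx] := powR_mono_unbounded (2 * c2 / c1) a0.
pose k := Num.sqrt (c1 / 2).
pose L := Num.max x (Num.max (z0 + 1) M).
have k0 : 0 < k by rewrite sqrtr_gt0 divr_gt0.
exists k, L; split; last by rewrite !le_max lexx !orbT.
have Lx : x <= L by rewrite le_max lexx.
have L0 : 0 < L by apply: lt_le_trans Lx; lra.
split => //; first lra.
move=> z Lz; have z0z : z0 < z.
  by apply: lt_le_trans Lz; rewrite !lt_max ltrDl ltr01 orbT.
have zp : 0 <= z by rewrite (le_trans _ Lz)// ltW.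
have fz := f0 z z0z.
rewrite -(@ler_pXn2r _ 2%N) ?nnegrE ?mulr_ge0 ?(ltW k0) ?powR_ge0//.
apply: le_trans (hf z zp).
rewrite exprMn sqr_sqrtr; last by rewrite divr_ge0// ltW.
rewrite -powR_mulrn ?powR_ge0// -powRrM divfK//.
have := hx z (le_trans Lx Lz); rewrite ler_pdivrMr// => h; lra.
Qed.

(** Comparing both growth bounds at infinity forces a1 <= a2; together with a2 < 2 a1 - 2 this gives
    a1 > 2. *)
Lemma growth_exponent (a1 a2 c1 c2 c3 c4 : R) (g : R -> R) : 0 < a2 -> 0 < c1 -> 0 < c2 -> 0 < c3 -> 0 < c4 ->
  (forall x, c1 * `|x| `^ a1 - c2 <= g x <= c3 * `|x| `^ a2 + c4) -> a1 <= a2.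
Proof.
move=> a20 c10 c20 c30 c40 h; rewrite leNgt; apply/negP => a21.
have d0 : 0 < a1 - a2 by lra.
have [x x1 hx] := powR_unbounded ((c3 + c2 + c4) / c1) d0.
have x0 : 0 <= x by rewrite (le_trans ler01).
have /andP[h1 h2] := h x; rewrite ger0_norm// in h1 h2.
have p1 : 1 <= x `^ a2.
  by rewrite powR_ge1// ltW.
have e : x `^ a1 = x `^ a2 * x `^ (a1 - a2).
  by rewrite -powRD ?(gt_eqF (lt_le_trans ltr01 x1)) ?implybT// addrC subrK.
have := le_trans h1 h2; rewrite e.
move: hx; rewrite ltr_pdivrMr// => hx.
have : x `^ a2 * (c3 + c2 + c4) < x `^ a2 * (x `^ (a1 - a2) * c1).
  by rewrite ltr_pM2l// (lt_le_trans ltr01).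
nra.
Qed.

End RealAnalysis.

(** * Consequences of the assumptions on F *)

Section Potential.
Context {R : realType} (F : R -> R) (x0 x1 : R) (dw : double_well F x0 x1).

Let F1 := derive1 F.

Lemma potential_primitive : [/\ primitive F F1, primitive F1 (derive1n 2 F) & continuous (derive1n 2 F)].
Proof.
have [[dF _] _ _ _ _] := dw.
have d0 := derivable_primitive (fun x => dF 0%N x isT).
have d1 := derivable_primitive (fun x => dF 1%N x isT).
have d2 := derivable_primitive (fun x => dF 2%N x isT).
by split; [exact: d0|exact: d1|exact: (primitive_continuous d2)].
Qed.

Let dF : primitive F F1 := let: And3 h _ _ := potential_primitive in h.
Let cF : continuous F := primitive_continuous dF.
Let cF1 : continuous F1.
Proof. by have [_ h _] := potential_primitive; exact: primitive_continuous h. Qed.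

Lemma potential_decl x y : x <= y -> y <= x0 -> F y <= F x.
Proof.
have [_ _ _ _ [[h _] _ _ _]] := dw.
rewrite le_eqVlt => /orP[/eqP -> //|xy] yx0.
have cN : continuous (fun z => - F z) by move=> z; apply: continuousN; exact: cF.
rewrite -lerN2; apply: (@continuous_le_ends _ (fun z => - F z) x y ((y - x) / 2) cN) => [|t t0 td]; first lra.
by rewrite lerN2; apply/ltW/h; lra.
Qed.

Lemma potential_inc x y : x0 <= x -> x <= y -> y <= 0 -> F x <= F y.
Proof.
have [_ _ _ _ [_ [h _] _ _]] := dw.
move=> x0x; rewrite le_eqVlt => /orP[/eqP -> //|xy] y0.
apply: (@continuous_le_ends _ F x y ((y - x) / 2) cF) => [|t t0 td]; first lra.
by apply/ltW/h; lra.
Qed.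

Lemma potential_dec x y : 0 <= x -> x <= y -> y <= x1 -> F y <= F x.
Proof.
have [_ _ _ _ [[_ h] _ _ _]] := dw.
move=> x0x; rewrite le_eqVlt => /orP[/eqP -> //|xy] y0.
have cN : continuous (fun z => - F z) by move=> z; apply: continuousN; exact: cF.
rewrite -lerN2; apply: (@continuous_le_ends _ (fun z => - F z) x y ((y - x) / 2) cN) => [|t t0 td]; first lra.
by rewrite lerN2; apply/ltW/h; lra.
Qed.

Lemma potential_incr x y : x1 <= x -> x <= y -> F x <= F y.
Proof.
have [_ _ _ _ [_ [_ h] _ _]] := dw.
move=> x1x; rewrite le_eqVlt => /orP[/eqP -> //|xy].
apply: (@continuous_le_ends _ F x y ((y - x) / 2) cF) => [|t t0 td]; first lra.
by apply/ltW/h; lra.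
Qed.

Lemma potential_ge x : F x0 <= F x.
Proof.
have [_ _ _ _ [_ _ _ /ltW F01]] := dw.
have [xx0|/ltW xx0] := leP x x0; first exact: potential_decl.
have [x0'|/ltW x0'] := leP x 0; first exact: potential_inc.
apply: le_trans F01 _.
by have [xx1|/ltW xx1] := leP x x1; [exact: potential_dec|exact: potential_incr].
Qed.

Let deriv_ge0 (f f1 : R -> R) z : primitive f f1 -> continuous f1 ->
  (forall x y, z <= x -> x <= y -> f x <= f y) -> forall x, z < x -> 0 <= f1 x.
Proof.
move=> df cf1 nd x zx; rewrite leNgt; apply/negP => neg.
have /cvgrPdist_lt/(_ (- f1 x)) := cf1 x; rewrite oppr_gt0 => /(_ neg) /nbhs_ballP[r /= r0 hr].
have xr : x <= x + r / 2 by rewrite lerDl divr_ge0// ltW.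
have [c /andP[c1 c2] e] := primitive_MVT df xr.
have : `|f1 x - f1 c| < - f1 x.
  by apply: hr; rewrite /ball /= distrC ger0_norm ?subr_ge0//; lra.
rewrite ltr_norml => /andP[h1 h2].
have c0 : f1 c < 0 by lra.
have := nd x _ (ltW zx) xr; rewrite -subr_ge0 e addrAC subrr add0r.
by rewrite leNgt nmulr_rlt0// divr_gt0.
Qed.

Let exponents : exists a1 c1 c2 : R, [/\ 2 < a1, 0 < c1 &
  forall x, c1 * `|x| `^ a1 - c2 <= F1 x ^+ 2].
Proof.
have [_ _ [a1 [a2 [c1 [c2 [c3 [c4 [[a10 a20 a12] [c10 c20 c30 c40] h _]]]]]]] _ _] := dw.
have := growth_exponent a20 c10 c20 c30 c40 h => a12'.
exists a1, c1, c2; split => //; first lra.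
by move=> x; have /andP[] := h x; rewrite real_normK ?num_real.
Qed.

Lemma tail_right : exists p k L, superlinear F1 p k L /\ x1 <= L.
Proof.
have [a1 [c1 [c2 [a2 c10 h]]]] := exponents.
have := @superlinear_of_square _ F1 a1 c1 c2 x1 x1 a2 c10.
case=> [||k [L hL]]; last by exists (a1 / 2), k, L.
- exact: deriv_ge0 dF cF1 potential_incr.
- by move=> z z0; have := h z; rewrite ger0_norm.
Qed.

Lemma tail_left : exists p k L, superlinear (fun x => - F1 (- x)) p k L /\ - x0 <= L.
Proof.
have [a1 [c1 [c2 [a2 c10 h]]]] := exponents.
have := @superlinear_of_square _ (fun x => - F1 (- x)) a1 c1 c2 (- x0) (- x0) a2 c10.
case=> [||k [L hL]]; last by exists (a1 / 2), k, L.
- apply: (deriv_ge0 (primitive_reflect dF)).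
    by move=> z; apply: (@continuousN _ _ _ (fun u : R => F1 (- u))); apply: continuous_comp; [exact: opp_continuous|exact: cF1].
  by move=> x y xx xy; apply: potential_decl; lra.
- by move=> z z0; have := h (- z); rewrite normrN ger0_norm// sqrrN.
Qed.

End Potential.

Section SpectralData.
Context {R : realType} (F : R -> R) (x0 x1 : R) (dw : double_well F x0 x1).
Local Notation F1 := (derive1 F).

Lemma weight_primitives eps : 0 < eps -> exists P S (lp lm : R),
  [/\ primitive P (weight F eps), primitive S (fun x => expR (F x / eps)),
      P x @[x --> +oo] --> lp & P x @[x --> -oo] --> lm].
Proof.
move=> eps0; have [dF _ _] := potential_primitive dw.
have [p [k [L [tailR _]]]] := tail_right dw.
have [p' [k' [L' [tailL _]]]] := tail_left dw.
have [P dP] := primitive_exists (weight_continuous (eps := eps) dF).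
have cE : continuous (fun x => expR (F x / eps)).
  move=> x; apply: (continuous_comp (f := fun x => F x / eps)); last exact: continuous_expR.
  by apply: cvgM; [exact: (primitive_continuous dF)|exact: cvg_cst].
have [S dS] := primitive_exists cE.
have [lp hlp] := weight_prim_cvg dF eps0 tailR dP.
have [lm hlm] := weight_prim_cvg (primitive_reflect dF) eps0 tailL (primitive_reflectN dP).
exists P, S, lp, (- lm); split => //.
by apply/cvgNy_compNP; rewrite -[P \o _]opprK; apply: cvgN; exact: hlm.
Qed.

Lemma at_pinfty_cvg (eta : R -> R) : oriented eta -> eta x @[x --> +oo] --> at_pinfty eta.
Proof.
move=> [_ [M hM] _ inc].
have nd : {homo eta : x y / x <= y}.
  by move=> x y; rewrite le_eqVlt => /orP[/eqP -> //|/inc/ltW].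
have [l hl] := @eventually_bounded_cvg R eta M 0 nd (fun y _ => le_trans (ler_norm _) (hM y)).
by rewrite /at_pinfty (cvg_lim _ hl).
Qed.

Lemma at_ninfty_cvg (eta : R -> R) : oriented eta -> eta x @[x --> -oo] --> at_ninfty eta.
Proof.
move=> [_ [M hM] _ inc].
have nd : {homo (fun x => - eta (- x)) : x y / x <= y}.
  move=> x y; rewrite le_eqVlt => /orP[/eqP -> //|xy].
  by rewrite lerN2; apply/ltW/inc; rewrite ltrN2.
have [l hl] := @eventually_bounded_cvg R _ M 0 nd (fun y _ => le_trans (ler_norm _) (eq_ind_r (fun z => z <= M) (hM (- y)) (normrN _))).
have hl' : eta x @[x --> -oo] --> - l.
  by apply/cvgNy_compNP; rewrite -[eta \o _]opprK; apply: cvgN; exact: hl.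
by rewrite /at_ninfty (cvg_lim _ hl').
Qed.

Lemma at_pinfty_gt0 (eta : R -> R) : oriented eta -> 0 < at_pinfty eta.
Proof.
move=> o; have [_ _ [r [_ _ hr]] inc] := o.
have nd : {homo eta : x y / x <= y}.
  by move=> x y; rewrite le_eqVlt => /orP[/eqP -> //|/inc/ltW].
have h : 0 < eta (r + 1) by apply: hr; rewrite ltrDl.
exact: lt_le_trans h (homo_le_lim (r + 1) nd (at_pinfty_cvg o)).
Qed.

Lemma at_ninfty_lt0 (eta : R -> R) : oriented eta -> at_ninfty eta < 0.
Proof.
move=> o; have [_ _ [r [hr _ _]] inc] := o.
have nd : {homo (fun x => - eta (- x)) : x y / x <= y}.
  move=> x y; rewrite le_eqVlt => /orP[/eqP -> //|xy].
  by rewrite lerN2; apply/ltW/inc; rewrite ltrN2.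
have h : eta (r - 1) < 0 by apply: hr; rewrite ltrBlDr ltrDl.
have hl : - eta (- x) @[x --> +oo] --> - at_ninfty eta.
  by apply: cvgN; apply: cvg_reflect; exact: at_ninfty_cvg.
have := homo_le_lim (1 - r) nd hl; rewrite opprB; lra.
Qed.

Lemma spectral_data_of eps lam eta P S lp lm : 0 < eps ->
  second_eigenvalue F eps (- lam) -> eigenfunction F eps (- lam) eta -> oriented eta ->
  primitive P (weight F eps) -> primitive S (fun x => expR (F x / eps)) ->
  P x @[x --> +oo] --> lp -> P x @[x --> -oo] --> lm ->
  spectral_data F F1 eps P S lp lm eta (derive1 eta) (derive1 (derive1 eta)) lam
    (at_pinfty eta) `|at_ninfty eta|.
Proof.
move=> eps0 [lam0 _ _] [_ deta _ ode] o dP dS hlp hlm; have [_ _ _ inc] := o.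
have d1 := derivable_primitive (fun x => (deta x).1).
have d2 := derivable_primitive (fun x => (deta x).2).
have neg := at_ninfty_lt0 o.
split => //.
- by rewrite oppr_lt0 in lam0.
- exact: at_pinfty_cvg.
- exact: at_pinfty_gt0.
- by rewrite ltr0_norm// opprK; exact: at_ninfty_cvg.
- by rewrite normr_gt0 lt_eqF.
Qed.

End SpectralData.

(** * Gibbs integrals of the tilted densities *)

Section GibbsIntegrals.
Context {R : realType} (F F1 : R -> R) (eps p k L p' k' L' : R).
Context (dF : primitive F F1) (eps0 : 0 < eps)
  (tailR : superlinear F1 p k L) (tailL : superlinear (fun x => - F1 (- x)) p' k' L').
Context (P S eta eta1 eta2 : R -> R) (lp lm lam Hp Hm : R).
Context (sd : spectral_data F F1 eps P S lp lm eta eta1 eta2 lam Hp Hm).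
Local Notation J := (flux F eps eta1 lam).

Let dP := sd_dP sd. Let limp := sd_lp sd. Let limm := sd_lm sd.
Let deta := sd_deta sd. Let deta1 := sd_deta1 sd. Let lam0 := sd_lam sd.
Let ode : forall x, eps * eta2 x - F1 x * eta1 x = - lam * eta x := sd_ode sd.
Let inc : {homo eta : x y / x < y} := sd_inc sd.
Let etap := sd_Hp sd. Let etam := sd_Hm sd. Let Hp0 := sd_Hp0 sd. Let Hm0 := sd_Hm0 sd.

Lemma flux_cvgy : J x @[x --> +oo] --> 0.
Proof. exact: (flux_cvg0 dF eps0 tailR deta deta1 ode lam0 inc etap Hp0). Qed.

Lemma flux_cvgNy : J x @[x --> -oo] --> 0.
Proof.
have sq : \forall x \near -oo, 0 <= J x <= Hm * (P x - lm).
  near=> x; rewrite (flux_ge0 F eps0 deta lam0 inc)//=.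
  by apply: (flux_le_left dF eps0 tailL dP limm deta deta1 ode lam0 inc etam Hm0).
apply: (squeeze_cvgr sq); first exact: cvg_cst.
  rewrite -[X in _ --> X](mulr0 Hm) -(subrr lm); apply: cvgM; first exact: cvg_cst.
  by apply: cvgB => //; exact: cvg_cst.
Unshelve. all: by end_near.
Qed.

Lemma gibbs_total : \int[lebesgue_measure]_(x in [set: R]) expR (- F x / eps) = lp - lm.
Proof.
rewrite /Rintegral (ge0_integral_line (Q := P) (l := lm) (l' := lp))//.
  exact: (weight_continuous dF).
Qed.

Let eta_bound x : `|eta x| <= Hp + Hm.
Proof.
rewrite ler_norml; apply/andP; split.
  have := eta_ge_lim deta inc etam x; have := Hp0; lra.
have := eta_le_lim deta inc etap x; have := Hm0; lra.
Qed.

Section Tilted.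
Context (c : R).
Let g x := (1 + c * eta x) * weight F eps x.
Let K := 1 + `|c| * (Hp + Hm).
Let Q x := P x - c * J x.

Let cw : continuous (weight F eps) := weight_continuous dF.
Let cg : continuous g.
Proof.
move=> x; rewrite /continuous_at; apply: cvgM; last exact: cw.
apply: cvgD; first exact: cvg_cst.
by apply: cvgM; [exact: cvg_cst|exact: (primitive_continuous deta)].
Qed.
Let ch : continuous (fun x => K * weight F eps x).
Proof. by move=> x; rewrite /continuous_at; apply: cvgM; [exact: cvg_cst|exact: cw]. Qed.
Let gK x : `|g x| <= K * weight F eps x.
Proof.
rewrite normrM (ger0_norm (ltW (weight_gt0 _ _ _))) ler_wpM2r ?(ltW (weight_gt0 _ _ _))//.
apply: le_trans (ler_normD _ _) _; rewrite normr1 lerD2l normrM ler_wpM2l//.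
Qed.
Let dQ : primitive Q g.
Proof.
have := primitiveB dP (primitiveZ c (flux_primitive dF eps0 deta1 ode lam0)).
rewrite -/Q; suff -> : (fun x => weight F eps x - c * (- eta x * weight F eps x)) = g by [].
by apply/funext => x; rewrite /g; ring.
Qed.
Let dK : primitive (fun x => K * P x) (fun x => K * weight F eps x) := primitiveZ K dP.
Let limQp : Q x @[x --> +oo] --> lp.
Proof.
rewrite -[X in _ --> X]subr0 -[X in _ - X](mulr0 c); apply: cvgB => //.
by apply: cvgM; [exact: cvg_cst|exact: flux_cvgy].
Qed.
Let limQm : Q x @[x --> -oo] --> lm.
Proof.
rewrite -[X in _ --> X]subr0 -[X in _ - X](mulr0 c); apply: cvgB => //.
by apply: cvgM; [exact: cvg_cst|exact: flux_cvgNy].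
Qed.

(** The density (1 + c eta) G has the antiderivative P - c J, and J vanishes at both ends of the
    line. *)
Lemma gibbs_left : gibbs_int F eps `]-oo, 0[ (fun x => 1 + c * eta x) =
  (P 0 - lm - c * J 0) / (lp - lm).
Proof.
rewrite /gibbs_int gibbs_total; congr (_ / _).
have lK : K * P x @[x --> -oo] --> K * lm by apply: cvgM => //; exact: cvg_cst.
have [_] := signed_integral_left cg ch gK dQ dK limQm lK.
by rewrite /g /weight => ->; rewrite /Q; ring.
Qed.

Lemma gibbs_right : gibbs_int F eps `]0, +oo[ (fun x => 1 + c * eta x) =
  (lp - P 0 + c * J 0) / (lp - lm).
Proof.
rewrite /gibbs_int gibbs_total; congr (_ / _).
have lK : K * P x @[x --> +oo] --> K * lp by apply: cvgM => //; exact: cvg_cst.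
have [_] := signed_integral_right cg ch gK dQ dK limQp lK.
by rewrite /g /weight => ->; rewrite /Q; ring.
Qed.

End Tilted.
End GibbsIntegrals.

Section DiffusionBounds.
Context {R : realType} (F : R -> R) (eps x : R).
Context d (T : measurableType d) (P : probability T R) (X : R -> T -> R).
Context (eps0 : 0 < eps) (cF1 : continuous (derive1 F)) (dX : diffusion_from F eps x P X).

Lemma diffusion_mean_ge (H : set R) b L v u : b <= x <= L -> (forall y, b <= y <= L -> ~ H y) ->
  solution (derive1 F) eps v -> v b = 0 -> v L = 0 ->
  solution (derive1 F) eps u -> (forall y, b <= y <= L -> 0 <= u y) ->
  ((v x)%:E <= mean_hitting_time P X H)%E.
Proof.
have [G [W [[fil bm] adX X0 cX sde]]] := dX.
exact: (mean_hitting_ge fil bm adX X0 (@cX) sde eps0 cF1).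
Qed.

Lemma diffusion_mean_le (H : set R) v (bn Ln : nat -> R) c : H c -> c != x ->
  (forall n y, - n%:R <= y <= n%:R -> ~ (bn n <= y <= Ln n) ->
     Num.min y x <= c <= Num.max y x) ->
  solution (derive1 F) eps v ->
  (\forall n \near \oo, bn n <= x <= Ln n /\ forall y, bn n <= y <= Ln n -> 0 <= v y) ->
  (mean_hitting_time P X H <= (v x)%:E)%E.
Proof.
have [G [W [[fil bm] adX X0 cX sde]]] := dX.
exact: (mean_hitting_le fil bm adX X0 (@cX) sde eps0 cF1).
Qed.

End DiffusionBounds.

Section VanishingRatio.
Context {R : realType} (U S : R -> R) (c0 : R).
Context (c00 : 0 < c0)
  (Slin : forall y z, y <= z -> c0 * (z - y) <= S z - S y)
  (small : forall e, 0 < e -> exists L0, forall y, L0 <= y -> U y - U L0 <= e * (S y - S L0)).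

(** S grows at least linearly, so constants coming from the change of base point from L0 to b are
    swamped by half of e (S L - S b). Used to send the artificial far endpoint of an exit interval
    to infinity. *)
Lemma vanishing_ratio b M e : 0 < e -> exists L, [/\ M <= L, b < L & U L - U b <= e * (S L - S b)].
Proof.
move=> e0; have e2 : 0 < e / 2 by rewrite divr_gt0.
have [L0 hL0] := small e2.
pose C := `|e / 2 * (S b - S L0)| + `|U L0 - U b|.
pose t := C / (e / 2 * c0).
have t0 : 0 <= t by rewrite divr_ge0 ?addr_ge0// mulr_ge0 ?ltW.
pose L := Num.max M (Num.max L0 (b + 1 + t)).
have L1 : b + 1 + t <= L by rewrite !le_max lexx !orbT.
have L0L : L0 <= L by rewrite !le_max lexx !orbT.
have bL : b < L by lra.
exists L; split => //; first by rewrite le_max lexx.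
have hC : C <= e / 2 * (S L - S b).
  apply: le_trans (ler_wpM2l (ltW e2) (Slin (ltW bL))).
  rewrite mulrA [leRHS]mulrC -ler_pdivrMr ?mulr_gt0// -/t; lra.
have h1 := hL0 L L0L.
have h2 := ler_norm (e / 2 * (S b - S L0)); have h3 := ler_norm (U L0 - U b).
move: hC; rewrite /C; lra.
Qed.

End VanishingRatio.

(** * Explicit solutions and exit times *)

Section ExitTimes.
Context {R : realType} (F : R -> R) (x0 x1 : R) (dw : double_well F x0 x1).
Context (eps : R) (eps0 : 0 < eps) (P S : R -> R) (lp lm : R).
Context (dP : primitive P (weight F eps)) (dS : primitive S (fun x => expR (F x / eps)))
  (limp : P x @[x --> +oo] --> lp) (limm : P x @[x --> -oo] --> lm).
Local Notation F1 := (derive1 F).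
Local Notation E x := (expR (F x / eps)).

Let dF : primitive F F1 := let: And3 h _ _ := potential_primitive dw in h.

(** The integrating factor exp(F / eps) reduces the equation to K' = - G. Adding a constant to K
    adds a multiple of S to v, which allows a boundary value to be adjusted. *)
Lemma solution_of (K v : R -> R) : primitive K (fun y => - weight F eps y) ->
  primitive v (fun y => eps^-1 * (E y * K y)) -> solution F1 eps v.
Proof.
move=> dK dv; have [_ dF1 cF2] := potential_primitive dw.
pose v1 y := eps^-1 * (E y * K y).
pose v2 y := eps^-1 * (F1 y * v1 y - 1).
pose v3 y := eps^-1 * (F1 y * v2 y + v1 y * derive1n 2 F y - 0).
have dE : primitive (fun y => E y) (fun y => F1 y / eps * E y).
  have := primitive_expR (primitiveZ eps^-1 dF).
  have -> : (fun y => expR (eps^-1 * F y)) = (fun y => E y) by apply/funext => y; rewrite mulrC.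
  by have -> : (fun y => eps^-1 * F1 y * expR (eps^-1 * F y)) = (fun y => F1 y / eps * E y) by apply/funext => y; rewrite [eps^-1 * F1 y]mulrC [eps^-1 * F y]mulrC.
have d1 : primitive v1 v2.
  have := primitiveZ eps^-1 (primitiveM dE dK).
  have -> // : (fun y => eps^-1 * (E y * - weight F eps y + K y * (F1 y / eps * E y))) = v2.
  apply/funext => y; rewrite mulrN weight_inv /v2 /v1; ring.
have d2 : primitive v2 v3.
  exact: (primitiveZ eps^-1 (primitiveB (primitiveM dF1 d1) (primitive_cst 1))).
exists v1, v2, v3; split; last first.
  by move=> y; rewrite /v2; field; rewrite gt_eqF.
split => //.
have c1 := primitive_continuous d1; have c2 := primitive_continuous d2.
have cF1 := primitive_continuous dF1.
move=> y; rewrite /continuous_at /v3; apply: cvgM; first exact: cvg_cst.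
apply: cvgB; last exact: cvg_cst.
by apply: cvgD; apply: cvgM; [exact: cF1|exact: c2|exact: c1|exact: cF2].
Qed.

Let E_gt0 y : 0 < E y. Proof. exact: expR_gt0. Qed.

Let Slin : forall y z, y <= z -> expR (F x0 / eps) * (z - y) <= S z - S y.
Proof.
move=> y z yz; apply: (primitive_lb dS yz) => t _.
by rewrite ler_expR ler_pM2r ?invr_gt0//; exact: (potential_ge dw).
Qed.

Section Right.
Context (u : R -> R) (du : primitive u (fun y => eps^-1 * (E y * (lp - P y)))).

Let N_ge0 y : 0 <= lp - P y. Proof. exact: (weight_tail_ge0 dP limp). Qed.
Let und : {homo u : y z / y <= z}.
Proof.
by apply: (primitive_nd du) => y; rewrite !mulr_ge0 ?invr_ge0 ?(ltW eps0)// ltW.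
Qed.

Lemma solution_right al be kap : solution F1 eps (fun y => u y - al - kap * (S y - be)).
Proof.
apply: (@solution_of (fun y => lp - P y - eps * kap)).
  have := primitiveB (primitiveB (primitive_cst lp) dP) (primitive_cst (eps * kap)).
  by have -> : (fun y => 0 - weight F eps y - 0) = (fun y => - weight F eps y) by apply/funext => y; ring.
have := primitiveB (primitiveB du (primitive_cst al)) (primitiveZ kap (primitiveB dS (primitive_cst be))).
have -> // : (fun y => eps^-1 * (E y * (lp - P y)) - 0 - kap * (E y - 0)) = (fun y => eps^-1 * (E y * (lp - P y - eps * kap))).
by apply/funext => y; field; rewrite gt_eqF.
Qed.

Let small : forall e, 0 < e -> exists L0, forall y, L0 <= y -> u y - u L0 <= e * (S y - S L0).
Proof.
move=> e e0; have ee : 0 < e * eps by rewrite mulr_gt0.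
have /cvgrPdist_lt/(_ _ ee) h := limp.
have [L0 hL0] := filter_ex h.
exists L0 => y Ly; have hN : lp - P L0 <= e * eps by apply: ltW; apply: le_lt_trans hL0; rewrite ler_norm.
have := primitive_le (primitiveB (primitiveZ e dS) du) Ly; rewrite /= => hh.
suff : e * S L0 - u L0 <= e * S y - u y by lra.
apply: hh => z /andP[Lz _].
have hP := weight_prim_nd dP Lz.
have -> : e * E z - eps^-1 * (E z * (lp - P z)) = eps^-1 * (E z * (e * eps - (lp - P z))) by field; rewrite gt_eqF.
by rewrite !mulr_ge0 ?invr_ge0 ?(ltW eps0) ?(ltW (E_gt0 z))//; lra.
Qed.

Context d (T : measurableType d) (Pr : probability T R) (X : R -> T -> R).
Context (rho : R) (rho0 : 0 < rho).
Let cF1 : continuous F1.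
Proof. by have [_ h _] := potential_primitive dw; exact: primitive_continuous h. Qed.

(** A multiple kap of S - S b is subtracted from u - u b so that the solution also vanishes at a far
    endpoint L. Since u grows more slowly than S, kap can be made as small as desired. *)
Lemma exit_right_ge : diffusion_from F eps x1 Pr X -> x0 + rho < x1 ->
  ((u x1 - u (x0 + rho)%R)%:E <= mean_hitting_time Pr X (ball x0 rho))%E.
Proof.
move=> dX bx1; set b := x0 + rho.
apply/lee_addgt0Pr => e e0.
have Sb : 0 <= S x1 - S b.
  by apply: le_trans (Slin (ltW bx1)); rewrite mulr_ge0 ?expR_ge0 ?subr_ge0 ?(ltW bx1).
have e1 : 0 < e / (S x1 - S b + 1) by rewrite divr_gt0// ltr_wpDl.
have [L [x1L bL hL]] := vanishing_ratio (expR_gt0 _) Slin small b x1 e1.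
have SL : 0 < S L - S b.
  by apply: lt_le_trans (Slin (ltW bL)); rewrite mulr_gt0 ?expR_gt0 ?subr_gt0.
pose kap := (u L - u b) / (S L - S b).
have kape : kap * (S x1 - S b) <= e.
  apply: le_trans (_ : e / (S x1 - S b + 1) * (S x1 - S b) <= _).
    by rewrite ler_wpM2r// ler_pdivrMr.
  by rewrite mulrAC -mulrA ler_piMr ?(ltW e0)// ler_pdivrMr ?mul1r ?lerDl// ltr_wpDl.
have := @diffusion_mean_ge R F eps x1 d T Pr X eps0 cF1 dX (ball x0 rho) b L
   (fun y => u y - u b - kap * (S y - S b)) (fun y => u y - u b - 0 * (S y - 0)).
move=> /(_ _ _ (solution_right _ _ _) _ _ (solution_right _ _ _)) h.
apply: le_trans (_ : ((u x1 - u b - kap * (S x1 - S b))%:E + e%:E <= _)%E).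
  by rewrite -EFinD lee_fin; lra.
rewrite leeD2r//; apply: h.
- by rewrite (ltW bx1).
- by move=> y /andP[yb _]; rewrite /ball /= distrC => /ltr_normlW; rewrite /b in yb; lra.
- by rewrite !subrr mulr0 subrr.
- by rewrite /kap divfK ?subrr// gt_eqF.
- by move=> y /andP[by_ _]; rewrite mul0r subr0 subr_ge0 und.
Qed.

(** From x1 the diffusion must pass x0, which lies in the ball, before leaving [x0, n] downwards; u
    - u x0 is a nonnegative solution on these intervals. *)
Lemma exit_right_le : diffusion_from F eps x1 Pr X ->
  (mean_hitting_time Pr X (ball x0 rho) <= (u x1 - u x0)%:E)%E.
Proof.
move=> dX; have [_ _ _ /andP[x00 x10] _] := dw.
have := @diffusion_mean_le R F eps x1 d T Pr X eps0 cF1 dX (ball x0 rho)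
   (fun y => u y - u x0 - 0 * (S y - 0)) (fun=> x0) (fun n => n%:R) x0 (ballxx _ rho0).
rewrite mul0r subr0; apply.
- by rewrite lt_eqF// (lt_trans x00).
- move=> n y /andP[_ yn]; rewrite yn andbT => /negP; rewrite -ltNge => yx0.
  by rewrite ge_min le_max (ltW yx0)/= (ltW (lt_trans x00 x10)) orbT.
- exact: solution_right.
- exists (Num.truncn x1).+1 => // n /= hn; split.
    rewrite (ltW (lt_trans x00 x10))/=; apply/ltW/(lt_le_trans (truncnS_gt x1)).
    by rewrite ler_nat.
  by move=> y /andP[x0y _]; rewrite mul0r subr0 subr_ge0 und.
Qed.

End Right.

Section Left.
Context (w : R -> R) (dw' : primitive w (fun y => eps^-1 * (E y * (P y - lm)))).

Let M_ge0 y : 0 <= P y - lm.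
Proof.
have lim : - P (- x) @[x --> +oo] --> - lm by apply: cvgN; exact: cvg_reflect.
have := weight_tail_ge0 (primitive_reflectN dP) lim (- y); rewrite !opprK; lra.
Qed.
Let wnd : {homo w : y z / y <= z}.
Proof.
by apply: (primitive_nd dw') => y; rewrite !mulr_ge0 ?invr_ge0 ?(ltW eps0)// ltW.
Qed.

Lemma solution_left al be kap : solution F1 eps (fun y => al - w y - kap * (be - S y)).
Proof.
apply: (@solution_of (fun y => lm - P y + eps * kap)).
  have := primitiveD (primitiveB (primitive_cst lm) dP) (primitive_cst (eps * kap)).
  by have -> : (fun y => 0 - weight F eps y + 0) = (fun y => - weight F eps y) by apply/funext => y; ring.
have := primitiveB (primitiveB (primitive_cst al) dw') (primitiveZ kap (primitiveB (primitive_cst be) dS)).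
have -> // : (fun y => 0 - eps^-1 * (E y * (P y - lm)) - kap * (0 - E y)) = (fun y => eps^-1 * (E y * (lm - P y + eps * kap))).
by apply/funext => y; field; rewrite gt_eqF.
Qed.

Let small : forall e, 0 < e -> exists L0, forall y, L0 <= y ->
  - w (- y) - - w (- L0) <= e * (- S (- y) - - S (- L0)).
Proof.
move=> e e0; have ee : 0 < e * eps by rewrite mulr_gt0.
have /cvgrPdist_lt/(_ _ ee) h := limm.
have [L0 hL0] := filter_ex h.
exists (- L0) => y Ly; have hN : P L0 - lm <= e * eps.
  by apply: ltW; apply: le_lt_trans hL0; rewrite distrC ler_norm.
have yL0 : - y <= L0 by lra.
have := primitive_le (primitiveB (primitiveZ e dS) dw') yL0 => /= hh.
rewrite !opprK; suff : e * S (- y) - w (- y) <= e * S L0 - w L0 by lra.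
apply: hh => z /andP[_ Lz].
have hP := weight_prim_nd dP Lz.
have -> : e * E z - eps^-1 * (E z * (P z - lm)) = eps^-1 * (E z * (e * eps - (P z - lm))) by field; rewrite gt_eqF.
by rewrite !mulr_ge0 ?invr_ge0 ?(ltW eps0) ?(ltW (E_gt0 z))//; lra.
Qed.

Context d (T : measurableType d) (Pr : probability T R) (X : R -> T -> R).
Context (rho : R) (rho0 : 0 < rho).
Let cF1 : continuous F1.
Proof. by have [_ h _] := potential_primitive dw; exact: primitive_continuous h. Qed.

Lemma exit_left_ge : diffusion_from F eps x0 Pr X -> x0 < x1 - rho ->
  ((w (x1 - rho)%R - w x0)%:E <= mean_hitting_time Pr X (ball x1 rho))%E.
Proof.
move=> dX bx1; set c := x1 - rho.
apply/lee_addgt0Pr => e e0.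
have Sb : 0 <= S c - S x0.
  by apply: le_trans (Slin (ltW bx1)); rewrite mulr_ge0 ?expR_ge0 ?subr_ge0 ?(ltW bx1).
have e1 : 0 < e / (S c - S x0 + 1) by rewrite divr_gt0// ltr_wpDl.
have Slin' y z : y <= z -> expR (F x0 / eps) * (z - y) <= - S (- z) - - S (- y).
  by move=> yz; have := @Slin (- z) (- y); rewrite lerN2 => /(_ yz); lra.
have [L [x1L bL]] := vanishing_ratio (expR_gt0 _) Slin' small (- c) (- x0) e1.
rewrite !opprK => hL.
have Lc : - L < c by lra.
have SL : 0 < S c - S (- L).
  by apply: lt_le_trans (Slin (ltW Lc)); rewrite mulr_gt0 ?expR_gt0 ?subr_gt0.
(* Makes the solution vanish at the far endpoint - L as well as at c. *)
pose kap := (w c - w (- L)) / (S c - S (- L)).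
have kape : kap * (S c - S x0) <= e.
  apply: le_trans (_ : e / (S c - S x0 + 1) * (S c - S x0) <= _).
    by rewrite ler_wpM2r// ler_pdivrMr//; lra.
  by rewrite mulrAC -mulrA ler_piMr ?(ltW e0)// ler_pdivrMr ?mul1r ?lerDl// ltr_wpDl.
have := @diffusion_mean_ge R F eps x0 d T Pr X eps0 cF1 dX (ball x1 rho) (- L) c
   (fun y => w c - w y - kap * (S c - S y)) (fun y => w c - w y - 0 * (0 - S y)).
move=> /(_ _ _ (solution_left _ _ _) _ _ (solution_left _ _ _)) h.
apply: le_trans (_ : ((w c - w x0 - kap * (S c - S x0))%:E + e%:E <= _)%E).
  by rewrite -EFinD lee_fin; lra.
rewrite leeD2r//; apply: h.
- by rewrite (ltW bx1) andbT; lra.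
- by move=> y /andP[_ yb]; rewrite /ball /= => /ltr_normlW; rewrite /c in yb; lra.
- by rewrite /kap divfK ?subrr// gt_eqF.
- by rewrite !subrr mulr0 subrr.
- by move=> y /andP[_ yc]; rewrite mul0r subr0 subr_ge0 wnd.
Qed.

Lemma exit_left_le : diffusion_from F eps x0 Pr X ->
  (mean_hitting_time Pr X (ball x1 rho) <= (w x1 - w x0)%:E)%E.
Proof.
move=> dX; have [_ _ _ /andP[x00 x10] _] := dw.
have := @diffusion_mean_le R F eps x0 d T Pr X eps0 cF1 dX (ball x1 rho)
   (fun y => w x1 - w y - 0 * (0 - S y)) (fun n => - n%:R) (fun=> x1) x1 (ballxx _ rho0).
rewrite mul0r subr0; apply.
- by rewrite gt_eqF// (lt_trans x00).
- move=> n y /andP[yn _]; rewrite yn /= => /negP; rewrite -ltNge => yx1.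
  by rewrite ge_min le_max (ltW yx1) (ltW (lt_trans x00 x10)) orbT.
- exact: solution_left.
- exists (Num.truncn (- x0)).+1 => // n /= hn; split.
    rewrite (ltW (lt_trans x00 x10)) andbT lerNl; apply/ltW/(lt_le_trans (truncnS_gt (- x0))).
    by rewrite ler_nat.
  by move=> y /andP[_ x0y]; rewrite mul0r subr0 subr_ge0 wnd.
Qed.

End Left.
End ExitTimes.

(** * The equivalence *)

Section LimitAlgebra.
Context {R : realType}.
Implicit Types (f g : R -> R).

Lemma lim0_near_eq f g l : (\forall eps \near 0^'+, f eps = g eps) -> lim0 f l -> lim0 g l.
Proof. by move=> fg; apply: cvg_trans; apply: near_eq_cvg; apply: filterS fg => x ->. Qed.

Lemma lim0_red f (x y : R) : x = y -> lim0 f x -> lim0 f y.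
Proof. by move=> ->. Qed.

Lemma lim0_div f g (l m : R) : m != 0 -> lim0 f l -> lim0 g m -> lim0 (fun x => f x / g x) (l / m).
Proof. by move=> m0 fl gm; apply: (lim0M fl); exact: lim0V. Qed.

Lemma lim0_cancel f g (l m : R) : m != 0 -> lim0 (fun x => f x * g x) l -> lim0 g m -> lim0 f (l / m).
Proof.
move=> m0 fg gm; apply: lim0_near_eq (lim0_div m0 fg gm).
have g0 : \forall eps \near (0 : R)^'+, g eps != 0 by exact: (cvgr_neq0 m).
by apply: filterS g0 => x gx; rewrite mulfK.
Qed.

(* [a] stands for xi_1 |eta(-oo)| and [b] for - xi_0 eta(oo). *)
Lemma coupling_limits (A N r kR kL a b : R -> R) :
  lim0 A 1 -> lim0 N 0 -> lim0 r 0 -> lim0 kR 1 -> lim0 kL 1 ->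
  (forall eps, 0 < eps -> a eps != 0 /\ b eps != 0) ->
  [/\ lim0 (fun x => 1 - N x + b x * A x * r x) 1, lim0 (fun x => N x + a x * A x) 1,
      lim0 (fun x => (1 + b x / a x * r x) / kR x) 1 &
      lim0 (fun x => (r x + a x / b x) / kL x) 1] <->
  lim0 b 1 /\ lim0 a 1.
Proof.
(* A is J(0) / (|eta(-oo)| Z), N the mass fraction of the right half-line, r is |eta(-oo)| /
   eta(oo), kR is lambda m_1 and kL is lambda m_0 r. *)
move=> hA hN hr hkR hkL nz; have n1 : (1 : R) != 0 := oner_neq0 _.
split=> [[_ h2 _ h4]|[hb ha]].
(* The second limit gives a A -> 1, hence a -> 1; the fourth gives a / b -> 1 because r -> 0; then b
   is the quotient of a by a / b. *)
- have ha : lim0 a 1.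
    apply: lim0_red (lim0_cancel n1 (l := 1) _ hA); first by rewrite divr1.
    apply: lim0_red (lim0_eq _ (lim0B h2 hN)); first by rewrite subr0.
    by move=> x _; rewrite addrC addKr.
  have hab : lim0 (fun x => a x / b x) 1.
    apply: lim0_red (lim0_eq _ (lim0B (lim0_cancel (f := fun x => r x + a x / b x) (g := fun x => (kL x)^-1) n1 h4 _) hr)).
    + by rewrite divr1 subr0.
    + by move=> x _; rewrite addrC addKr.
    + by rewrite -[X in lim0 _ X]invr1; exact: lim0V.
  split => //; apply: lim0_red (lim0_eq _ (lim0_div n1 ha hab)); first by rewrite divr1.
  by move=> x x0; have [a0 b0] := nz x x0; rewrite invfM invrK mulrA mulfV// mul1r.
- split.
  + apply: lim0_red (lim0D (lim0_1B hN) (lim0M (lim0M hb hA) hr)); first by rewrite subr0 mulr0 addr0.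
  + apply: lim0_red (lim0D hN (lim0M ha hA)); first by rewrite mulr1 add0r.
  + apply: lim0_red (lim0_div n1 (lim0D (lim0_cst 1) (lim0M (lim0_div n1 hb ha) hr)) hkR).
    by rewrite mulr0 addr0 divr1.
  + apply: lim0_red (lim0_div n1 (lim0D hr (lim0_div n1 ha hb)) hkL).
    by rewrite add0r !divr1.
Qed.

End LimitAlgebra.

Theorem theorem4p5 (R : realType) (F : R -> R) (x0 x1 rho : R)
    (lambda : R -> R) (eta : R -> R -> R) (xi p : R -> bool -> R)
    (* the coupled processes (X_eps, Y_eps) *)
    (d : measure_display) (T : R -> measurableType d)
    (P : forall eps, probability (T eps) R)
    (X : forall eps, R -> T eps -> R) (Y : forall eps, R -> T eps -> bool)
    (* the diffusions started at x, giving E^x *)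
    (dX : measure_display) (TX : R -> R -> measurableType dX)
    (PX : forall eps x, probability (TX eps x) R)
    (Xst : forall eps x, R -> TX eps x -> R)
    (* the chains started at j, giving E^j *)
    (dY : measure_display) (TY : R -> bool -> measurableType dY)
    (PY : forall eps j, probability (TY eps j) R)
    (Yst : forall eps j, R -> TY eps j -> bool) :
  double_well F x0 x1 ->
  0 < rho < Num.min `|x0| x1 ->
  (forall eps, 0 < eps ->
     [/\ second_eigenvalue F eps (- lambda eps),
         eigenfunction F eps (- lambda eps) (eta eps)
       & oriented (eta eps)]) ->
  (forall eps, 0 < eps -> admissible (eta eps) (xi eps)) ->
  (forall eps, 0 < eps ->
     (forall j, 0 <= p eps j) /\ p eps false + p eps true = 1) ->
  (forall eps, 0 < eps ->
     coupled_process F eps (rate_matrix (rate (lambda eps) (xi eps)))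
       (tilt (eta eps) (xi eps)) (p eps) (P eps) (@X eps) (@Y eps)) ->
  (* the known formula for the conditional laws of the coupling *)
  (forall eps t j (A : set R), 0 < eps -> 0 <= t -> measurable A ->
     cond_law F eps (tilt (eta eps) (xi eps)) (P eps) (@X eps) (@Y eps) t j A =
     gibbs_int F eps A (tilt (eta eps) (xi eps) j)) ->
  (forall eps x, 0 < eps -> diffusion_from F eps x (PX eps x) (@Xst eps x)) ->
  (forall eps j, 0 < eps ->
     markov_chain_from (rate_matrix (rate (lambda eps) (xi eps))) j
       (PY eps j) (@Yst eps j)) ->
  [/\ forall t, 0 <= t ->
        cond_law F eps (tilt (eta eps) (xi eps)) (P eps) (@X eps) (@Y eps)
          t false `]-oo, 0[ @[eps --> 0^'+] --> (1 : R),
      forall t, 0 <= t ->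
        cond_law F eps (tilt (eta eps) (xi eps)) (P eps) (@X eps) (@Y eps)
          t true `]0, +oo[ @[eps --> 0^'+] --> (1 : R),
      equivalent0_ereal
        (fun eps => mean_hitting_time (PY eps true) (@Yst eps true) [set false])
        (fun eps => mean_hitting_time (PX eps x1) (@Xst eps x1) (ball x0 rho))
    & equivalent0_ereal
        (fun eps => mean_hitting_time (PY eps false) (@Yst eps false) [set true])
        (fun eps => mean_hitting_time (PX eps x0) (@Xst eps x0) (ball x1 rho))]
  <->
  equivalent0 (xi ^~ false) (fun eps => - (at_pinfty (eta eps))^-1) /\
  equivalent0 (xi ^~ true) (fun eps => `|at_ninfty (eta eps)|^-1).
Proof.
move=> dw /andP[rho0 rhomin] eig adm _ _ law diff chain.
have [_ _ _ /andP[x00 x10] [[_ sdec] [sinc _] _ F01]] := dw.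
have [rho1 rho2] : rho < - x0 /\ rho < x1.
  by move: rhomin; rewrite lt_min ltr0_norm// => /andP[].
have [dF dF1 cF2] := potential_primitive dw.
have [pR [kpR [LR [tailR x1L]]]] := tail_right dw.
have [pL [kpL [LL [tailL x0L]]]] := tail_left dw.
(* The primitives and solutions are chosen for all eps at once; for eps <= 0 the requirement is
   empty and dummy values are used. *)
pose Good (eps : R) (q : (R -> R) * (R -> R) * (R * R) * ((R -> R) * (R -> R))) := 0 < eps ->
  let: (PP, SS, (lp, lm), (u, w)) := q in
  [/\ primitive PP (weight F eps), primitive SS (fun x => expR (F x / eps)),
      PP x @[x --> +oo] --> lp & PP x @[x --> -oo] --> lm] /\
  (primitive u (fun y => eps^-1 * (expR (F y / eps) * (lp - PP y))) /\
   primitive w (fun y => eps^-1 * (expR (F y / eps) * (PP y - lm)))).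
have [D hD] : {f & forall eps, Good eps (f eps)}.
  apply: choice => eps; have [eps0|neps] := pselect (0 < eps); last first.
    by exists (id, id, (0, 0), (id, id)).
  have [PP [SS [lp [lm [h1 h2 h3 h4]]]]] := weight_primitives dw eps0.
  have cE : continuous (fun x => expR (F x / eps)).
    move=> x; apply: (continuous_comp (f := fun x => F x / eps)); last exact: continuous_expR.
    by apply: cvgM; [exact: (primitive_continuous dF)|exact: cvg_cst].
  have cP := primitive_continuous h1.
  have [u du] : exists u, primitive u (fun y => eps^-1 * (expR (F y / eps) * (lp - PP y))).
    apply: primitive_exists => y; apply: cvgM; first exact: cvg_cst.
    apply: cvgM; first exact: cE.
    by apply: cvgB; [exact: cvg_cst|exact: cP].
  have [w dw'] : exists w, primitive w (fun y => eps^-1 * (expR (F y / eps) * (PP y - lm))).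
    apply: primitive_exists => y; apply: cvgM; first exact: cvg_cst.
    apply: cvgM; first exact: cE.
    by apply: cvgB; [exact: cP|exact: cvg_cst].
  by exists (PP, SS, (lp, lm), (u, w)).
pose PP eps := (D eps).1.1.1; pose SS eps := (D eps).1.1.2.
pose lp eps := (D eps).1.2.1; pose lm eps := (D eps).1.2.2.
pose u eps := (D eps).2.1; pose w eps := (D eps).2.2.
have {}hD eps : 0 < eps -> [/\ primitive (PP eps) (weight F eps),
   primitive (SS eps) (fun x => expR (F x / eps)),
   PP eps x @[x --> +oo] --> lp eps & PP eps x @[x --> -oo] --> lm eps] /\
  (primitive (u eps) (fun y => eps^-1 * (expR (F y / eps) * (lp eps - PP eps y))) /\
   primitive (w eps) (fun y => eps^-1 * (expR (F y / eps) * (PP eps y - lm eps)))).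
  move=> eps0; have := hD eps eps0; rewrite /PP /SS /lp /lm /u /w.
  by case: (D eps) => [[[? ?] [? ?]] [? ?]].
pose Hp eps := at_pinfty (eta eps); pose Hm eps := `|at_ninfty (eta eps)|.
pose eta1 eps := derive1 (eta eps); pose eta2 eps := derive1 (derive1 (eta eps)).
have sd eps : 0 < eps -> spectral_data F (derive1 F) eps (PP eps) (SS eps) (lp eps) (lm eps)
    (eta eps) (eta1 eps) (eta2 eps) (lambda eps) (Hp eps) (Hm eps).
  move=> eps0; have [h1 h2 h3] := eig _ eps0; have [[? ? ? ?] _] := hD _ eps0.
  exact: spectral_data_of.
have decl := potential_decl dw; have inc := potential_inc dw.
have dec := potential_dec dw; have incr := potential_incr dw.
have hA := flux_left_lim dF tailR tailL x00 x10 x1L x0L decl inc dec incr sinc sdec F01 sd.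
have hN := right_mass0_lim dF tailR x00 x1L inc dec incr sinc F01 sd.
have hr := eta_ratio_lim dF tailR tailL x00 x10 x1L x0L decl inc dec incr sinc sdec F01 sd.
have hu b x0b b0 := right_exit_lim dF tailR tailL x00 x10 x1L x0L decl inc dec incr sinc sdec F01 sd (b := b) x0b b0 (fun eps eps0 => (hD eps eps0).2.1).
have hw c c0 cx1 := left_exit_lim dF tailR tailL x00 x10 x1L x0L decl inc dec incr sinc sdec F01 sd (c := c) c0 cx1 (fun eps eps0 => (hD eps eps0).2.2).
pose mR eps := mean_hitting_time (PX eps x1) (@Xst eps x1) (ball x0 rho).
pose mL eps := mean_hitting_time (PX eps x0) (@Xst eps x0) (ball x1 rho).
have finite_between (y z : R) (m : \bar R) : (y%:E <= m)%E -> (m <= z%:E)%E ->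
    m \is a fin_num /\ y <= fine m <= z.
  by case: m => [m| |]//; rewrite ?leye_eq// !lee_fin => -> ->.
have mRb eps : 0 < eps -> mR eps \is a fin_num /\
    u eps x1 - u eps (x0 + rho) <= fine (mR eps) <= u eps x1 - u eps x0.
  move=> eps0; have [[h1 h2 h3 h4] [h5 h6]] := hD _ eps0; apply: finite_between.
    have lt1 : x0 + rho < x1 by lra.
    exact: (exit_right_ge dw eps0 h1 h2 h3 h5 (diff _ _ eps0) lt1).
  exact: (exit_right_le dw eps0 h1 h2 h3 h5 rho0 (diff _ _ eps0)).
have mLb eps : 0 < eps -> mL eps \is a fin_num /\
    w eps (x1 - rho) - w eps x0 <= fine (mL eps) <= w eps x1 - w eps x0.
  move=> eps0; have [[h1 h2 h3 h4] [h5 h6]] := hD _ eps0; apply: finite_between.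
    have lt1 : x0 < x1 - rho by lra.
    exact: (exit_left_ge dw eps0 h1 h2 h4 h6 (diff _ _ eps0) lt1).
  exact: (exit_left_le dw eps0 h1 h2 h4 h6 rho0 (diff _ _ eps0)).
have lam0 eps : 0 < eps -> 0 < lambda eps by move=> eps0; exact: sd_lam (sd _ eps0).
have Hp0 eps : 0 < eps -> 0 < Hp eps by move=> eps0; exact: sd_Hp0 (sd _ eps0).
have Hm0 eps : 0 < eps -> 0 < Hm eps by move=> eps0; exact: sd_Hm0 (sd _ eps0).
have near_pos : \forall eps \near (0 : R)^'+, 0 < eps.
  by have := near0_pos (@ltr01 R); apply: filterS => eps /andP[].
(* Squeezed between the two starting points b = x0 + rho and b = x0, for which the limit is the
   same. *)
have hkR : lim0 (fun eps => lambda eps * fine (mR eps)) 1.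
  apply: lim0_squeeze (hu (x0 + rho) _ _) (hu x0 _ _); rewrite ?lexx//; try lra.
  apply: filterS near_pos => eps eps0; have [_ /andP[h1 h2]] := mRb _ eps0.
  by rewrite !ler_wpM2l// ltW// lam0.
have hkL : lim0 (fun eps => lambda eps * fine (mL eps) * (Hm eps / Hp eps)) 1.
  apply: lim0_squeeze (hw (x1 - rho) _ _) (hw x1 _ _); rewrite ?lexx//; try lra.
  apply: filterS near_pos => eps eps0; have [_ /andP[h1 h2]] := mLb _ eps0.
  have r0 : 0 <= Hm eps / Hp eps by rewrite divr_ge0// ltW// ?Hm0 ?Hp0.
  by rewrite !ler_wpM2r// ler_wpM2l// ltW// lam0.
(* In these variables the mean holding times are (1 + (b / a) Hm / Hp) / lambda at 1 and (1 + (a /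
   b) Hp / Hm) / lambda at 0. *)
pose a eps := xi eps true * Hm eps; pose b eps := - xi eps false * Hp eps.
have xi_neg eps : 0 < eps -> xi eps false * xi eps true < 0 by move=> eps0; have [] := adm _ eps0.
have xi_neq eps j : 0 < eps -> xi eps j != 0.
  move=> eps0; apply/eqP => E; have := xi_neg _ eps0.
  by case: j E => ->; rewrite ?mulr0 ?mul0r ltxx.
have nz eps : 0 < eps -> a eps != 0 /\ b eps != 0.
  move=> eps0; rewrite /a /b !mulf_neq0 ?oppr_eq0 ?xi_neq//; first by rewrite gt_eqF// Hp0.
  by rewrite gt_eqF// Hm0.
have gap eps j : 0 < eps -> xi eps j - xi eps (~~ j) != 0.
  move=> eps0; rewrite subr_eq0; apply/eqP => E; have := xi_neg _ eps0.
  by case: j E => /= E; rewrite E -expr2 ltNge sqr_ge0.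
have rate0 eps j : 0 < eps -> 0 < rate (lambda eps) (xi eps) j.
  move=> eps0; rewrite /rate -mulrA mulr_gt0 ?lam0//.
  (* With a squared denominator, positivity follows from xi_0 xi_1 < 0. *)
  have e2 : xi eps j / (xi eps j - xi eps (~~ j)) =
      (xi eps j ^+ 2 - xi eps false * xi eps true) / (xi eps j - xi eps (~~ j)) ^+ 2.
    by case: j (gap _ j eps0) => /= gj; field.
  rewrite e2 divr_gt0//; last by rewrite exprn_even_gt0//= gap.
  by have := sqr_ge0 (xi eps j); have := xi_neg _ eps0; lra.
have mY eps j : 0 < eps ->
    mean_hitting_time (PY eps j) (@Yst eps j) [set ~~ j] = (1 / rate (lambda eps) (xi eps) j)%:E.
  move=> eps0; apply/eqP; rewrite eq_le.
  rewrite (chain_hitting_le (chain _ j eps0) (rate0 _ j eps0)).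
  by rewrite (chain_hitting_ge (chain _ j eps0) (rate0 _ j eps0)).
have := coupling_limits hA hN hr hkR hkL nz.
set c1 := lim0 _ 1; set c2 := lim0 _ 1; set c3 := lim0 _ 1; set c4 := lim0 _ 1.
set cb := lim0 b 1; set ca := lim0 a 1.
have flip_lim (f g : R -> R) : (forall eps, 0 < eps -> f eps = g eps) -> lim0 f 1 <-> lim0 g 1.
  by move=> fg; split; apply: lim0_eq => eps eps0; rewrite fg.
have Z0 eps : 0 < eps -> 0 < lp eps - lm eps.
  move=> eps0; have [[h1 _ h3 h4] _] := hD _ eps0.
  have hi := homo_le_lim 1 (weight_prim_nd h1) h3.
  have lo := weight_head_ge0 h1 h4 0.
  have [z _ hz] := primitive_MVT h1 (@ler01 R).
  by have := weight_gt0 F eps z; lra.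
have eb : cb <-> equivalent0 (xi ^~ false) (fun eps => - (at_pinfty (eta eps))^-1).
  by apply: flip_lim => eps eps0; rewrite /b -/(Hp eps) invrN invrK mulrN mulNr.
have ea : ca <-> equivalent0 (xi ^~ true) (fun eps => `|at_ninfty (eta eps)|^-1).
  by apply: flip_lim => eps eps0; rewrite /a invrK.
(* The law of the coupling turns the conditional probability into a Gibbs integral independent of t,
   so a single limit serves every t. *)
have e1 t : 0 <= t -> c1 <-> (cond_law F eps (tilt (eta eps) (xi eps)) (P eps) (@X eps) (@Y eps)
          t false `]-oo, 0[ @[eps --> 0^'+] --> (1 : R)).
  move=> t0; apply: flip_lim => eps eps0; rewrite law//.
  rewrite (gibbs_left dF eps0 tailL (sd _ eps0) (xi eps false)).
  rewrite /b; field.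
  by rewrite !gt_eqF ?Z0 ?Hp0 ?Hm0.
have e2 t : 0 <= t -> c2 <-> (cond_law F eps (tilt (eta eps) (xi eps)) (P eps) (@X eps) (@Y eps)
          t true `]0, +oo[ @[eps --> 0^'+] --> (1 : R)).
  move=> t0; apply: flip_lim => eps eps0; rewrite law//.
  rewrite (gibbs_right dF eps0 tailR (sd _ eps0) (xi eps true)).
  rewrite /a; field.
  by rewrite !gt_eqF ?Z0 ?Hm0.
have ereal_eq (f g : R -> \bar R) (h : R -> R) : (forall eps, 0 < eps -> f eps \is a fin_num /\ g eps \is a fin_num) ->
    (forall eps, 0 < eps -> h eps = fine (f eps) / fine (g eps)) ->
    lim0 h 1 <-> equivalent0_ereal f g.
  move=> fg hfg; have -> : equivalent0_ereal f g <-> lim0 (fun eps => fine (f eps) / fine (g eps)) 1.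
    split=> [[_ //]|h1]; split => //.
    by apply: filterS near_pos => eps /fg.
  exact: flip_lim.
have e3 : c3 <-> equivalent0_ereal
        (fun eps => mean_hitting_time (PY eps true) (@Yst eps true) [set false]) mR.
  apply: ereal_eq => eps eps0; rewrite (mY _ true eps0); first by have [] := mRb _ eps0.
  have g1 := gap _ true eps0; have x1' := xi_neq _ true eps0.
  rewrite /= !invfM /rate /= /a /b; move: ((fine (mR eps))^-1) => y.
  field.
  by rewrite x1' g1 !gt_eqF ?lam0 ?Hp0 ?Hm0.
have e4 : c4 <-> equivalent0_ereal
        (fun eps => mean_hitting_time (PY eps false) (@Yst eps false) [set true]) mL.
  apply: ereal_eq => eps eps0; rewrite (mY _ false eps0); first by have [] := mLb _ eps0.
  have g1 := gap _ false eps0; have x1' := xi_neq _ false eps0.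
  rewrite /= !invfM /rate /= /a /b; move: ((fine (mL eps))^-1) => y.
  field.
  by rewrite x1' g1 !gt_eqF ?lam0 ?Hp0 ?Hm0.
move=> main; split=> [[h1 h2 h3 h4]|[h1 h2]].
  have [hb ha] : cb /\ ca.
    apply/main; split; [exact/(e1 0)/h1|exact/(e2 0)/h2|exact/e3|exact/e4].
  by split; [exact/eb|exact/ea].
have [h1' h2' h3' h4'] : [/\ c1, c2, c3 & c4] by apply/main; split; [exact/eb|exact/ea].
split; [by move=> t t0; exact/(e1 t t0)|by move=> t t0; exact/(e2 t t0)|exact/e3|exact/e4].
Qed.
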